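(* Let $k\ge1$ be an odd integer, and let $\chi_1,\chi_2$ be primitive Dirichlet characters modulo $p$ and $q$ respectively, such that either both are non-principal even characters or both are odd characters. Let $a,x>0$. Then for every complex $\nu$ with $\Re(\nu)>0$, \begin{align*} \sum_{n=1}^\infty \sigma_{k,\chi_1,\chi_2}(n)n^{\frac{\nu}{2}}K_\nu(a\sqrt{nx})=\frac{(-1)^{\frac{k+1}{2}}(aq)^\nu p^{\nu+k} x^{\frac{\nu}{2}}}{2^{3\nu+k+2}\pi^{2\nu+k+1}} \tau(\chi_1)\tau(\chi_2)\Gamma(\nu+k+1)\sum_{n=1}^\infty \frac{\sigma_{k,\bar{\chi}_2,\bar{\chi}_1}(n)} {\left( n+\frac{a^2pqx}{16\pi^2} \right)^{\nu+k+1} }. \end{align*}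
   Context: For Dirichlet characters $\chi_1,\chi_2$ and $z\in\mathbb{C}$: $\sigma_{z,\chi_1,\chi_2}(n)=\sum_{d\mid n}d^z\chi_1(d)\chi_2(n/d)$. $\tau(\chi)=\sum_{h=1}^q\chi(h)e^{2\pi i h/q}$ is the Gauss sum of a character $\chi$ modulo $q$, and $K_\nu$ is the modified Bessel function of the second kind. *)

(* Defs.v *)
From Stdlib Require Import Reals Arith.
From Coquelicot Require Import Coquelicot.
Open Scope R_scope.

Definition Cexp (z : C) : C :=
  (exp (Re z) * cos (Im z), exp (Re z) * sin (Im z)).

Definition Rcpow (x : R) (s : C) : C := Cexp (s * RtoC (ln x))%C.

(* Dirichlet character modulo q, as a function on nat (values on all integers
   are determined by periodicity) *)
Definition is_dirichlet_char (q : nat) (chi : nat -> C) : Prop :=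
  (0 < q)%nat /\ chi 1%nat = 1%C /\
  (forall m n, chi (m * n)%nat = (chi m * chi n)%C) /\
  (forall n, chi (n + q)%nat = chi n) /\
  (forall n, chi n = 0%C <-> Nat.gcd n q <> 1%nat).

Definition is_principal (q : nat) (chi : nat -> C) : Prop :=
  forall n, Nat.gcd n q = 1%nat -> chi n = 1%C.

(* primitive: not induced by any character of modulus a proper divisor d of q,
   i.e. for every proper divisor d there is n coprime to q, n = 1 mod d,
   with chi n <> 1 *)
Definition is_primitive_char (q : nat) (chi : nat -> C) : Prop :=
  is_dirichlet_char q chi /\
  forall d, Nat.divide d q -> (d < q)%nat ->
    exists n, Nat.gcd n q = 1%nat /\ n mod d = 1 mod d /\ chi n <> 1%C.

(* chi(-1) = chi(q-1) *)
Definition is_even_char (q : nat) (chi : nat -> C) : Prop := chi (q - 1)%nat = 1%C.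
Definition is_odd_char (q : nat) (chi : nat -> C) : Prop := chi (q - 1)%nat = (-1)%C.

Definition conj_char (chi : nat -> C) : nat -> C := fun n => Cconj (chi n).

Definition sigma_char (z : C) (chi1 chi2 : nat -> C) (n : nat) : C :=
  sum_n (fun j => let d := S j in
           if Nat.eqb (n mod d) 0
           then (Rcpow (INR d) z * chi1 d * chi2 (n / d)%nat)%C
           else RtoC 0) (pred n).

Definition gauss_sum (q : nat) (chi : nat -> C) : C :=
  sum_n (fun j => let h := S j in
           (chi h * Cexp (0%R, (2 * PI * INR h / INR q)%R))%C) (pred q).

Definition CGamma (s : C) : C :=
  @RInt_gen C_R_CompleteNormedModule (fun t => (Rcpow t (s - 1) * RtoC (exp (- t)))%C)
    (at_right 0) (Rbar_locally p_infty).

Definition BesselK (nu : C) (x : R) : C :=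
  @RInt_gen C_R_CompleteNormedModule (fun t => (RtoC (exp (- x * cosh t)) *
                      ((Cexp (nu * RtoC t) + Cexp (- (nu * RtoC t))) / 2))%C)
    (at_point 0) (Rbar_locally p_infty).

(* Main.v *)
Require Import Defs.
From Stdlib Require Import Reals Arith Lra Lia List Permutation Classical ClassicalEpsilon.
From Coquelicot Require Import Coquelicot.
Open Scope R_scope.

(** With [y = e^t] and [B = a^2 x / 4], the Bessel term [n^(nu/2) K_nu (a sqrt (n x))] is a constant
    times the integral over [y > 0] of [e^(-n y) e^(-B/y) y^(-nu-1)], and the terms on the right are the
    same integral with [e^(-n y)] replaced by [y^(-k-1) e^(-4 pi^2 n / (p q y))].  So the formula is
    the integrated form of the modular relation, of weight [k + 1], between the Lambert series
    [sum sigma_{k,chi1,chi2}(n) e^(-n y)] and its dual under [y -> 4 pi^2 / (p q y)].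

    The modular relation follows by expanding one of the two sums of the Lambert series with the
    Lipschitz formula [sum_d d^k e^(-d w) = k! sum_l (w + 2 pi i l)^(-k-1)], twisted by a primitive
    character through Gauss sums, exchanging the two sums, and using the Lipschitz formula backwards.
    For [k = 1] the double series converges only conditionally; grouping one variable into full
    periods of a non-principal character restores absolute convergence.  The Lipschitz formula
    for [k = 1] is obtained by Herglotz's trick and for larger [k] by difference quotients. *)

(** * Sequences and series of complex numbers *)

(** Behind the modular relation stands one lattice sum: the kernel
    [(u - i v)^(-k-1) + eps (u + i v)^(-k-1)] at [u = m y], [v = 2 pi l / p], weighted by [chi2 m]
    and the conjugate of [chi1 l], where [eps] is the common value of the characters at -1. Summed
    over [l] it is a Lipschitz expansion for [chi1], summed over [m] one for [chi2], because
    exchanging [u] and [v] only costs the factor [eps (-1)^((k+1)/2)]. This is where equal parity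
    and the oddness of [k] enter.

    The integration exchanges a sum with an improper integral. Both sides are series in [t = ln y]
    with the same pointwise sum, so it is enough to bound the terms by [c_n e^(-al |t|)] with [c_n]
    summable. The factor [e^(-B/y)] supplies any power of [y] near 0, and the divisor sums are
    summable against [n^(-k-1-eta)] for every [eta > 0]; the choice [eta = Re nu / 2] leaves decay
    at both ends because [Re nu > 0].

    The Gauss sum of the conjugate of [chi1] ends up on the Bessel side; the product formula for
    conjugate Gauss sums turns it into [tau(chi1)] on the other side. *)

Fixpoint csum (f : nat -> C) (n : nat) : C :=
  match n with O => RtoC 0 | S m => (csum f m + f m)%C end.

Fixpoint rsum (f : nat -> R) (n : nat) : R :=
  match n with O => 0 | S m => rsum f m + f m end.

Definition Ccv (s : nat -> C) (l : C) : Prop :=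
  forall eps : R, 0 < eps ->
    exists N : nat, forall n : nat, (N <= n)%nat -> Cmod (s n - l)%C < eps.

Definition Csum (a : nat -> C) (l : C) : Prop := Ccv (csum a) l.

Lemma csum_ext f g n : (forall i, (i < n)%nat -> f i = g i) -> csum f n = csum g n.
Proof.
  induction n as [|n IH]; intros H; simpl; auto.
  rewrite IH, H; auto.
Qed.

Lemma rsum_ext f g n : (forall i, (i < n)%nat -> f i = g i) -> rsum f n = rsum g n.
Proof.
  induction n as [|n IH]; intros H; simpl; auto.
  rewrite IH, H; auto.
Qed.

Lemma csum_plus f g n : csum (fun i => f i + g i)%C n = (csum f n + csum g n)%C.
Proof. induction n as [|n IH]; simpl; [ring | rewrite IH; ring]. Qed.

Lemma csum_minus f g n : csum (fun i => f i - g i)%C n = (csum f n - csum g n)%C.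
Proof. induction n as [|n IH]; simpl; [ring | rewrite IH; ring]. Qed.

Lemma csum_scal c f n : csum (fun i => c * f i)%C n = (c * csum f n)%C.
Proof. induction n as [|n IH]; simpl; [ring | rewrite IH; ring]. Qed.

Lemma csum_zero n : csum (fun _ => RtoC 0) n = RtoC 0.
Proof. induction n as [|n IH]; simpl; [ring | rewrite IH; ring]. Qed.

Lemma rsum_scal c f n : rsum (fun i => c * f i) n = c * rsum f n.
Proof. induction n as [|n IH]; simpl; [ring | rewrite IH; ring]. Qed.

Lemma rsum_const c n : rsum (fun _ => c) n = INR n * c.
Proof. induction n as [|n IH]; [simpl; ring | rewrite S_INR; simpl; rewrite IH; ring]. Qed.

Lemma csum_const c n : csum (fun _ => c) n = (RtoC (INR n) * c)%C.
Proof.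
  induction n as [|n IH]; [simpl; ring | rewrite S_INR, RtoC_plus; simpl; rewrite IH; ring].
Qed.

Lemma rsum_le f g n : (forall i, (i < n)%nat -> f i <= g i) -> rsum f n <= rsum g n.
Proof.
  induction n as [|n IH]; intros H; simpl; [lra|].
  apply Rplus_le_compat; auto.
Qed.

Lemma rsum_mono f n m : (forall i, 0 <= f i) -> (n <= m)%nat -> rsum f n <= rsum f m.
Proof.
  intros H L; induction L; simpl; [lra|]. specialize (H m); lra.
Qed.

Lemma rsum_pos f n : (forall i, 0 <= f i) -> 0 <= rsum f n.
Proof. intros H; apply (rsum_mono f 0 n H); lia. Qed.

Lemma Cmod_csum f n : Cmod (csum f n) <= rsum (fun i => Cmod (f i)) n.
Proof.
  induction n as [|n IH]; simpl; [rewrite Cmod_0; lra|].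
  eapply Rle_trans; [apply Cmod_triangle|]; lra.
Qed.

Lemma csum_swap f n m :
  csum (fun i => csum (fun j => f i j) m) n = csum (fun j => csum (fun i => f i j) n) m.
Proof.
  induction n as [|n IH]; simpl.
  - now rewrite csum_zero.
  - rewrite IH; symmetry; apply csum_plus.
Qed.

Lemma csum_RtoC (f : nat -> R) n : csum (fun i => RtoC (f i)) n = RtoC (rsum f n).
Proof. induction n as [|n IH]; simpl; [|rewrite IH, RtoC_plus]; auto. Qed.

Lemma csum_app f n m : csum f (n + m) = (csum f n + csum (fun i => f (n + i)%nat) m)%C.
Proof.
  induction m as [|m IH]; [rewrite Nat.add_0_r; simpl; ring|].
  rewrite Nat.add_succ_r; simpl; rewrite IH; ring.
Qed.

Lemma csum_shift f n : csum f (S n) = (f O + csum (fun i => f (S i)) n)%C.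
Proof. change (S n) with (1 + n)%nat; rewrite csum_app; simpl; ring. Qed.

Lemma sum_n_csum (f : nat -> C) n : sum_n f n = csum f (S n).
Proof.
  induction n as [|n IH].
  - rewrite sum_O; simpl; ring.
  - rewrite sum_Sn, IH; reflexivity.
Qed.

Lemma sum_n_rsum (f : nat -> R) n : sum_n f n = rsum f (S n).
Proof.
  induction n as [|n IH].
  - rewrite sum_O; simpl; ring.
  - rewrite sum_Sn, IH; reflexivity.
Qed.

Lemma Csum_is_series a l : Csum a l <-> is_series a l.
Proof.
  split; intros H.
  - apply filterlim_locally; intros eps.
    destruct (H eps (cond_pos eps)) as [N HN].
    exists N; intros n Hn.
    apply C_NormedModule_mixin_compat1.
    rewrite sum_n_csum. apply HN; lia.
  - intros eps He.
    (* Balls in [C] are those of the product of two real lines; passing from them to [Cmod] costs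
       the factor [sqrt 2]. *)
    assert (Hs : 0 < sqrt 2) by (apply sqrt_lt_R0; lra).
    assert (He' : 0 < eps / sqrt 2) by (apply Rdiv_lt_0_compat; lra).
    generalize (proj1 (filterlim_locally _ _) H (mkposreal _ He')); intros [N HN].
    exists (S N); intros n Hn.
    destruct n as [|n]; [lia|].
    specialize (HN n ltac:(lia)).
    apply C_NormedModule_mixin_compat2 in HN.
    rewrite sum_n_csum in HN. simpl pos in HN.
    replace (sqrt 2 * (eps / sqrt 2)) with eps in HN by (field; lra).
    exact HN.
Qed.

(** * Limits of complex sequences *)

Lemma Ccv_ext s t l : (forall n, s n = t n) -> Ccv s l -> Ccv t l.
Proof. intros E H eps He; destruct (H eps He) as [N HN]; exists N; intros; rewrite <- E; auto. Qed.

Lemma Ccv_unique s l l' : Ccv s l -> Ccv s l' -> l = l'.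
Proof.
  intros H H'. apply NNPP; intros D.
  assert (P : 0 < Cmod (l - l')%C).
  { apply Cmod_gt_0; intros E; apply D.
    replace l with (l - l' + l')%C by ring; rewrite E; ring. }
  destruct (H (Cmod (l - l')%C / 2) ltac:(lra)) as [N HN].
  destruct (H' (Cmod (l - l')%C / 2) ltac:(lra)) as [N' HN'].
  specialize (HN (N + N')%nat ltac:(lia)); specialize (HN' (N + N')%nat ltac:(lia)).
  assert (T := Cmod_triangle (- (s (N + N')%nat - l))%C (s (N + N')%nat - l')%C).
  rewrite Cmod_opp in T.
  replace (- (s (N + N')%nat - l) + (s (N + N')%nat - l'))%C with (l - l')%C in T by ring.
  lra.
Qed.

Lemma Ccv_plus s t l m : Ccv s l -> Ccv t m -> Ccv (fun n => s n + t n)%C (l + m)%C.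
Proof.
  intros H H' eps He.
  destruct (H (eps / 2) ltac:(lra)) as [N HN]; destruct (H' (eps / 2) ltac:(lra)) as [N' HN'].
  exists (N + N')%nat; intros n Hn.
  specialize (HN n ltac:(lia)); specialize (HN' n ltac:(lia)).
  replace (s n + t n - (l + m))%C with ((s n - l) + (t n - m))%C by ring.
  eapply Rle_lt_trans; [apply Cmod_triangle|]; lra.
Qed.

Lemma Ccv_scal c s l : Ccv s l -> Ccv (fun n => c * s n)%C (c * l)%C.
Proof.
  intros H eps He.
  assert (P := Cmod_ge_0 c).
  destruct (H (eps / (Cmod c + 1))) as [N HN]; [apply Rdiv_lt_0_compat; lra|].
  exists N; intros n Hn; specialize (HN n Hn).
  replace (c * s n - c * l)%C with (c * (s n - l))%C by ring.
  rewrite Cmod_mult.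
  apply (Rmult_lt_compat_l (Cmod c + 1)) in HN; [|lra].
  replace ((Cmod c + 1) * (eps / (Cmod c + 1))) with eps in HN by (field; lra).
  assert (Q := Cmod_ge_0 (s n - l)%C). nra.
Qed.

Lemma Ccv_const c : Ccv (fun _ => c) c.
Proof.
  intros eps He; exists O; intros; replace (c - c)%C with (RtoC 0) by ring; now rewrite Cmod_0.
Qed.

Lemma Ccv_minus s t l m : Ccv s l -> Ccv t m -> Ccv (fun n => s n - t n)%C (l - m)%C.
Proof.
  intros H H'.
  replace (l - m)%C with (l + (-1) * m)%C by ring.
  eapply Ccv_ext; [|exact (Ccv_plus _ _ _ _ H (Ccv_scal (-1)%C _ _ H'))].
  intros n; simpl; ring.
Qed.

(** [f] only has to tend to infinity; it may repeat values, as [n / S d] does in the divisor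
    sums. *)
Lemma Ccv_subseq s l (f : nat -> nat) :
  (forall K, exists N, forall n, (N <= n)%nat -> (K <= f n)%nat) ->
  Ccv s l -> Ccv (fun n => s (f n)) l.
Proof.
  intros Hf H eps He; destruct (H eps He) as [N HN]; destruct (Hf N) as [M HM].
  exists M; intros; apply HN; auto.
Qed.

Lemma Ccv_incr s l : Ccv (fun n => s (S n)) l -> Ccv s l.
Proof.
  intros H eps He; destruct (H eps He) as [N HN].
  exists (S N); intros [|n] Hn; [lia|]. apply HN; lia.
Qed.

Lemma Ccv_bound s l B D : (forall n, (D <= n)%nat -> Cmod (s n) <= B) -> Ccv s l -> Cmod l <= B.
Proof.
  intros HB H. apply Rnot_lt_le; intros Hlt.
  destruct (H (Cmod l - B) ltac:(lra)) as [N HN].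
  specialize (HN (N + D)%nat ltac:(lia)); specialize (HB (N + D)%nat ltac:(lia)).
  assert (T := Cmod_triangle (s (N + D)%nat) (- (s (N + D)%nat - l))%C).
  rewrite Cmod_opp in T.
  replace (s (N + D)%nat + - (s (N + D)%nat - l))%C with l in T by ring. lra.
Qed.

Lemma Ccv_squeeze s (b : nat -> R) :
  (forall n, Cmod (s n) <= b n) -> is_lim_seq b 0 -> Ccv s (RtoC 0).
Proof.
  intros H L eps He.
  apply is_lim_seq_spec in L. destruct (L (mkposreal eps He)) as [N HN].
  exists N; intros n Hn. specialize (HN n Hn); simpl in HN.
  replace (s n - 0)%C with (s n) by ring.
  rewrite Rminus_0_r in HN. specialize (H n). apply Rabs_def2 in HN. lra.
Qed.

(** * Convergent complex series, majorants and exchange of sums *)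

Lemma Csum_ext a b l : (forall n, a n = b n) -> Csum a l -> Csum b l.
Proof. intros E; apply Ccv_ext; intros n; apply csum_ext; auto. Qed.

Lemma Csum_unique a l l' : Csum a l -> Csum a l' -> l = l'.
Proof. apply Ccv_unique. Qed.

Lemma Csum_plus a b l m : Csum a l -> Csum b m -> Csum (fun n => a n + b n)%C (l + m)%C.
Proof.
  intros H H'; eapply Ccv_ext; [|exact (Ccv_plus _ _ _ _ H H')].
  intros n; now rewrite csum_plus.
Qed.

Lemma Csum_minus a b l m : Csum a l -> Csum b m -> Csum (fun n => a n - b n)%C (l - m)%C.
Proof.
  intros H H'; eapply Ccv_ext; [|exact (Ccv_minus _ _ _ _ H H')].
  intros n; now rewrite csum_minus.
Qed.

Lemma Csum_scal c a l : Csum a l -> Csum (fun n => c * a n)%C (c * l)%C.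
Proof.
  intros H; eapply Ccv_ext; [|exact (Ccv_scal c _ _ H)].
  intros n; now rewrite csum_scal.
Qed.

Lemma Csum_zero : Csum (fun _ => RtoC 0) (RtoC 0).
Proof. eapply Ccv_ext; [|apply Ccv_const]. intros n; now rewrite csum_zero. Qed.

Lemma Csum_csum (a : nat -> nat -> C) (l : nat -> C) n :
  (forall i, (i < n)%nat -> Csum (a i) (l i)) -> Csum (fun j => csum (fun i => a i j) n) (csum l n).
Proof.
  induction n as [|n IH]; intros H; simpl; [apply Csum_zero|].
  apply (Csum_plus (fun j => csum (fun i => a i j) n)); auto.
Qed.

Lemma Csum_finite a n : (forall i, (n <= i)%nat -> a i = RtoC 0) -> Csum a (csum a n).
Proof.
  intros H eps He; exists n; intros m Hm.
  replace (csum a m) with (csum a n).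
  - replace (csum a n - csum a n)%C with (RtoC 0) by ring; now rewrite Cmod_0.
  - induction Hm; auto. simpl. rewrite <- IHHm, H; auto. ring.
Qed.

(** Grouping passes to the subsequence of partial sums at multiples of [q], so conditional
    convergence suffices. *)
Lemma Csum_group a l q :
  (0 < q)%nat -> Csum a l -> Csum (fun M => csum (fun h => a (q * M + h)%nat) q) l.
Proof.
  intros Hq H.
  assert (E : forall M, csum (fun M => csum (fun h => a (q * M + h)%nat) q) M = csum a (q * M)).
  { induction M as [|M IH]; simpl.
    - now rewrite Nat.mul_0_r.
    - rewrite IH. replace (q * S M)%nat with (q * M + q)%nat by lia.
      now rewrite csum_app. }
  eapply Ccv_ext; [intros n; symmetry; apply E|].
  apply (Ccv_subseq (csum a) l (fun n => (q * n)%nat)); auto.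
  intros K; exists K; intros; nia.
Qed.

Lemma rsum_le_series b L n : (forall i, 0 <= b i) -> is_series b L -> rsum b n <= L.
Proof.
  intros P H.
  assert (H' : is_lim_seq (fun n => rsum b (S n)) L).
  { eapply is_lim_seq_ext; [|exact H]. intros m; now rewrite sum_n_rsum. }
  eapply Rle_trans; [|apply (is_lim_seq_incr_compare (fun n => rsum b (S n)) L H')].
  - apply rsum_mono; auto.
  - intros m; apply rsum_mono; auto.
Qed.

Lemma rsum_cv b L : is_series b L -> is_lim_seq (rsum b) L.
Proof.
  intros H. apply is_lim_seq_incr_1. eapply is_lim_seq_ext; [|exact H].
  intros m; now rewrite sum_n_rsum.
Qed.

Lemma ex_series_bounded b M :
  (forall i, 0 <= b i) -> (forall n, rsum b n <= M) -> ex_series b.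
Proof.
  intros P H.
  destruct (ex_finite_lim_seq_incr (fun n => rsum b (S n)) M) as [l Hl].
  - intros n; apply rsum_mono; auto.
  - intros n; apply H.
  - exists l. eapply filterlim_ext; [|exact Hl]. intros n; symmetry; apply sum_n_rsum.
Qed.

Lemma Csum_ex a b : (forall n, Cmod (a n) <= b n) -> ex_series b -> exists l, Csum a l.
Proof.
  intros H Hb.
  destruct (ex_series_le (K := C_AbsRing) (V := C_CompleteNormedModule) a b) as [l Hl].
  - exact H.
  - exact Hb.
  - exists l; now apply Csum_is_series.
Qed.

Lemma rsum_diff_csum a b n m :
  (forall n, Cmod (a n) <= b n) -> (n <= m)%nat ->
  Cmod (csum a m - csum a n)%C <= rsum b m - rsum b n.
Proof.
  intros H L. induction L as [|m L IH].
  - replace (csum a n - csum a n)%C with (RtoC 0) by ring; rewrite Cmod_0; lra.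
  - simpl. replace (csum a m + a m - csum a n)%C with ((csum a m - csum a n) + a m)%C by ring.
    eapply Rle_trans; [apply Cmod_triangle|]. specialize (H m); lra.
Qed.

Lemma Csum_tail a b l L n :
  (forall n, Cmod (a n) <= b n) -> Csum a l -> is_series b L ->
  Cmod (l - csum a n)%C <= L - rsum b n.
Proof.
  intros H Ha Hb.
  apply (Ccv_bound (fun m => csum a m - csum a n)%C _ _ n).
  - intros m Hm. eapply Rle_trans; [apply (rsum_diff_csum _ _ _ _ H Hm)|].
    assert (rsum b m <= L); [|lra].
    apply rsum_le_series; auto.
    intros i; eapply Rle_trans; [apply Cmod_ge_0 | apply H].
  - apply Ccv_minus; [exact Ha | apply Ccv_const].
Qed.

Lemma Csum_bound a b l L :
  (forall n, Cmod (a n) <= b n) -> Csum a l -> is_series b L -> Cmod l <= L.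
Proof.
  intros H Ha Hb. generalize (Csum_tail a b l L 0 H Ha Hb); simpl.
  replace (l - 0)%C with l by ring. lra.
Qed.

Lemma Csum_terms a l : Csum a l -> Ccv a (RtoC 0).
Proof.
  intros H. replace (RtoC 0) with (l - l)%C by ring.
  eapply Ccv_ext; [|apply Ccv_minus; [|exact H]].
  2: apply (Ccv_subseq (csum a) l S); [intros K; exists K; intros; lia | exact H].
  intros n; simpl; ring.
Qed.

Lemma ex_series_scal_R (c : R) a : ex_series a -> ex_series (fun n => c * a n).
Proof. exact (ex_series_scal (V := R_NormedModule) c a). Qed.

Lemma ex_series_le_R (a b : nat -> R) :
  (forall n, 0 <= a n <= b n) -> ex_series b -> ex_series a.
Proof.
  intros H [L HL]. apply (ex_series_bounded a L); [apply H|].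
  intros n. eapply Rle_trans; [apply rsum_le; intros; apply H|].
  apply rsum_le_series; auto. intros i; specialize (H i); lra.
Qed.

(** Tannery's theorem. Cut at a [D] beyond which the tail of the majorant is below [eps / 4]: the
    two tails are small uniformly in [N], and the finite head converges term by term. *)
Lemma Csum_tannery (S : nat -> nat -> C) (A : nat -> R) (c s : nat -> C) (t : C) :
  (forall N d, Cmod (S N d) <= A d) -> ex_series A ->
  (forall d, Ccv (fun N => S N d) (c d)) ->
  (forall N, Csum (S N) (s N)) -> Csum c t -> Ccv s t.
Proof.
  intros HA [L HL] Hc Hs Ht eps He.
  (* The majorant passes to the pointwise limits, so the tail of [c] is controlled as well. *)
  assert (HcA : forall d, Cmod (c d) <= A d).
  { intros d. apply (Ccv_bound (fun N => S N d) _ _ O); auto. }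
  assert (T := rsum_cv _ _ HL). apply is_lim_seq_spec in T.
  assert (He4 : 0 < eps / 4) by lra.
  destruct (T (mkposreal _ He4)) as [D HD]. specialize (HD D (Nat.le_refl D)).
  simpl in HD. apply Rabs_def2 in HD.
  assert (HF : Ccv (fun N => csum (S N) D) (csum c D)).
  { clear -Hc. induction D as [|D IH]; simpl; [apply Ccv_const|].
    apply (Ccv_plus (fun N => csum (S N) D)); auto. }
  destruct (HF (eps / 4) He4) as [N HN].
  exists N; intros n Hn. specialize (HN n Hn).
  assert (T1 := Csum_tail _ _ _ _ D (HA n) (Hs n) HL).
  assert (T2 := Csum_tail _ _ _ _ D HcA Ht HL).
  replace (s n - t)%C with ((s n - csum (S n) D) + ((csum (S n) D - csum c D) + - (t - csum c D)))%C
    by ring.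
  eapply Rle_lt_trans; [apply Cmod_triangle|].
  eapply Rle_lt_trans; [apply Rplus_le_compat_l, Cmod_triangle|].
  rewrite Cmod_opp. lra.
Qed.

(** The partial sums over [n] of each column are dominated by [A], uniformly in their length, so the
    exchange is an instance of Tannery's theorem with the column sums as pointwise limits. *)
Lemma Csum_fubini (c : nat -> nat -> C) (A : nat -> R) (r t : nat -> C) (s : C) :
  (forall d n, rsum (fun n => Cmod (c n d)) n <= A d) -> ex_series A ->
  (forall n, Csum (c n) (r n)) -> (forall d, Csum (fun n => c n d) (t d)) ->
  Csum t s -> Csum r s.
Proof.
  intros HA HexA Hr Ht Hs.
  apply (Csum_tannery (fun N d => csum (fun n => c n d) N) A t (csum r) s); auto.
  - intros N d. eapply Rle_trans; [apply Cmod_csum | apply HA].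
  - intros N.
    apply (Csum_csum (fun n d => c n d) r N). auto.
Qed.

Lemma Csum_fubini_prod (c : nat -> nat -> C) (u v : nat -> R) (r t : nat -> C) (s : C) :
  (forall n d, Cmod (c n d) <= u n * v d) ->
  (forall n, 0 <= u n) -> (forall d, 0 <= v d) -> ex_series u -> ex_series v ->
  (forall n, Csum (c n) (r n)) -> (forall d, Csum (fun n => c n d) (t d)) ->
  Csum t s -> Csum r s.
Proof.
  intros H Pu Pv [U HU] Hv.
  apply (Csum_fubini c (fun d => U * v d)).
  - intros d n.
    apply Rle_trans with (rsum (fun n => v d * u n) n).
    + apply rsum_le; intros; rewrite Rmult_comm; auto.
    + rewrite rsum_scal, Rmult_comm. apply Rmult_le_compat_r; auto.
      apply rsum_le_series; auto.
  - now apply ex_series_scal_R.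
Qed.

Lemma Cmod_RtoC_pos x : 0 <= x -> Cmod (RtoC x) = x.
Proof. intros H; rewrite Cmod_R; now apply Rabs_pos_eq. Qed.

(** Turns a family of existing sums into a function giving the sums. *)
Lemma choose_fun {A T} (P : A -> T -> Prop) :
  (forall n, exists y, P n y) -> exists f, forall n, P n (f n).
Proof.
  intros H. exists (fun n => proj1_sig (constructive_indefinite_description _ (H n))).
  intros n. apply proj2_sig.
Qed.

(** * Real powers and the complex exponential *)

Lemma INR_S_pos n : 0 < INR (S n).
Proof. apply lt_0_INR; lia. Qed.

Lemma Rpower_pos x y : 0 < Rpower x y.
Proof. apply exp_pos. Qed.

Lemma ln_le_sub_1 x : 0 < x -> ln x <= x - 1.
Proof.
  intros H. destruct (Req_dec x 1) as [->|N]; [rewrite ln_1; lra|].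
  assert (T : ln x <> 0) by (intros E; apply N; apply ln_inv; try lra; now rewrite ln_1).
  generalize (exp_ineq1 (ln x) T). rewrite exp_ln; lra.
Qed.

(* The summand is dominated by the telescoping difference n^(-e) - (n+1)^(-e). *)
Lemma ex_series_Rpower e : 0 < e -> ex_series (fun n => Rpower (INR (S n)) (- (1 + e))).
Proof.
  intros He.
  assert (St : forall n, e * Rpower (INR (S (S n))) (- (1 + e))
                         <= Rpower (INR (S n)) (- e) - Rpower (INR (S (S n))) (- e)).
  { intros n. set (x := INR (S n)). set (y := INR (S (S n))).
    assert (Hx : 0 < x) by apply INR_S_pos.
    assert (Hy : y = x + 1) by (unfold x, y; rewrite (S_INR (S n)); ring).
    assert (E1 : Rpower y (- (1 + e)) = Rpower y (- e) * / y).
    { replace (- (1 + e)) with (- e + - (1)) by ring.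
      rewrite Rpower_plus, (Rpower_Ropp y 1), Rpower_1; lra. }
    assert (E2 : Rpower x (- e) = Rpower y (- e) * exp (e * (ln y - ln x))).
    { unfold Rpower. rewrite <- exp_plus. f_equal; ring. }
    rewrite E1, E2.
    assert (L1 : / y <= ln y - ln x).
    { assert (Hxy : 0 < x / y) by (apply Rdiv_lt_0_compat; lra).
      assert (L := ln_le_sub_1 (x / y) Hxy).
      rewrite ln_div in L by lra.
      assert (x / y - 1 = - / y) by (rewrite Hy; field; lra). lra. }
    assert (Hiy : 0 < / y) by (apply Rinv_0_lt_compat; lra).
    assert (L3 : 1 + e * (ln y - ln x) <= exp (e * (ln y - ln x))).
    { eapply Rle_trans; [|apply exp_ineq1_le]. lra. }
    assert (Hp := Rpower_pos y (- e)).
    assert (L4 : e * / y <= e * (ln y - ln x)) by (apply Rmult_le_compat_l; lra).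
    assert (L5 : 0 <= Rpower y (- e) * (exp (e * (ln y - ln x)) - 1 - e * / y))
      by (apply Rmult_le_pos; lra).
    lra. }
  apply (ex_series_bounded _ (1 + / e)).
  - intros i; left; apply Rpower_pos.
  - assert (Q : forall n, e * rsum (fun n => Rpower (INR (S n)) (- (1 + e))) (S n)
                          <= e + 1 - Rpower (INR (S n)) (- e)).
    { induction n as [|n IH].
      - simpl. unfold Rpower. rewrite ln_1, !Rmult_0_r, exp_0. lra.
      - change (rsum ?f (S (S n))) with (rsum f (S n) + f (S n)).
        specialize (St n). lra. }
    intros [|n].
    + simpl. assert (0 < / e) by (apply Rinv_0_lt_compat; lra). lra.
    + specialize (Q n). assert (P := Rpower_pos (INR (S n)) (- e)).
      apply (Rmult_le_reg_l e); auto. rewrite Rmult_plus_distr_l, Rinv_r; lra.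
Qed.

Lemma Rpower_neg_pow x n : 0 < x -> Rpower x (- INR n) = / x ^ n.
Proof. intros H; rewrite Rpower_Ropp, Rpower_pow; auto. Qed.

Lemma ex_series_inv_sq : ex_series (fun n => / INR (S n) ^ 2).
Proof.
  eapply ex_series_ext; [|apply (ex_series_Rpower 1); lra].
  intros n. rewrite <- Rpower_neg_pow by apply INR_S_pos. f_equal; simpl; ring.
Qed.

(** This is [ln (u / m) <= u / m - 1] multiplied by [m], without the further factor [e^(-m)] that
    would make it sharp. It trades exponential decay for any chosen power. *)
Lemma Rpower_exp_bound m u : 0 < m -> 0 < u -> exp (- u) <= Rpower m m * Rpower u (- m).
Proof.
  intros Hm Hu. unfold Rpower. rewrite <- exp_plus.
  assert (Hum : 0 < u / m) by (apply Rdiv_lt_0_compat; lra).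
  assert (L := ln_le_sub_1 (u / m) Hum). rewrite ln_div in L by lra.
  assert (E : m * ln m + - m * ln u >= - u).
  { assert (Lm : m * (ln u - ln m) <= m * (u / m - 1)) by (apply Rmult_le_compat_l; lra).
    replace (m * (u / m - 1)) with (u - m) in Lm by (field; lra). lra. }
  destruct E as [E|E]; [left; apply exp_increasing; lra | right; f_equal; lra].
Qed.

Lemma ex_series_pow_exp k x : 0 < x -> ex_series (fun n => INR (S n) ^ k * exp (- (INR (S n) * x))).
Proof.
  intros Hx.
  (* The power [k + 2] absorbs [n^k] and leaves [n^(-2)]. *)
  set (m := INR (k + 2)).
  assert (Hm : 0 < m) by (apply lt_0_INR; lia).
  apply (ex_series_le_R _ (fun n => (Rpower m m * Rpower x (- m)) * / INR (S n) ^ 2)).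
  2: apply ex_series_scal_R, ex_series_inv_sq.
  intros n. assert (P := INR_S_pos n). set (N := INR (S n)) in *.
  assert (P' : 0 < N ^ k) by now apply pow_lt.
  split; [left; apply Rmult_lt_0_compat; auto; apply exp_pos|].
  assert (B := Rpower_exp_bound m (N * x) Hm ltac:(nra)).
  rewrite <- Rpower_mult_distr in B by auto.
  assert (E : Rpower N (- m) = / N ^ k * / N ^ 2).
  { unfold m; rewrite Rpower_neg_pow, pow_add, Rinv_mult; auto. }
  rewrite E in B.
  apply Rle_trans with (N ^ k * (Rpower m m * (/ N ^ k * / N ^ 2 * Rpower x (- m)))).
  - apply Rmult_le_compat_l; lra.
  - right; field. split; lra.
Qed.

(** * The complex exponential *)

Lemma Cexp_plus z w : Cexp (z + w)%C = (Cexp z * Cexp w)%C.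
Proof.
  destruct z as [a b], w as [c d]; unfold Cexp, Cmult; simpl. rewrite exp_plus, cos_plus, sin_plus. f_equal; ring.
Qed.

Lemma Cexp_0 : Cexp 0 = 1%C.
Proof. unfold Cexp, RtoC; simpl. rewrite exp_0, cos_0, sin_0. f_equal; ring. Qed.

Lemma Cmod_Cexp z : Cmod (Cexp z) = exp (Re z).
Proof.
  unfold Cmod, Cexp; simpl.
  transitivity (sqrt (Rsqr (exp (Re z)))); [|apply sqrt_Rsqr; left; apply exp_pos].
  f_equal. unfold Rsqr. assert (T := sin2_cos2 (Im z)). unfold Rsqr in T.
  transitivity (exp (Re z) * exp (Re z) * (sin (Im z) * sin (Im z) + cos (Im z) * cos (Im z))); [ring|].
  rewrite T; ring.
Qed.

Lemma Cexp_neq_0 z : Cexp z <> 0%C.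
Proof. intros E; assert (T := Cmod_Cexp z); rewrite E, Cmod_0 in T; generalize (exp_pos (Re z)); lra. Qed.

Lemma Cexp_opp z : Cexp (- z)%C = (/ Cexp z)%C.
Proof.
  assert (E : (Cexp (- z) * Cexp z)%C = 1%C).
  { rewrite <- Cexp_plus. replace (- z + z)%C with (RtoC 0) by ring. apply Cexp_0. }
  assert (N := Cexp_neq_0 z).
  replace (Cexp (- z))%C with (Cexp (- z) * Cexp z * / Cexp z)%C by (field; auto).
  rewrite E; ring.
Qed.

Lemma Cexp_RtoC x : Cexp (RtoC x) = RtoC (exp x).
Proof. unfold Cexp, RtoC; simpl. rewrite cos_0, sin_0. f_equal; ring. Qed.

Lemma Cexp_nat n z : Cexp (RtoC (INR n) * z)%C = (Cexp z ^ n)%C.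
Proof.
  induction n as [|n IH].
  - simpl. replace (0 * z)%C with (RtoC 0) by ring. apply Cexp_0.
  - rewrite S_INR, RtoC_plus.
    replace ((INR n + 1) * z)%C with (z + INR n * z)%C by ring.
    rewrite Cexp_plus, IH. reflexivity.
Qed.

Lemma Cexp_2PI (n : nat) : Cexp (0, 2 * PI * INR n) = 1%C.
Proof.
  replace (0, 2 * PI * INR n)%R with (RtoC (INR n) * (0, 2 * PI)%R)%C
    by (unfold Cmult, RtoC; simpl; f_equal; ring).
  rewrite Cexp_nat. unfold Cexp; simpl Re; simpl Im. rewrite exp_0, cos_2PI, sin_2PI.
  replace (1 * 1, 1 * 0)%R with (RtoC 1) by (unfold RtoC; f_equal; ring).
  apply Cpow_1_l || (induction n; simpl; [|rewrite IHn]; ring).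
Qed.

Lemma RtoC_neq_0 x : x <> 0 -> RtoC x <> 0%C.
Proof. intros H E; apply H; now apply RtoC_inj. Qed.

Lemma Cmod_ge_Im z : Rabs (Im z) <= Cmod z.
Proof. eapply Rle_trans; [|apply (Rmax_Cmod z)]; apply Rmax_r. Qed.

Lemma Re_pos_neq_0 z : 0 < Re z -> z <> 0%C.
Proof. intros H E; rewrite E in H; simpl in H; lra. Qed.

(** * The Lipschitz formula *)

(** One integration by the mean value theorem, giving up the factor [1 / (n + 1)]. Iterated, it
    produces the Taylor bounds below without factorials. *)
Lemma derive_bound_step (f f' : R -> R) K n a :
  0 <= K -> (forall t, is_derive f t (f' t)) -> f 0 = 0 ->
  (forall t, 0 <= t <= a -> Rabs (f' t) <= K * t ^ n) ->
  forall t, 0 <= t <= a -> Rabs (f t) <= K * t ^ S n.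
Proof.
  intros HK Hd H0 Hb t Ht.
  destruct (MVT_gen f 0 t f') as [c [Hc Ec]].
  - intros; apply Hd.
  - intros y _. apply derivable_continuous_pt. exists (f' y). now apply is_derive_Reals.
  - rewrite Rmin_left, Rmax_right in Hc by lra.
    rewrite H0, !Rminus_0_r in Ec. rewrite Ec, Rabs_mult, (Rabs_pos_eq t) by lra.
    simpl. rewrite (Rmult_comm t (t ^ n)), <- Rmult_assoc. apply Rmult_le_compat_r; [lra|].
    eapply Rle_trans; [apply Hb; lra|].
    apply Rmult_le_compat_l; auto. apply pow_incr; lra.
Qed.

Lemma sin_cos_taylor t : 0 <= t ->
  Rabs (sin t) <= t /\ Rabs (sin t - t) <= t ^ 3 /\ Rabs (cos t - 1 + t ^ 2 / 2) <= t ^ 4.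
Proof.
  intros Ht.
  assert (A1 : forall s, 0 <= s <= t -> Rabs (sin s) <= 1 * s ^ 1).
  { apply (derive_bound_step sin cos 1 0 t); [lra | | apply sin_0 |].
    - intros s; auto_derive; auto; ring.
    - intros s _; simpl. apply Rabs_le. generalize (COS_bound s); lra. }
  assert (A2 : forall s, 0 <= s <= t -> Rabs (cos s - 1) <= 1 * s ^ 2).
  { apply (derive_bound_step (fun s => cos s - 1) (fun s => - sin s) 1 1 t); [lra | | |].
    - intros s; auto_derive; auto; ring.
    - rewrite cos_0; ring.
    - intros s Hs; rewrite Rabs_Ropp; auto. }
  assert (A3 : forall s, 0 <= s <= t -> Rabs (sin s - s) <= 1 * s ^ 3).
  { apply (derive_bound_step (fun s => sin s - s) (fun s => cos s - 1) 1 2 t); [lra | | |auto].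
    - intros s; auto_derive; auto; ring.
    - rewrite sin_0; ring. }
  assert (A4 : forall s, 0 <= s <= t -> Rabs (cos s - 1 + s ^ 2 / 2) <= 1 * s ^ 4).
  { apply (derive_bound_step (fun s => cos s - 1 + s ^ 2 / 2) (fun s => - (sin s - s)) 1 3 t);
      [lra | | |].
    - intros s; auto_derive; auto; field.
    - rewrite cos_0; field.
    - intros s Hs; rewrite Rabs_Ropp; auto. }
  specialize (A1 t ltac:(lra)); specialize (A3 t ltac:(lra)); specialize (A4 t ltac:(lra)).
  rewrite Rmult_1_l in *. rewrite pow_1 in A1. auto.
Qed.

(** Repeated integration starting from [cosh <= e^a] on [[0, a]], which is why every constant is
    [exp a]. *)
Lemma sinh_cosh_taylor a t : 0 <= t <= a ->
  Rabs (sinh t - t) <= exp a * t ^ 3 /\ Rabs (cosh t - 1) <= exp a * t ^ 2 /\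
  Rabs (cosh t - 1 - t ^ 2 / 2) <= exp a * t ^ 4 /\ 1 <= cosh t <= exp a.
Proof.
  intros Ht.
  assert (Ds : forall s, is_derive sinh s (cosh s)).
  { intros s; unfold sinh, cosh; auto_derive; auto; field. }
  assert (Dc : forall s, is_derive cosh s (sinh s)).
  { intros s; unfold sinh, cosh; auto_derive; auto; field. }
  assert (Pa := exp_pos a).
  assert (B : forall s, 0 <= s <= a -> 1 <= cosh s <= exp a).
  { intros s Hs. unfold cosh.
    assert (exp (- s) <= exp s) by (destruct (Req_dec s 0) as [->|]; [rewrite Ropp_0; lra|left; apply exp_increasing; lra]).
    assert (exp s <= exp a) by (destruct (Req_dec s a) as [->|]; [lra|left; apply exp_increasing; lra]).
    assert (exp s * exp (- s) = 1) by (rewrite <- exp_plus, Rplus_opp_r; apply exp_0).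
    assert (P := exp_pos s). assert (P' := exp_pos (- s)).
    split; [|lra].
    assert (0 <= (exp s - exp (- s)) * (exp s - exp (- s))) by nra. nra. }
  assert (S0 : sinh 0 = 0) by (unfold sinh; rewrite Ropp_0; field).
  assert (C0 : cosh 0 = 1) by (unfold cosh; rewrite Ropp_0, exp_0; field).
  assert (A1 : forall s, 0 <= s <= a -> Rabs (sinh s) <= exp a * s ^ 1).
  { apply (derive_bound_step sinh cosh (exp a) 0 a); auto; [lra|].
    intros s Hs; specialize (B s Hs); simpl. apply Rabs_le; lra. }
  assert (A2 : forall s, 0 <= s <= a -> Rabs (cosh s - 1) <= exp a * s ^ 2).
  { apply (derive_bound_step (fun s => cosh s - 1) sinh (exp a) 1 a); auto; [lra| |lra].
    intros s. replace (sinh s) with (sinh s - 0) by ring.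
    apply (is_derive_minus (V := R_NormedModule)); auto. apply is_derive_Reals, derivable_pt_lim_const. }
  assert (A3 : forall s, 0 <= s <= a -> Rabs (sinh s - s) <= exp a * s ^ 3).
  { apply (derive_bound_step (fun s => sinh s - s) (fun s => cosh s - 1) (exp a) 2 a); auto; [lra| |lra].
    intros s. apply (is_derive_minus (V := R_NormedModule)); auto. apply is_derive_Reals, derivable_pt_lim_id. }
  assert (A4 : forall s, 0 <= s <= a -> Rabs (cosh s - 1 - s ^ 2 / 2) <= exp a * s ^ 4).
  { apply (derive_bound_step (fun s => cosh s - 1 - s ^ 2 / 2) (fun s => sinh s - s) (exp a) 3 a); auto;
      [lra| |rewrite C0; field].
    intros s. unfold cosh, sinh; auto_derive; auto; field. }
  repeat split; try apply B; auto.
Qed.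

(** The difference splits as [4 sinh^2 (x/2) + 4 sin^2 (v/2)], so the variables are bounded
    separately. The range [v <= 4] contains [[0, PI]], and for [y = v / 2 <= 2] the cubic Taylor
    polynomial gives [sin y >= y / 3]. *)
Lemma cosh_sub_cos_lower x v :
  0 <= x -> 0 <= v <= 4 -> (x ^ 2 + v ^ 2) / 9 <= 2 * (cosh x - cos v).
Proof.
  intros Hx Hv.
  assert (H1 : x ^ 2 / 4 <= 2 * (cosh x - 1)).
  { set (y := x / 2).
    assert (E : 2 * (cosh x - 1) = (exp y - exp (- y)) ^ 2).
    { unfold cosh. replace x with (y + y) by (unfold y; field).
      rewrite Ropp_plus_distr, !exp_plus.
      assert (exp y * exp (- y) = 1) by (rewrite <- exp_plus, Rplus_opp_r; apply exp_0).
      simpl. nra. }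
    rewrite E. replace (x ^ 2 / 4) with (y ^ 2) by (unfold y; field).
    assert (Hy : 0 <= y) by (unfold y; lra).
    apply pow_incr; split; auto.
    assert (P1 := exp_ineq1_le y).
    assert (exp y * exp (- y) = 1) by (rewrite <- exp_plus, Rplus_opp_r; apply exp_0).
    assert (P := exp_pos (- y)).
    assert (exp (- y) <= 1).
    { destruct (Req_dec y 0) as [Z|]; [rewrite Z, Ropp_0, exp_0; lra|].
      rewrite <- exp_0; left; apply exp_increasing; lra. }
    lra. }
  assert (H2 : v ^ 2 / 9 <= 2 * (1 - cos v)).
  { set (y := v / 2).
    assert (E : 2 * (1 - cos v) = 4 * (sin y) ^ 2).
    { replace v with (2 * y) by (unfold y; field). rewrite cos_2a_sin. ring. }
    rewrite E. replace (v ^ 2 / 9) with (4 * (y / 3) ^ 2) by (unfold y; field).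
    assert (Hy : 0 <= y <= 2) by (unfold y; lra).
    apply Rmult_le_compat_l; [lra|]. apply pow_incr; split; [lra|].
    assert (Hpi := PI2_3_2).
    destruct (sin_bound y 0) as [B _]; [lra|lra|].
    unfold sin_approx, sin_term in B; simpl in B.
    assert (y * y * y <= 4 * y) by nra.
    unfold Rdiv in B. lra. }
  assert (H3 := pow2_ge_0 x). lra.
Qed.

(* This is [4 sinh^2 (w/2)]. *)
Definition sinhsq (w : C) : C := (Cexp w + Cexp (- w) - 2)%C.

Lemma sinhsq_parts x v :
  sinhsq (x, v) = (2 * cosh x * cos v - 2, 2 * sinh x * sin v).
Proof.
  unfold sinhsq, Cexp, Cplus, Cminus, Copp, RtoC, cosh, sinh; simpl.
  rewrite cos_neg, sin_neg. unfold Cplus; simpl. f_equal; field.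
Qed.

Lemma Cmod_le_sum z : Cmod z <= Rabs (Re z) + Rabs (Im z).
Proof.
  assert (E := Cmod2_alt z). assert (P := Cmod_ge_0 z).
  assert (P1 := Rabs_pos (Re z)). assert (P2 := Rabs_pos (Im z)).
  rewrite <- (pow2_abs (Re z)), <- (pow2_abs (Im z)) in E.
  nra.
Qed.

(** The modulus of [4 sinh^2 (w/2)] is exactly [2 (cosh x - cos v)], which reduces this to the
    preceding bound. *)
Lemma sinhsq_lower x v : 0 <= x -> Rabs v <= 4 -> Cmod (x, v) ^ 2 / 9 <= Cmod (sinhsq (x, v)).
Proof.
  intros Hx Hv.
  assert (L := cosh_sub_cos_lower x (Rabs v) Hx (conj (Rabs_pos v) Hv)).
  rewrite pow2_abs in L.
  assert (Ec : cos (Rabs v) = cos v).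
  { unfold Rabs; destruct (Rcase_abs v); auto; apply cos_neg. }
  rewrite Ec in L.
  rewrite (Cmod2_alt (x, v)). simpl Re; simpl Im.
  eapply Rle_trans; [exact L|].
  assert (P0 : 0 <= 2 * (cosh x - cos v)) by (generalize (pow2_ge_0 x) (pow2_ge_0 v); lra).
  rewrite <- (sqrt_Rsqr _ P0).
  rewrite sinhsq_parts. unfold Cmod; simpl fst; simpl snd.
  apply sqrt_le_1_alt. right. unfold Rsqr.
  assert (H1 : sin v * sin v = 1 - cos v * cos v) by (generalize (sin2_cos2 v); unfold Rsqr; lra).
  assert (H2 : sinh x * sinh x = cosh x * cosh x - 1).
  { unfold sinh, cosh. assert (exp x * exp (- x) = 1) by (rewrite <- exp_plus, Rplus_opp_r; apply exp_0).
    nra. }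
  transitivity ((2 * cosh x * cos v - 2) ^ 2 + 4 * (sinh x * sinh x) * (sin v * sin v)); [|ring].
  rewrite H1, H2; ring.
Qed.

(** [w^2] is the leading term of [4 sinh^2 (w/2)]. The error of order four is what makes
    [1 / w^2 - 1 / sinhsq w] bounded near 0. Only [x] is restricted, since the bounds for [sin] and
    [cos] are global. *)
Lemma sinhsq_taylor x v : 0 <= x <= 4 ->
  Cmod (sinhsq (x, v) - (x, v) * (x, v))%C <= 4 * exp 4 * Cmod (x, v) ^ 4.
Proof.
  intros Hx.
  destruct (sinh_cosh_taylor 4 x Hx) as (S1 & S2 & S3 & S4).
  destruct (sin_cos_taylor (Rabs v) (Rabs_pos v)) as (T0 & T1 & T2).
  set (K := exp 4) in *.
  assert (Ec : cos (Rabs v) = cos v).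
  { unfold Rabs; destruct (Rcase_abs v); auto; apply cos_neg. }
  assert (Es : Rabs (sin v - v) = Rabs (sin (Rabs v) - Rabs v)).
  { unfold Rabs at 3 4; destruct (Rcase_abs v); auto.
    rewrite sin_neg, <- Rabs_Ropp; f_equal; ring. }
  assert (Es0 : Rabs (sin v) = Rabs (sin (Rabs v))).
  { unfold Rabs at 3; destruct (Rcase_abs v); auto. rewrite sin_neg, Rabs_Ropp; auto. }
  rewrite Ec in T2. rewrite <- Es in T1. rewrite <- Es0 in T0.
  replace (Rabs v ^ 4) with (v ^ 4) in T2 by (
    replace (v ^ 4) with ((v ^ 2) ^ 2) by ring; rewrite <- (pow2_abs v); ring).
  rewrite pow2_abs in T2.
  assert (HK : 1 <= K) by lra.
  replace (Cmod (x, v) ^ 4) with ((x ^ 2 + v ^ 2) ^ 2)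
    by (replace (Cmod (x, v) ^ 4) with ((Cmod (x, v) ^ 2) ^ 2) by ring; rewrite Cmod2_alt; reflexivity).
  eapply Rle_trans; [apply Cmod_le_sum|].
  rewrite sinhsq_parts. simpl Re; simpl Im.
  assert (X := pow2_ge_0 x). assert (V := pow2_ge_0 v).
  (* The real part is regrouped so that each summand contains a single Taylor remainder. *)
  assert (R1 : Rabs (2 * cosh x * cos v - 2 + - (x * x - v * v)) <= 2 * K * (x ^ 2 + v ^ 2) ^ 2).
  { replace (2 * cosh x * cos v - 2 + - (x * x - v * v)) with
      (2 * (cosh x - 1 - x ^ 2 / 2) + (- v ^ 2 * (cosh x - 1) + 2 * cosh x * (cos v - 1 + v ^ 2 / 2)))
      by field.
    eapply Rle_trans; [apply Rabs_triang|].
    eapply Rle_trans; [apply Rplus_le_compat_l, Rabs_triang|].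
    rewrite !Rabs_mult, (Rabs_pos_eq 2), (Rabs_pos_eq (cosh x)), Rabs_Ropp, (Rabs_pos_eq (v ^ 2)) by lra.
    set (a := Rabs (cosh x - 1)) in *. set (b := Rabs (cos v - 1 + v ^ 2 / 2)) in *.
    assert (0 <= b) by apply Rabs_pos.
    assert (v ^ 2 * a <= v ^ 2 * (K * x ^ 2)) by (apply Rmult_le_compat_l; auto).
    assert (cosh x * b <= K * v ^ 4) by (apply Rmult_le_compat; lra).
    assert (0 <= K * (x ^ 2 * v ^ 2)) by (apply Rmult_le_pos; nra).
    replace ((x ^ 2 + v ^ 2) ^ 2) with (x ^ 4 + 2 * (x ^ 2 * v ^ 2) + v ^ 4) by ring.
    nra. }
  assert (R2 : Rabs (2 * sinh x * sin v + - (x * v + v * x)) <= 2 * K * (x ^ 2 + v ^ 2) ^ 2).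
  { replace (2 * sinh x * sin v + - (x * v + v * x)) with
      (2 * ((sinh x - x) * sin v + x * (sin v - v))) by ring.
    rewrite Rabs_mult, (Rabs_pos_eq 2) by lra. rewrite Rmult_assoc.
    apply Rmult_le_compat_l; [lra|].
    eapply Rle_trans; [apply Rabs_triang|].
    rewrite !Rabs_mult, (Rabs_pos_eq x) by lra.
    set (u := Rabs v) in *. assert (Pu : 0 <= u) by apply Rabs_pos.
    replace (v ^ 2) with (u ^ 2) by (unfold u; apply pow2_abs).
    assert (Rabs (sinh x - x) * Rabs (sin v) <= K * x ^ 3 * u).
    { apply Rmult_le_compat; auto using Rabs_pos. }
    assert (x * Rabs (sin v - v) <= x * u ^ 3) by (apply Rmult_le_compat_l; lra).
    assert (0 <= x * u ^ 3) by (apply Rmult_le_pos; [lra | now apply pow_le]).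
    assert (x * u ^ 3 <= K * (x * u ^ 3)) by nra.
    assert (2 * (x * u) <= x ^ 2 + u ^ 2) by (assert (0 <= (x - u) ^ 2) by apply pow2_ge_0; nra).
    assert (0 <= x ^ 2 + u ^ 2) by (generalize (pow2_ge_0 u); lra).
    assert (0 <= x * u) by nra.
    assert (x * u * (x ^ 2 + u ^ 2) <= (x ^ 2 + u ^ 2) ^ 2) by nra.
    assert (K * (x * u * (x ^ 2 + u ^ 2)) <= K * (x ^ 2 + u ^ 2) ^ 2) by (apply Rmult_le_compat_l; lra).
    nra. }
  lra.
Qed.

(** * The pole series and the exponential series *)

Definition iPI (t : R) : C := (0, 2 * PI * t).

(* The two-sided sum over the integers is encoded by pairing [l] with [-l-1]. *)
Definition lip (n : nat) (w : C) (l : nat) : C :=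
  (/ (w + iPI (INR l)) ^ n + / (w - iPI (INR (S l))) ^ n)%C.

Definition lexp (k : nat) (w : C) (n : nat) : C :=
  (RtoC (INR (S n) ^ k) * Cexp (- (RtoC (INR (S n)) * w)))%C.

Lemma PI_gt_3 : 3 < PI.
Proof. generalize PI2_3_2; lra. Qed.

Lemma iPI_plus s t : iPI (s + t) = (iPI s + iPI t)%C.
Proof. unfold iPI, Cplus; simpl; f_equal; ring. Qed.

Lemma Cexp_opp_iPI (n : nat) : Cexp (- iPI (INR n)) = 1%C.
Proof. rewrite Cexp_opp. unfold iPI. rewrite Cexp_2PI. field. Qed.

Lemma Re_shift_plus w t : Re (w + iPI t)%C = Re w.
Proof. destruct w; simpl; ring. Qed.
Lemma Re_shift_minus w t : Re (w - iPI t)%C = Re w.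
Proof. destruct w; simpl; ring. Qed.
Lemma Im_shift_plus w t : Im (w + iPI t)%C = Im w + 2 * PI * t.
Proof. destruct w; simpl; ring. Qed.
Lemma Im_shift_minus w t : Im (w - iPI t)%C = Im w - 2 * PI * t.
Proof. destruct w; simpl; ring. Qed.

(** For [l < 3] the real part suffices, hence [Re w / 3]; for [l >= 3] the imaginary part takes
    over. Half-width [3 PI] covers the strip [|Im w| <= PI] and its two translates by [2 pi i],
    hence every point where the formula will be used. *)
Lemma pole_lower w : 0 < Re w -> Rabs (Im w) <= 3 * PI ->
  exists c, 0 < c /\ forall l : nat, c * INR (S l) <= Cmod (w + iPI (INR l))%C /\
                                     c * INR (S l) <= Cmod (w - iPI (INR (S l)))%C.
Proof.
  intros Hx Hv. assert (Hpi := PI_gt_3).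
  set (c := Rmin 1 (Re w / 3)).
  assert (Hc1 : c <= 1) by apply Rmin_l. assert (Hc2 : c <= Re w / 3) by apply Rmin_r.
  assert (Hc : 0 < c) by (apply Rmin_pos; lra).
  exists c; split; auto. apply Rabs_le_between in Hv.
  intros l.
  assert (A := re_le_Cmod (w + iPI (INR l))%C). assert (B := re_le_Cmod (w - iPI (INR (S l)))%C).
  assert (A' := Cmod_ge_Im (w + iPI (INR l))%C). assert (B' := Cmod_ge_Im (w - iPI (INR (S l)))%C).
  rewrite Re_shift_plus, Rabs_pos_eq in A by lra. rewrite Re_shift_minus, Rabs_pos_eq in B by lra.
  rewrite Im_shift_plus in A'. rewrite Im_shift_minus in B'.
  destruct (le_lt_dec 3 l) as [L|L].
  - apply le_INR in L. simpl in L. rewrite S_INR in *.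
    assert (A2 := Rle_abs (Im w + 2 * PI * INR l)).
    assert (B2 := Rle_abs (- (Im w - 2 * PI * (INR l + 1)))). rewrite Rabs_Ropp in B2.
    assert (T : 3 * (2 * INR l - 3) <= PI * (2 * INR l - 3)) by (apply Rmult_le_compat_r; lra).
    assert (c * (INR l + 1) <= INR l + 1) by nra.
    split; lra.
  - assert (INR (S l) <= 3) by (assert (T : INR (S l) <= INR 3) by (apply le_INR; lia); simpl INR in T at 2; lra).
    assert (0 < INR (S l)) by apply INR_S_pos.
    assert (c * INR (S l) <= Re w) by nra.
    split; lra.
Qed.

Lemma Cmod_inv_pow (z : C) n : z <> 0%C -> Cmod (/ z ^ n)%C = / Cmod z ^ n.
Proof. intros H. rewrite Cmod_inv, Cmod_pow; auto. apply Cpow_nz; exact H. Qed.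

Lemma inv_pow_bound c z n (l : nat) :
  0 < c -> c * INR (S l) <= Cmod z -> Cmod (/ z ^ (2 + n))%C <= / c ^ (2 + n) * / INR (S l) ^ 2.
Proof.
  intros Hc H. assert (P := INR_S_pos l).
  assert (P1 : 1 <= INR (S l)) by (rewrite S_INR; generalize (pos_INR l); lra).
  assert (Q : 0 < c * INR (S l)) by now apply Rmult_lt_0_compat.
  rewrite Cmod_inv_pow by (apply Cmod_gt_0; lra).
  rewrite <- Rinv_mult. apply Rinv_le_contravar.
  - apply Rmult_lt_0_compat; now apply pow_lt.
  - apply Rle_trans with ((c * INR (S l)) ^ (2 + n)); [|apply pow_incr; lra].
    rewrite Rpow_mult_distr. apply Rmult_le_compat_l; [left; now apply pow_lt|].
    apply Rle_pow; auto; lia.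
Qed.

Lemma lip_bound w n : 0 < Re w -> Rabs (Im w) <= 3 * PI ->
  exists K, forall l, Cmod (lip (2 + n) w l) <= K * / INR (S l) ^ 2.
Proof.
  intros Hx Hv. destruct (pole_lower w Hx Hv) as [c [Hc H]].
  exists (2 * / c ^ (2 + n)); intros l. destruct (H l) as [H1 H2].
  unfold lip. eapply Rle_trans; [apply Cmod_triangle|].
  generalize (inv_pow_bound c _ n l Hc H1) (inv_pow_bound c _ n l Hc H2). lra.
Qed.

Lemma lip_ex w n : 0 < Re w -> Rabs (Im w) <= 3 * PI -> exists g, Csum (lip (2 + n) w) g.
Proof.
  intros Hx Hv; destruct (lip_bound w n Hx Hv) as [K HK].
  apply (Csum_ex _ _ HK). apply ex_series_scal_R, ex_series_inv_sq.
Qed.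

Lemma Cmod_lexp k w n : Cmod (lexp k w n) = INR (S n) ^ k * exp (- (INR (S n) * Re w)).
Proof.
  unfold lexp. rewrite Cmod_mult, Cmod_Cexp, Cmod_RtoC_pos by (apply pow_le, pos_INR).
  do 2 f_equal. destruct w; simpl; ring.
Qed.

Lemma lexp_ex k w : 0 < Re w -> exists e, Csum (lexp k w) e.
Proof.
  intros Hx. apply (Csum_ex _ (fun n => INR (S n) ^ k * exp (- (INR (S n) * Re w)))).
  - intros n; rewrite Cmod_lexp; lra.
  - now apply ex_series_pow_exp.
Qed.

Lemma is_lim_seq_inv_sq K : is_lim_seq (fun n => K * / INR (S n) ^ 2) 0.
Proof.
  destruct ex_series_inv_sq as [l Hl].
  replace (Finite 0) with (Rbar_mult K 0) by (simpl; f_equal; ring).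
  apply is_lim_seq_scal_l. apply ex_series_lim_0. now exists l.
Qed.

(** Translation by [2 pi i] moves each pole onto the next, so the paired partial sums change only by
    two boundary terms, which tend to 0. *)
Lemma lip_shift w n g : 0 < Re w -> Rabs (Im w) <= 3 * PI ->
  Csum (lip (2 + n) w) g <-> Csum (lip (2 + n) (w + iPI 1)) g.
Proof.
  intros Hx Hv. destruct (pole_lower w Hx Hv) as [c [Hc H]].
  set (d := fun N : nat => (/ (w + iPI (INR N)) ^ (2 + n) - / (w - iPI (INR N)) ^ (2 + n))%C).
  assert (E : forall N, csum (lip (2 + n) (w + iPI 1)) N = (csum (lip (2 + n) w) N + d N)%C).
  { induction N as [|N IH].
    - simpl csum. unfold d. simpl INR.
      replace (iPI 0) with (RtoC 0) by (unfold iPI; rewrite Rmult_0_r; auto).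
      replace (w - 0)%C with (w + 0)%C by ring. ring.
    - cbn [csum]. rewrite IH. unfold d, lip.
      replace (w + iPI 1 + iPI (INR N))%C with (w + iPI (INR (S N)))%C
        by (rewrite S_INR, iPI_plus; ring).
      replace (w + iPI 1 - iPI (INR (S N)))%C with (w - iPI (INR N))%C
        by (rewrite S_INR, iPI_plus; ring).
      ring. }
  assert (D : Ccv d (RtoC 0)).
  { apply Ccv_incr, (Ccv_squeeze _ (fun N => (2 * / c ^ (2 + n)) * / INR (S N) ^ 2)).
    - intros N. unfold d. eapply Rle_trans; [apply Cmod_triangle|]. rewrite Cmod_opp.
      assert (B1 := inv_pow_bound c _ n N Hc (proj2 (H N))).
      assert (B2 : c * INR (S N) <= Cmod (w + iPI (INR (S N)))%C).
      { eapply Rle_trans; [|apply (proj1 (H (S N)))].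
        apply Rmult_le_compat_l; [lra|]. apply le_INR; lia. }
      assert (B3 := inv_pow_bound c _ n N Hc B2). lra.
    - apply is_lim_seq_inv_sq. }
  split; intros G.
  - replace g with (g + 0)%C by ring.
    eapply Ccv_ext; [intros N; symmetry; apply E|]. now apply Ccv_plus.
  - replace g with (g - 0)%C by ring.
    apply (Ccv_ext (fun N => csum (lip (2 + n) (w + iPI 1)) N - d N)%C).
    + intros N; rewrite E; ring.
    + now apply Ccv_minus.
Qed.

Lemma lexp_shift k w n : lexp k (w + iPI 1)%C n = lexp k w n.
Proof.
  unfold lexp. f_equal.
  replace (- (INR (S n) * (w + iPI 1)))%C with (- (INR (S n) * w) + - iPI (INR (S n)))%C.
  - rewrite Cexp_plus, Cexp_opp_iPI. ring.
  - destruct w; unfold iPI, Cplus, Cmult, Copp, RtoC; simpl; f_equal; ring.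
Qed.

(** * The case of exponent 2: duplication and Herglotz's trick *)

Lemma inv_half_sq (z : C) : z <> 0%C -> (/ (z / 2) ^ 2)%C = (4 * / z ^ 2)%C.
Proof. intros H. simpl. field. auto. Qed.

(** The terms at [w / 2] and [w / 2 + i pi] are those of [w] at even and at odd multiples of
    [2 pi i], with the base halved; the square produces the factor 4. Two consecutive terms of the
    paired series for [w] match one term of each of the others. *)
Lemma lip_double w g g1 g2 : 0 < Re w ->
  Csum (lip 2 w) g -> Csum (lip 2 (w / 2)) g1 -> Csum (lip 2 (w / 2 + iPI (1 / 2))) g2 ->
  (g1 + g2 = 4 * g)%C.
Proof.
  intros Hx G G1 G2.
  apply (Csum_unique (fun l => lip 2 (w / 2) l + lip 2 (w / 2 + iPI (1 / 2)) l)%C).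
  - now apply Csum_plus.
  - apply (Csum_ext (fun M => 4 * csum (fun h => lip 2 w (2 * M + h)) 2)%C).
    2: apply Csum_scal, (Csum_group _ _ 2); [lia | exact G].
    intros l. cbn [csum]. unfold lip.
    replace (2 * l + 0)%nat with (2 * l)%nat by lia.
    assert (N1 : forall t, (w + iPI t)%C <> 0%C)
      by (intros t; apply Re_pos_neq_0; rewrite Re_shift_plus; auto).
    assert (N2 : forall t, (w - iPI t)%C <> 0%C)
      by (intros t; apply Re_pos_neq_0; rewrite Re_shift_minus; auto).
    replace (w / 2 + iPI (INR l))%C with ((w + iPI (INR (2 * l))) / 2)%C.
    2: { rewrite mult_INR. destruct w; unfold iPI, Cplus, Cdiv, Cmult, Cinv, RtoC; simpl; f_equal; field. }
    replace (w / 2 - iPI (INR (S l)))%C with ((w - iPI (INR (S (2 * l + 1)))) / 2)%C.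
    2: { rewrite !S_INR, plus_INR, mult_INR.
         destruct w; unfold iPI, Cminus, Cplus, Copp, Cdiv, Cmult, Cinv, RtoC; simpl; f_equal; field. }
    replace (w / 2 + iPI (1 / 2) + iPI (INR l))%C with ((w + iPI (INR (2 * l + 1))) / 2)%C.
    2: { rewrite plus_INR, mult_INR.
         destruct w; unfold iPI, Cplus, Cdiv, Cmult, Cinv, RtoC; simpl; f_equal; field. }
    replace (w / 2 + iPI (1 / 2) - iPI (INR (S l)))%C with ((w - iPI (INR (S (2 * l)))) / 2)%C.
    2: { rewrite !S_INR, mult_INR.
         destruct w; unfold iPI, Cminus, Cplus, Copp, Cdiv, Cmult, Cinv, RtoC; simpl; f_equal; field. }
    rewrite !inv_half_sq by auto. ring.
Qed.

Lemma Cexp_opp_PI : Cexp (- iPI (1 / 2)) = (-1)%C.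
Proof.
  unfold Cexp, iPI; simpl. replace (- (2 * PI * (1 / 2))) with (- PI) by field.
  rewrite cos_neg, sin_neg, cos_PI, sin_PI, Ropp_0, exp_0. unfold RtoC, Copp; simpl; f_equal; ring.
Qed.

Lemma Cpow_m1_even n : ((-1)%C ^ (2 * n))%C = 1%C.
Proof.
  induction n as [|n IH]; [reflexivity|].
  replace (2 * S n)%nat with (S (S (2 * n))) by lia. cbn [Cpow]. rewrite IH. ring.
Qed.

(** The translation by [i pi] multiplies the term of frequency [n] by [(-1)^n]: odd frequencies
    cancel, even ones double, and the coefficient [2 n] of frequency [2 n] supplies the other factor
    2. *)
Lemma lexp_double w e e1 e2 :
  Csum (lexp 1 w) e -> Csum (lexp 1 (w / 2)) e1 -> Csum (lexp 1 (w / 2 + iPI (1 / 2))) e2 ->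
  (e1 + e2 = 4 * e)%C.
Proof.
  intros G G1 G2.
  assert (A := Csum_group _ _ 2 ltac:(lia) (Csum_plus _ _ _ _ G1 G2)).
  apply (Csum_unique _ _ _ A).
  eapply Csum_ext; [|exact (Csum_scal 4 _ _ G)].
  intros M. cbn [csum].
  assert (P : forall n, lexp 1 (w / 2 + iPI (1 / 2)) n = ((-1) ^ (S n) * lexp 1 (w / 2) n)%C).
  { intros n. unfold lexp.
    replace (- (INR (S n) * (w / 2 + iPI (1 / 2))))%C
      with (- (INR (S n) * (w / 2)) + INR (S n) * (- iPI (1 / 2)))%C by ring.
    rewrite Cexp_plus, Cexp_nat, Cexp_opp_PI. ring. }
  rewrite !P.
  replace (2 * M + 0)%nat with (2 * M)%nat by lia.
  replace (S (2 * M + 1)) with (2 * (S M))%nat by lia.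
  rewrite Cpow_m1_even. cbn [Cpow]. rewrite Cpow_m1_even.
  replace (lexp 1 (w / 2) (2 * M + 1)) with (2 * lexp 1 w M)%C; [ring|].
  unfold lexp. replace (S (2 * M + 1)) with (2 * S M)%nat by lia.
  rewrite !pow_1, mult_INR, RtoC_mult. replace (INR 2) with 2 by (simpl; ring).
  replace (2 * INR (S M) * (w / 2))%C with (INR (S M) * w)%C by field.
  ring.
Qed.

(** With [r = e^(-w)] this is [sum n r^n = r / (1 - r)^2]. The assumed convergence already forces
    [r^n -> 0], since [|r^n| <= |n r^n|]. *)
Lemma lexp1_closed w e : 0 < Re w -> Csum (lexp 1 w) e -> (e * sinhsq w = 1)%C.
Proof.
  intros Hx G. set (r := Cexp (- w)).
  assert (T : forall n, lexp 1 w n = (RtoC (INR (S n)) * r ^ (S n))%C).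
  { intros n. unfold lexp, r. rewrite pow_1.
    replace (- (INR (S n) * w))%C with (INR (S n) * (- w))%C by ring. now rewrite Cexp_nat. }
  assert (A : forall N, ((1 - r) * (1 - r) * csum (lexp 1 w) N
                         = r - r ^ S N - (1 - r) * (lexp 1 w N - r ^ S N))%C).
  { induction N as [|N IH].
    - simpl csum. rewrite T. simpl. ring.
    - cbn [csum]. rewrite Cmult_plus_distr_l, IH, !T, (S_INR (S N)), RtoC_plus. cbn [Cpow]. ring. }
  assert (Z1 := Csum_terms _ _ G).
  assert (Z2 : Ccv (fun N => r ^ S N)%C 0%C).
  { intros eps He; destruct (Z1 eps He) as [N HN]; exists N; intros n Hn.
    eapply Rle_lt_trans; [|apply (HN n Hn)].
    replace (r ^ S n - 0)%C with (r ^ S n)%C by ring.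
    replace (lexp 1 w n - 0)%C with (lexp 1 w n)%C by ring.
    rewrite T, Cmod_mult, Cmod_RtoC_pos by apply pos_INR.
    assert (1 <= INR (S n)) by (rewrite S_INR; generalize (pos_INR n); lra).
    generalize (Cmod_ge_0 (r ^ S n)%C). nra. }
  assert (B : ((1 - r) * (1 - r) * e = r - 0 - (1 - r) * (0 - 0))%C).
  { apply (Ccv_unique (fun N => (1 - r) * (1 - r) * csum (lexp 1 w) N)%C).
    - now apply Ccv_scal.
    - eapply Ccv_ext; [intros N; symmetry; apply A|].
      apply Ccv_minus; [apply Ccv_minus; auto; apply Ccv_const|].
      apply Ccv_scal, Ccv_minus; auto. }
  assert (Hr : r <> 0%C) by apply Cexp_neq_0.
  assert (E : sinhsq w = ((1 - r) * (1 - r) / r)%C).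
  { unfold sinhsq. fold r. replace w with (- - w)%C at 1 by ring.
    rewrite Cexp_opp. fold r. field. auto. }
  rewrite E.
  replace (e * ((1 - r) * (1 - r) / r))%C with ((1 - r) * (1 - r) * e / r)%C by (field; auto).
  rewrite B. field. auto.
Qed.

(** Both sides have the same double pole [1 / w^2] at 0, the only one on the closure of the
    half-strip; each is compared with it separately. *)
Lemma lipschitz1_bounded : exists M, 0 <= M /\ forall w g e,
  0 < Re w -> Rabs (Im w) <= PI -> Csum (lip 2 w) g -> Csum (lexp 1 w) e -> Cmod (g - e)%C <= M.
Proof.
  destruct ex_series_inv_sq as [A HA].
  assert (PA : 0 <= A).
  { apply (rsum_le_series _ A 0) in HA; auto.
    intros i; left; apply Rinv_0_lt_compat, pow_lt, INR_S_pos. }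
  assert (PE := exp_pos 4).
  (* [2 A] bounds the remaining poles. For [|w| <= 4] the Taylor error [4 e^4 |w|^4] divided by
     [|w|^2 |w|^2 / 9] gives [36 e^4]; for [|w| > 4] the two terms add up to at most [10 / 16]. *)
  exists (2 * A + (36 * exp 4 + 1)). split; [lra|].
  intros w g e Hx Hv G E. assert (Hpi := PI_gt_3). assert (Hpi4 := PI_4).
  assert (Hw : w <> 0%C) by now apply Re_pos_neq_0.
  assert (Pw : 0 < Cmod w) by now apply Cmod_gt_0.
  assert (B1 : Cmod (g - / w ^ 2)%C <= 2 * A).
  (* The pole at 0 is the first half of the term [l = 0]; as a one-term series it can be subtracted
     termwise. *)
  { set (d := fun l : nat => match l with O => (/ w ^ 2)%C | _ => 0%C end).
    apply (Csum_bound (fun l => lip 2 w l - d l)%C (fun l => 2 * / INR (S l) ^ 2)).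
    - apply Rabs_le_between in Hv.
      assert (Hm : forall l, INR (S l) <= Cmod (w - iPI (INR (S l)))%C).
      { intros l. eapply Rle_trans; [|apply Cmod_ge_Im].
        rewrite Im_shift_minus, <- Rabs_Ropp. eapply Rle_trans; [|apply Rle_abs].
        assert (T := pos_INR l). rewrite S_INR. nra. }
      assert (Hp : forall l, INR (S (S l)) <= Cmod (w + iPI (INR (S l)))%C).
      { intros l. eapply Rle_trans; [|apply Cmod_ge_Im].
        rewrite Im_shift_plus. eapply Rle_trans; [|apply Rle_abs].
        assert (T := pos_INR l). rewrite !S_INR. nra. }
      assert (Z : forall (z : C) l, INR (S l) <= Cmod z -> Cmod (/ z ^ 2)%C <= / INR (S l) ^ 2).
      { intros z l Hz. assert (Q := inv_pow_bound 1 z 0 l ltac:(lra)).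
        rewrite Rmult_1_l, pow1, Rinv_1, Rmult_1_l in Q. auto. }
      intros [|l]; unfold d, lip.
      + replace (iPI (INR 0)) with (RtoC 0) by (unfold iPI; simpl; rewrite Rmult_0_r; auto).
        replace (/ (w + 0) ^ 2 + / (w - iPI (INR 1)) ^ 2 - / w ^ 2)%C
          with (/ (w - iPI (INR 1)) ^ 2)%C
          by (replace (w + 0)%C with w by ring; ring).
        eapply Rle_trans; [apply (Z _ O), Hm|]. simpl; lra.
      + unfold Cminus at 1. rewrite Copp_0, Cplus_0_r.
        eapply Rle_trans; [apply Cmod_triangle|].
        generalize (Z _ _ (Hp l)) (Z _ _ (Hm (S l))). lra.
    - apply Csum_minus; auto.
      replace (/ w ^ 2)%C with (csum d 1) by (simpl; ring).
      apply Csum_finite. intros [|i] Hi; [lia | reflexivity].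
    - apply (is_series_scal (V := R_NormedModule) 2 _ _ HA). }
  assert (B2 : Cmod (/ w ^ 2 - e)%C <= 36 * exp 4 + 1).
  { assert (C1 := lexp1_closed w e Hx E).
    destruct w as [x v]. simpl in Hx, Hv.
    assert (L := sinhsq_lower x v ltac:(lra) ltac:(lra)).
    set (w := (x, v) : C) in *. set (Q := sinhsq w) in *.
    set (m := Cmod w) in *.
    assert (Pm2 : 0 < m ^ 2) by now apply pow_lt.
    assert (HQ : Q <> 0%C) by (apply Cmod_gt_0; lra).
    assert (Ee : e = (/ Q)%C).
    { replace e with (e * Q * / Q)%C by (field; auto). rewrite C1; ring. }
    assert (BQ : / Cmod Q <= 9 / m ^ 2).
    { replace (9 / m ^ 2) with (/ (m ^ 2 / 9)) by (field; lra).
      apply Rinv_le_contravar; lra. }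
    destruct (Rle_dec m 4) as [L4|L4].
    - assert (T := sinhsq_taylor x v).
      assert (x <= m) by (eapply Rle_trans; [apply Rle_abs | apply (re_le_Cmod w)]).
      specialize (T ltac:(lra)). fold w Q m in T.
      replace (/ w ^ 2 - e)%C with ((Q - w * w) * (/ w ^ 2 * / Q))%C
        by (rewrite Ee; simpl; field; auto).
      rewrite !Cmod_mult, Cmod_inv_pow, Cmod_inv by auto. fold m.
      apply Rle_trans with (4 * exp 4 * m ^ 4 * (/ m ^ 2 * (9 / m ^ 2))).
      + apply Rmult_le_compat; auto using Cmod_ge_0.
        * apply Rmult_le_pos; left; [now apply Rinv_0_lt_compat|].
          apply Rinv_0_lt_compat; lra.
        * apply Rmult_le_compat_l; auto. left; now apply Rinv_0_lt_compat.
      + replace (4 * exp 4 * m ^ 4 * (/ m ^ 2 * (9 / m ^ 2))) with (36 * exp 4) by (field; lra). lra.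
    - unfold Cminus. eapply Rle_trans; [apply Cmod_triangle|].
      rewrite Cmod_opp, Ee, Cmod_inv_pow, Cmod_inv by auto. fold m.
      assert (/ m ^ 2 <= / 16) by (apply Rinv_le_contravar; nra).
      unfold Rdiv in BQ. lra. }
  replace (g - e)%C with ((g - / w ^ 2) + (/ w ^ 2 - e))%C by ring.
  eapply Rle_trans; [apply Cmod_triangle|]. lra.
Qed.

(* Herglotz's trick: the defect D satisfies 4 D(w) = D(w/2) + D(w/2 + i pi), so its bound can be
   halved indefinitely. *)
Lemma lipschitz1_strip w g e :
  0 < Re w -> Rabs (Im w) <= PI -> Csum (lip 2 w) g -> Csum (lexp 1 w) e -> g = e.
Proof.
  destruct lipschitz1_bounded as [M [HM HB]].
  assert (Hpi := PI_gt_3).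
  assert (Hn : forall n w g e, 0 < Re w -> Rabs (Im w) <= PI ->
     Csum (lip 2 w) g -> Csum (lexp 1 w) e -> Cmod (g - e)%C <= M * (/ 2) ^ n).
  { clear w g e. induction n as [|n IH]; intros w g e Hx Hv G E.
    - simpl; rewrite Rmult_1_r; eauto.
    - assert (R1 : Re (w / 2)%C = Re w / 2)
        by (destruct w; unfold Cdiv, Cmult, Cinv, RtoC; simpl; field).
      assert (I1 : Im (w / 2)%C = Im w / 2)
        by (destruct w; unfold Cdiv, Cmult, Cinv, RtoC; simpl; field).
      assert (Hv' := proj1 (Rabs_le_between _ _) Hv).
      assert (V1 : Rabs (Im (w / 2)%C) <= PI) by (rewrite I1; apply Rabs_le; lra).
      set (u := (w / 2 + iPI (1 / 2))%C).
      assert (Ru : Re u = Re w / 2) by (unfold u; rewrite Re_shift_plus; auto).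
      assert (Iu : Im u = Im w / 2 + PI) by (unfold u; rewrite Im_shift_plus, I1; field).
      destruct (lip_ex (w / 2) 0) as [g1 G1]; [lra|lra|].
      destruct (lexp_ex 1 (w / 2)) as [e1 E1]; [lra|].
      destruct (lip_ex u 0) as [g2 G2]; [lra|rewrite Iu; apply Rabs_le; lra|].
      destruct (lexp_ex 1 u) as [e2 E2]; [lra|].
      assert (D1 : Cmod (g1 - e1)%C <= M * (/ 2) ^ n) by (apply (IH (w / 2)%C); auto; lra).
      assert (D2 : Cmod (g2 - e2)%C <= M * (/ 2) ^ n).
      { destruct (Rle_dec (Im w) 0) as [Hn|Hp].
        - apply (IH u); auto; [lra|]. rewrite Iu; apply Rabs_le; lra.
        (* For [Im w > 0] the point [u] lies above the strip; its translate by [-2 pi i] lies inside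
           and has the same two sums. *)
        - set (t := (u - iPI 1)%C).
          assert (Rt : Re t = Re w / 2) by (unfold t; rewrite Re_shift_minus; auto).
          assert (It : Im t = Im w / 2 - PI) by (unfold t; rewrite Im_shift_minus, Iu; ring).
          assert (Et : (t + iPI 1)%C = u) by (unfold t; ring).
          apply (IH t).
          + lra.
          + rewrite It; apply Rabs_le; lra.
          + apply (lip_shift t 0); [lra|rewrite It; apply Rabs_le; lra|]. now rewrite Et.
          + rewrite <- Et in E2. eapply Csum_ext; [|exact E2]. intros i; apply lexp_shift. }
      assert (X := lip_double w g g1 g2 Hx G G1 G2).
      assert (Y := lexp_double w e e1 e2 E E1 E2).
      assert (Z : (4 * (g - e) = (g1 - e1) + (g2 - e2))%C).
      { replace (4 * (g - e))%C with (4 * g - 4 * e)%C by ring. rewrite <- X, <- Y; ring. }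
      assert (N : 4 * Cmod (g - e)%C <= 2 * (M * (/ 2) ^ n)).
      { replace (4 * Cmod (g - e)%C) with (Cmod (4 * (g - e))%C)
          by (rewrite Cmod_mult, Cmod_RtoC_pos; lra).
        rewrite Z. eapply Rle_trans; [apply Cmod_triangle|]. lra. }
      simpl. lra. }
  intros Hx Hv G E.
  assert (Z : Cmod (g - e)%C <= 0).
  { assert (L : is_lim_seq (fun n => M * (/ 2) ^ n) 0).
    { replace (Finite 0) with (Rbar_mult M 0) by (simpl; f_equal; ring).
      apply is_lim_seq_scal_l, is_lim_seq_geom. rewrite Rabs_pos_eq; lra. }
    apply (is_lim_seq_le (fun _ => Cmod (g - e)%C) (fun n => M * (/ 2) ^ n) (Cmod (g - e)%C) 0); auto.
    - intros n; eapply Hn; eauto.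
    - apply is_lim_seq_const. }
  assert (D : (g - e)%C = 0%C) by (apply Cmod_eq_0; generalize (Cmod_ge_0 (g - e)%C); lra).
  replace g with (g - e + e)%C by ring. rewrite D; ring.
Qed.

(** Both sides have period [2 pi i], which carries the wide strip into [|Im w| <= PI]. *)
Lemma lipschitz1 w g e :
  0 < Re w -> Rabs (Im w) <= 3 * PI -> Csum (lip 2 w) g -> Csum (lexp 1 w) e -> g = e.
Proof.
  intros Hx Hv G E. assert (Hv' := proj1 (Rabs_le_between _ _) Hv). assert (Hpi := PI_gt_3).
  destruct (Rle_dec (Im w) PI) as [H1|H1]; [destruct (Rle_dec (- PI) (Im w)) as [H2|H2]|].
  - apply (lipschitz1_strip w); auto. apply Rabs_le; lra.
  - apply (lipschitz1_strip (w + iPI 1)%C).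
    + now rewrite Re_shift_plus.
    + rewrite Im_shift_plus; apply Rabs_le; lra.
    + now apply (lip_shift w 0).
    + eapply Csum_ext; [|exact E]. intros i; now rewrite lexp_shift.
  - assert (Et : (w - iPI 1 + iPI 1)%C = w) by ring.
    apply (lipschitz1_strip (w - iPI 1)%C).
    + now rewrite Re_shift_minus.
    + rewrite Im_shift_minus; apply Rabs_le; lra.
    + apply (lip_shift (w - iPI 1)%C 0);
        [now rewrite Re_shift_minus | rewrite Im_shift_minus; apply Rabs_le; lra | now rewrite Et].
    + eapply Csum_ext; [|exact E]. intros i; now rewrite <- (lexp_shift 1 (w - iPI 1)%C), Et.
Qed.

(** Since [Re s > 0] and [h >= 0], [|s + h| >= |s|], so every inverse power may be estimated at [s].
    The constant [n^2] is chosen for the induction, which needs only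
    [n^2 + (n + 1) <= (n + 1)^2]. *)
Lemma inv_pow_taylor (s : C) (h : R) n : 0 < Re s -> 0 <= h ->
  Cmod (/ (s + h) ^ n - / s ^ n + INR n * h * / s ^ S n)%C <= INR n ^ 2 * h ^ 2 * / Cmod s ^ (2 + n).
Proof.
  intros Hs Hh.
  assert (Hs0 : s <> 0%C) by now apply Re_pos_neq_0.
  assert (Hsh : (s + h)%C <> 0%C) by (apply Re_pos_neq_0; destruct s; simpl in *; lra).
  set (a := (/ s)%C). set (b := (/ (s + h))%C).
  assert (Pa : 0 < Cmod s) by now apply Cmod_gt_0.
  assert (Hab : Cmod b <= Cmod a).
  { unfold a, b. rewrite !Cmod_inv by auto. apply Rinv_le_contravar; auto.
    assert (Q1 := Cmod2_alt s). assert (Q2 := Cmod2_alt (s + h)%C).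
    assert (R1 : Re (s + h)%C = Re s + h) by (destruct s; simpl; ring).
    assert (R2 : Im (s + h)%C = Im s) by (destruct s; simpl; ring).
    rewrite R1, R2 in Q2. assert (P2 := Cmod_ge_0 (s + h)%C). nra. }
  assert (Hd : (a - b)%C = (h * a * b)%C) by (unfold a, b; field; auto).
  replace (/ Cmod s ^ (2 + n)) with (Cmod a ^ (2 + n)) by (unfold a; rewrite Cmod_inv, pow_inv; auto).
  rewrite <- !Cpow_inv by auto. fold a b.
  assert (Ma := Cmod_ge_0 a).
  induction n as [|n IH].
  - simpl. replace (1 - 1 + 0 * h * (a * 1))%C with (RtoC 0) by ring. rewrite Cmod_0. lra.
  (* The recursion of the remainder: [a - b = h a b] turns the discarded linear terms into one term
     of second order in [h]. *)
  - replace (b ^ S n - a ^ S n + INR (S n) * h * a ^ S (S n))%C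
      with (b * (b ^ n - a ^ n + INR n * h * a ^ S n) + (INR (S n) * h * h) * (a ^ (2 + n) * b))%C.
    + eapply Rle_trans; [apply Cmod_triangle|]. rewrite !Cmod_mult, Cmod_pow.
      rewrite !Cmod_RtoC_pos by (auto using pos_INR).
      apply Rle_trans with (Cmod a * (INR n ^ 2 * h ^ 2 * Cmod a ^ (2 + n))
                            + INR (S n) * h * h * (Cmod a ^ (2 + n) * Cmod a)).
      * apply Rplus_le_compat.
        -- apply Rmult_le_compat; auto using Cmod_ge_0.
        -- apply Rmult_le_compat_l.
           ++ repeat apply Rmult_le_pos; auto using pos_INR.
           ++ apply Rmult_le_compat_l; auto. now apply pow_le.
      * replace (2 + S n)%nat with (S (2 + n)) by lia. cbn [pow].
        set (X := Cmod a ^ (2 + n)). assert (PX : 0 <= X) by (now apply pow_le).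
        rewrite S_INR. assert (T := pos_INR n).
        assert (PY : 0 <= Cmod a * X * (h * h)) by (clearbody X; repeat apply Rmult_le_pos; auto).
        set (Y := Cmod a * X * (h * h)) in *.
        assert (0 <= (INR n + 1) * Y * INR n) by (clearbody Y; repeat apply Rmult_le_pos; lra).
        apply Rle_trans with (INR n ^ 2 * Y + (INR n + 1) * Y); [unfold Y; right; ring|].
        apply Rle_trans with ((INR n + 1) ^ 2 * Y); [nra | unfold Y; right; ring].
    + replace (b ^ S n)%C with (b * b ^ n)%C by reflexivity.
      replace (a ^ (2 + n))%C with (a * a * a ^ n)%C by (simpl; ring).
      replace (a ^ S (S n))%C with (a * a * a ^ n)%C by (simpl; ring).
      replace (a ^ S n)%C with (a * a ^ n)%C by reflexivity.
      rewrite S_INR, RtoC_plus.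
      replace (((INR n + 1) * h * h) * (a * a * a ^ n * b))%C
        with ((INR n + 1) * h * (a * a ^ n) * (h * a * b))%C by ring.
      rewrite <- Hd.
      replace (b * (b ^ n - a ^ n + INR n * h * (a * a ^ n)) + (INR n + 1) * h * (a * a ^ n) * (a - b))%C
        with (b * b ^ n - a ^ n * (b + h * a * b) + (INR n + 1) * h * (a * a * a ^ n))%C by ring.
      rewrite <- Hd. ring.
Qed.

(** Stated for all [y >= 0], because it is applied with [y = N h] for every frequency [N] at
    once. *)
Lemma exp_opp_taylor y : 0 <= y -> Rabs (exp (- y) - 1 + y) <= y ^ 2.
Proof.
  intros Hy. assert (L := exp_ineq1_le (- y)). assert (L' := exp_ineq1_le y).
  assert (E : exp (- y) * exp y = 1) by (rewrite <- exp_plus, Rplus_opp_l; apply exp_0).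
  assert (P := exp_pos (- y)).
  rewrite Rabs_pos_eq by lra.
  assert (exp (- y) * (1 + y) <= 1) by nra.
  assert (0 <= y ^ 3) by now apply pow_le.
  apply Rmult_le_reg_r with (1 + y); [lra|]. nra.
Qed.

(* Both sides of the formula for [k] have the difference quotient -(both sides for [k+1]). *)
Theorem lipschitz k w g e :
  0 < Re w -> Rabs (Im w) <= 3 * PI ->
  Csum (lip (2 + k) w) g -> Csum (lexp (S k) w) e -> (INR (fact (S k)) * g = e)%C.
Proof.
  revert w g e. induction k as [|k IH]; intros w g e Hx Hv G E.
  - simpl fact. replace (INR 1 * g)%C with g by (simpl; ring). now apply (lipschitz1 w).
  - destruct (pole_lower w Hx Hv) as [c [Hc Hp]].
    destruct ex_series_inv_sq as [A HA].
    (* The second order error contributes [(N h)^2], hence two more powers of [N]. *)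
    destruct (ex_series_pow_exp (S k + 2) (Re w) Hx) as [B HB].
    destruct (lip_ex w k Hx Hv) as [g0 G0]. destruct (lexp_ex (S k) w Hx) as [e0 E0].
    set (n := (2 + k)%nat) in *.
    set (K := 2 * (INR n ^ 2 * / c ^ (2 + n)) * A).
    assert (Dg : forall h g1, 0 < h -> Csum (lip n (w + h)) g1 ->
               Cmod (g1 - g0 + INR n * h * g)%C <= h ^ 2 * K).
    { intros h g1 Hh G1.
      apply (Csum_bound (fun l => lip n (w + h) l - lip n w l + (INR n * h) * lip (S n) w l)%C
               (fun l => (h ^ 2 * (2 * (INR n ^ 2 * / c ^ (2 + n)))) * / INR (S l) ^ 2)).
      - intros l. unfold lip.
        replace (w + h + iPI (INR l))%C with ((w + iPI (INR l)) + h)%C by ring.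
        replace (w + h - iPI (INR (S l)))%C with ((w - iPI (INR (S l))) + h)%C by ring.
        set (s1 := (w + iPI (INR l))%C). set (s2 := (w - iPI (INR (S l)))%C).
        assert (T1 := inv_pow_taylor s1 h n). assert (T2 := inv_pow_taylor s2 h n).
        unfold s1 in T1 at 1; rewrite Re_shift_plus in T1.
        unfold s2 in T2 at 1; rewrite Re_shift_minus in T2.
        specialize (T1 Hx ltac:(lra)); specialize (T2 Hx ltac:(lra)).
        destruct (Hp l) as [P1 P2]. fold s1 in P1. fold s2 in P2.
        assert (B1 := inv_pow_bound c s1 n l Hc P1). assert (B2 := inv_pow_bound c s2 n l Hc P2).
        assert (Q : 0 < c * INR (S l)) by (apply Rmult_lt_0_compat; auto; apply INR_S_pos).
        rewrite Cmod_inv_pow in B1 by (apply Cmod_gt_0; lra).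
        rewrite Cmod_inv_pow in B2 by (apply Cmod_gt_0; lra).
        match goal with |- Cmod ?z <= _ => replace z with
          ((/ (s1 + h) ^ n - / s1 ^ n + INR n * h * / s1 ^ S n)
           + (/ (s2 + h) ^ n - / s2 ^ n + INR n * h * / s2 ^ S n))%C by ring end.
        eapply Rle_trans; [apply Cmod_triangle|].
        assert (PN : 0 <= INR n ^ 2 * h ^ 2) by (apply Rmult_le_pos; apply pow2_ge_0).
        apply (Rmult_le_compat_l _ _ _ PN) in B1. apply (Rmult_le_compat_l _ _ _ PN) in B2.
        lra.
      - apply Csum_plus; [now apply Csum_minus | now apply Csum_scal].
      - replace (h ^ 2 * K) with ((h ^ 2 * (2 * (INR n ^ 2 * / c ^ (2 + n)))) * A) by (unfold K; ring).
        apply (is_series_scal (V := R_NormedModule) _ _ _ HA). }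
    assert (De : forall h e1, 0 < h -> Csum (lexp (S k) (w + h)) e1 ->
               Cmod (e1 - e0 + h * e)%C <= h ^ 2 * B).
    { intros h e1 Hh E1.
      apply (Csum_bound (fun l => lexp (S k) (w + h) l - lexp (S k) w l + h * lexp (S (S k)) w l)%C
               (fun l => h ^ 2 * (INR (S l) ^ (S k + 2) * exp (- (INR (S l) * Re w))))).
      - intros l. set (N := INR (S l)). assert (PN : 0 < N) by apply INR_S_pos.
        assert (X : (lexp (S k) (w + h) l - lexp (S k) w l + h * lexp (S (S k)) w l)%C
                    = (lexp (S k) w l * (exp (- (N * h)) - 1 + N * h)%R)%C).
        { unfold lexp. fold N.
          replace (- (N * (w + h)))%C with (- (N * w) + RtoC (- (N * h)))%C
            by (rewrite RtoC_opp, RtoC_mult; ring).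
          rewrite Cexp_plus, Cexp_RtoC.
          replace (N ^ S (S k)) with (N ^ S k * N) by (simpl; ring).
          rewrite RtoC_plus, RtoC_minus, !RtoC_mult. ring. }
        rewrite X, Cmod_mult, Cmod_lexp, Cmod_R. fold N.
        assert (T := exp_opp_taylor (N * h) ltac:(nra)).
        assert (PE := exp_pos (- (N * Re w))). assert (PK : 0 < N ^ S k) by now apply pow_lt.
        apply Rle_trans with (N ^ S k * exp (- (N * Re w)) * (N * h) ^ 2).
        + apply Rmult_le_compat_l; auto. apply Rmult_le_pos; lra.
        + right. rewrite pow_add. ring.
      - apply Csum_plus; [now apply Csum_minus | now apply Csum_scal].
      - apply (is_series_scal (V := R_NormedModule) _ _ _ HB). }
    set (F := INR (fact (S k))).
    assert (EQ0 : (F * g0)%C = e0) by (apply (IH w); auto).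
    set (z := (INR (fact (S (S k))) * g - e)%C).
    assert (Ez : z = (F * (INR n * g) - e)%C).
    { unfold z. rewrite (fact_simpl (S k)), mult_INR, RtoC_mult. fold F.
      unfold n. simpl (2 + k)%nat. ring. }
    assert (PF : 0 <= F) by apply pos_INR.
    (* At [w] and at [w + h] the formula for [k] holds exactly, so [h z] is a combination of two
       remainders of order [h^2]; dividing by [h] and letting it tend to 0 gives [z = 0]. *)
    assert (Bz : forall h, 0 < h -> Cmod z <= h * (F * K + B)).
    { intros h Hh.
      assert (R1 : 0 < Re (w + h)%C) by (destruct w; simpl in *; lra).
      assert (R2 : Rabs (Im (w + h)%C) <= 3 * PI)
        by (destruct w; simpl in *; rewrite Rplus_0_r; auto).
      destruct (lip_ex (w + h)%C k R1 R2) as [g1 G1]. destruct (lexp_ex (S k) (w + h)%C R1) as [e1 E1].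
      assert (EQ1 : (F * g1)%C = e1) by (apply (IH (w + h)%C); auto).
      specialize (Dg h g1 Hh G1). specialize (De h e1 Hh E1).
      assert (Q : (h * z = F * (g1 - g0 + INR n * h * g) + - (e1 - e0 + h * e))%C)
        by (rewrite Ez, <- EQ0, <- EQ1; ring).
      apply (Rmult_le_reg_l h); auto.
      replace (h * Cmod z) with (Cmod (h * z)%C) by (rewrite Cmod_mult, Cmod_RtoC_pos; lra).
      rewrite Q. eapply Rle_trans; [apply Cmod_triangle|].
      rewrite Cmod_opp, Cmod_mult, Cmod_RtoC_pos by auto.
      apply (Rmult_le_compat_l _ _ _ PF) in Dg. lra. }
    assert (Z0 : Cmod z <= 0).
    { apply Rnot_lt_le; intros Hlt.
      assert (PC : 0 < F * K + B).
      { specialize (Bz 1 ltac:(lra)). lra. }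
      specialize (Bz (Cmod z / (2 * (F * K + B)))).
      replace (Cmod z / (2 * (F * K + B)) * (F * K + B)) with (Cmod z / 2) in Bz by (field; lra).
      assert (0 < Cmod z / (2 * (F * K + B))) by (apply Rdiv_lt_0_compat; lra).
      specialize (Bz H). lra. }
    assert (D : z = 0%C) by (apply Cmod_eq_0; generalize (Cmod_ge_0 z); lra).
    replace e with (e + z)%C by (rewrite D; ring). unfold z. ring.
Qed.

(** * Characters and Gauss sums *)

Lemma periodic_mod {T} (f : nat -> T) q n :
  (forall m, f (m + q)%nat = f m) -> f (n mod q)%nat = f n.
Proof.
  intros H.
  assert (K : forall j m, f (m + j * q)%nat = f m).
  { induction j as [|j IH]; intros m; [now rewrite Nat.add_0_r|].
    replace (m + S j * q)%nat with ((m + j * q) + q)%nat by lia. now rewrite H, IH. }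
  rewrite (Nat.div_mod_eq n q) at 2.
  rewrite Nat.add_comm, Nat.mul_comm. now rewrite K.
Qed.

(** Sums over lists can be rearranged along a [Permutation]. *)
Lemma csum_fold f n : csum f n = fold_right (fun i s => (f i + s)%C) (RtoC 0) (seq 0 n).
Proof.
  assert (K : forall n a, csum (fun i => f (a + i)%nat) n
                          = fold_right (fun i s => (f i + s)%C) (RtoC 0) (seq a n)).
  { clear n; induction n as [|n IH]; intros a; auto.
    rewrite csum_shift, Nat.add_0_r. simpl. f_equal.
    rewrite <- IH. apply csum_ext; intros; f_equal; lia. }
  rewrite <- (K n O). reflexivity.
Qed.

Lemma fold_plus_perm (f : nat -> C) l l' : Permutation l l' ->
  fold_right (fun i s => (f i + s)%C) (RtoC 0) l = fold_right (fun i s => (f i + s)%C) (RtoC 0) l'.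
Proof.
  induction 1; simpl; auto; [congruence | ring | congruence].
Qed.

Lemma mult_mod_perm n q : (0 < q)%nat -> Nat.gcd n q = 1%nat ->
  Permutation (map (fun h => (n * h) mod q)%nat (seq 0 q)) (seq 0 q).
Proof.
  intros Hq Hg. apply NoDup_Permutation_bis.
  - apply NoDup_map_NoDup_ForallPairs; [|apply seq_NoDup].
    assert (K : forall x y, (x <= y)%nat -> (y < q)%nat -> ((n * x) mod q = (n * y) mod q)%nat -> x = y).
    { intros x y Hxy Hy E.
      assert (D : Nat.divide q (n * (y - x))).
      { exists ((n * y) / q - (n * x) / q)%nat.
        assert (E1 := Nat.div_mod_eq (n * x) q). assert (E2 := Nat.div_mod_eq (n * y) q).
        rewrite Nat.mul_sub_distr_l, Nat.mul_sub_distr_r. nia. }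
      apply Nat.gauss in D; [|now rewrite Nat.gcd_comm].
      destruct D as [z Hz]. destruct z; [lia|]. simpl in Hz. lia. }
    intros x y Hx Hy E. apply in_seq in Hx. apply in_seq in Hy.
    destruct (Nat.le_ge_cases x y); [|symmetry]; apply K; auto; lia.
  - rewrite length_map; lia.
  - intros x Hx. apply in_map_iff in Hx. destruct Hx as [h [<- _]].
    apply in_seq. split; [lia|]. apply Nat.mod_upper_bound; lia.
Qed.

(** Multiplication by a unit permutes the residues, and [f] sees only the residue. *)
Lemma csum_mult_perm (f : nat -> C) n q :
  (0 < q)%nat -> (forall m, f (m + q)%nat = f m) -> Nat.gcd n q = 1%nat ->
  csum (fun h => f (n * h)%nat) q = csum f q.
Proof.
  intros Hq Hf Hg. rewrite (csum_fold f q).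
  rewrite <- (fold_plus_perm f _ _ (mult_mod_perm n q Hq Hg)), csum_fold.
  generalize (seq 0 q). induction l as [|h l IH]; simpl; auto.
  rewrite IH, periodic_mod; auto.
Qed.

(* [e^(2 pi i n / q)] *)
Definition er (q n : nat) : C := Cexp (iPI (INR n / INR q)).

Lemma er_plus q m n : er q (m + n) = (er q m * er q n)%C.
Proof.
  unfold er. rewrite <- Cexp_plus, <- iPI_plus. do 2 f_equal. rewrite plus_INR. unfold Rdiv; ring.
Qed.

Lemma er_mult q m n : er q (m * n) = (er q m ^ n)%C.
Proof.
  unfold er. rewrite <- Cexp_nat. f_equal. rewrite mult_INR.
  unfold iPI, Cmult, RtoC; simpl. f_equal; unfold Rdiv; ring.
Qed.

Lemma er_q q m : (0 < q)%nat -> er q (q * m) = 1%C.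
Proof.
  intros Hq. unfold er, iPI. rewrite mult_INR.
  replace (INR q * INR m / INR q) with (INR m) by (field; apply not_0_INR; lia).
  apply Cexp_2PI.
Qed.

Lemma er_period q n : (0 < q)%nat -> er q (n + q) = er q n.
Proof.
  intros Hq. rewrite er_plus. assert (E := er_q q 1 Hq). rewrite Nat.mul_1_r in E. rewrite E. ring.
Qed.

(** The real part is [1 - 2 sin^2 (pi m / q)], and the sine is positive strictly between 0 and
    [pi]. *)
Lemma er_neq_1 q m : (0 < m < q)%nat -> er q m <> 1%C.
Proof.
  intros [H1 H2] E. unfold er, Cexp, iPI in E; simpl in E.
  apply (f_equal fst) in E; simpl in E. rewrite exp_0, Rmult_1_l in E.
  assert (Q1 : 0 < INR m) by (apply lt_0_INR; lia).
  assert (Q2 : INR m < INR q) by (apply lt_INR; lia).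
  set (t := PI * (INR m / INR q)).
  assert (Hr : 0 < INR m / INR q < 1).
  { split; [apply Rdiv_lt_0_compat; lra|]. apply Rmult_lt_reg_r with (INR q); [lra|].
    unfold Rdiv. rewrite Rmult_assoc, Rinv_l; lra. }
  assert (Hpi := PI_gt_3).
  assert (Ht : 0 < sin t) by (apply sin_gt_0; unfold t; nra).
  replace (2 * PI * (INR m / INR q)) with (2 * t) in E by (unfold t; ring).
  rewrite cos_2a_sin in E. nra.
Qed.

Lemma er_orth q m : (0 < q)%nat ->
  csum (fun j => er q (m * j)) q = if Nat.eqb (m mod q) 0 then RtoC (INR q) else RtoC 0.
Proof.
  intros Hq. destruct (Nat.eqb_spec (m mod q) 0) as [E|E].
  - rewrite (csum_ext _ (fun _ => RtoC 1)).
    + rewrite csum_const. ring.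
    + intros i _. apply Nat.Div0.mod_divides in E. destruct E as [c ->].
      replace (q * c * i)%nat with (q * (c * i))%nat by ring. now apply er_q.
  - assert (N : er q m <> 1%C).
    { rewrite <- (periodic_mod (er q) q m) by (intros; now apply er_period).
      apply er_neq_1. split; [lia|]. apply Nat.mod_upper_bound; lia. }
    assert (G : forall n, ((er q m - 1) * csum (fun j => er q (m * j)) n = er q m ^ n - 1)%C).
    { induction n as [|n IH]; [simpl; ring|].
      cbn [csum Cpow]. rewrite Cmult_plus_distr_l, IH, er_mult. ring. }
    specialize (G q). rewrite <- er_mult, Nat.mul_comm, er_q in G by auto.
    assert (N' : (er q m - 1)%C <> 0%C).
    { intros Z; apply N. replace (er q m) with (er q m - 1 + 1)%C by ring. rewrite Z; ring. }
    set (s := csum (fun j => er q (m * j)) q) in *.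
    replace s with ((er q m - 1) * s * / (er q m - 1))%C by (field; auto).
    rewrite G. field. auto.
Qed.

(** The definition runs over [1..q], block sums over [0..q-1]; the terms at [q] and at 0 agree by
    periodicity. *)
Lemma gauss_sum_csum q chi : (0 < q)%nat -> chi q = chi O ->
  gauss_sum q chi = csum (fun h => chi h * er q h)%C q.
Proof.
  intros Hq H0. unfold gauss_sum. rewrite sum_n_csum.
  replace (S (Nat.pred q)) with q by lia.
  assert (E : csum (fun j => (chi (S j) * er q (S j))%C) q = csum (fun h => chi h * er q h)%C q).
  { assert (A := csum_shift (fun h => chi h * er q h)%C q). cbn [csum] in A.
    assert (Er := er_period q 0 Hq). simpl in Er. rewrite Er, H0 in A.
    set (u := csum (fun h => chi h * er q h)%C q) in *.
    set (v := csum (fun j => chi (S j) * er q (S j))%C q) in *.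
    set (t := (chi O * er q O)%C) in *.
    transitivity (t + v - t)%C; [ring|]. rewrite <- A. ring. }
  rewrite <- E. apply csum_ext. intros i _. f_equal.
  unfold er, iPI. do 2 f_equal. unfold Rdiv; ring.
Qed.

Section Character.
Variables (q : nat) (chi : nat -> C).
Hypothesis Hchi : is_dirichlet_char q chi.

Lemma char_pos : (0 < q)%nat. Proof. apply Hchi. Qed.
Lemma char_1 : chi 1%nat = 1%C. Proof. apply Hchi. Qed.
Lemma char_mult m n : chi (m * n)%nat = (chi m * chi n)%C. Proof. apply Hchi. Qed.
Lemma char_period n : chi (n + q)%nat = chi n. Proof. apply Hchi. Qed.
Lemma char_0_iff n : chi n = 0%C <-> Nat.gcd n q <> 1%nat. Proof. apply Hchi. Qed.

Lemma char_qmul M h : chi (q * M + h)%nat = chi h.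
Proof.
  rewrite <- (periodic_mod chi q (q * M + h)), <- (periodic_mod chi q h) by apply char_period.
  f_equal. rewrite Nat.add_comm, Nat.mul_comm. apply Nat.Div0.mod_add.
Qed.

Lemma char_q : chi q = chi O.
Proof. change q with (0 + q)%nat at 1. apply char_period. Qed.

(** Multiplying by [n] permutes the residues, so [|chi n|] times the positive sum of all [|chi h|]
    equals that same sum. This avoids the multiplicative order of [n]. *)
Lemma Cmod_char n : Nat.gcd n q = 1%nat -> Cmod (chi n) = 1.
Proof.
  intros Hn.
  set (N := fun h => RtoC (Cmod (chi h))).
  assert (E := csum_mult_perm N n q char_pos).
  specialize (E ltac:(intros m; unfold N; now rewrite char_period) Hn).
  rewrite (csum_ext _ (fun h => N n * N h)%C) in E
    by (intros; unfold N; rewrite char_mult, Cmod_mult, RtoC_mult; auto).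
  rewrite csum_scal in E.
  unfold N in E. rewrite csum_RtoC in E. rewrite <- RtoC_mult in E. apply RtoC_inj in E.
  assert (P : 0 < rsum (fun h => Cmod (chi h)) q).
  { assert (Hq := char_pos).
    (* The class of 1 alone contributes 1; its index is written [1 mod q] so that modulus 1 is
       covered. *)
    assert (L : rsum (fun h => Cmod (chi h)) (S (1 mod q)) <= rsum (fun h => Cmod (chi h)) q).
    { apply rsum_mono; [intros; apply Cmod_ge_0|].
      assert (1 mod q < q)%nat by (apply Nat.mod_upper_bound; lia). lia. }
    simpl rsum in L at 1. rewrite (periodic_mod chi q 1), char_1, Cmod_1 in L by apply char_period.
    assert (0 <= rsum (fun h => Cmod (chi h)) (1 mod q)) by (apply rsum_pos; intros; apply Cmod_ge_0).
    lra. }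
  apply Rmult_eq_reg_r with (rsum (fun h => Cmod (chi h)) q); lra.
Qed.

Lemma Cmod_char_le n : Cmod (chi n) <= 1.
Proof.
  destruct (Nat.eq_dec (Nat.gcd n q) 1) as [E|E].
  - rewrite Cmod_char; auto; lra.
  - apply char_0_iff in E. rewrite E, Cmod_0; lra.
Qed.

Lemma char_conj_mult n : Nat.gcd n q = 1%nat -> (Cconj (chi n) * chi n = 1)%C.
Proof.
  intros H. rewrite Cmult_comm, <- Cmod2_conj, Cmod_char by auto. now rewrite pow1.
Qed.

Lemma conj_char_dirichlet : is_dirichlet_char q (conj_char chi).
Proof.
  unfold conj_char. split; [apply char_pos|]. repeat split.
  - rewrite char_1. unfold Cconj, RtoC; simpl; f_equal; ring.
  - intros m n. rewrite char_mult. apply Cmult_conj.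
  - intros n. now rewrite char_period.
  - intros H. apply char_0_iff. rewrite <- (Cconj_conj (chi n)), H.
    unfold Cconj, RtoC; simpl; f_equal; ring.
  - intros H. apply char_0_iff in H. rewrite H. unfold Cconj, RtoC; simpl; f_equal; ring.
Qed.

(** [q - h] and [(q - 1) h] are congruent modulo [q]: this is [chi (-h) = chi (-1) chi h] for
    natural arguments. *)
Lemma char_reflect h : (h <= q)%nat -> chi (q - h)%nat = (chi (q - 1)%nat * chi h)%C.
Proof.
  intros H. rewrite <- char_mult. destruct h as [|h].
  - rewrite Nat.mul_0_r, Nat.sub_0_r. apply char_q.
  - replace ((q - 1) * S h)%nat with (q * h + (q - S h))%nat by nia. now rewrite char_qmul.
Qed.
End Character.

Section Primitive.
Variables (q : nat) (chi : nat -> C).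
Hypothesis Hprim : is_primitive_char q chi.
Let Hchi : is_dirichlet_char q chi := proj1 Hprim.

Lemma conj_char_primitive : is_primitive_char q (conj_char chi).
Proof.
  split; [now apply conj_char_dirichlet|].
  intros d Hd Hlt. destruct (proj2 Hprim d Hd Hlt) as [n [H1 [H2 H3]]].
  exists n; repeat split; auto. intros E; apply H3.
  unfold conj_char in E. rewrite <- (Cconj_conj (chi n)), E. unfold Cconj, RtoC; simpl; f_equal; ring.
Qed.

Lemma char_twist_period d m :
  (chi (m + q)%nat * er q (d * (m + q)) = chi m * er q (d * m))%C.
Proof.
  rewrite (char_period q chi Hchi), Nat.mul_add_distr_l, er_plus, (Nat.mul_comm d q), er_q
    by apply (char_pos q chi Hchi). ring.
Qed.

(* For [gcd d q > 1] primitivity supplies [n] with [chi n <> 1] and [d n = d] modulo [q]. *)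
Lemma gauss_sum_separable d :
  csum (fun h => chi h * er q (d * h))%C q = (Cconj (chi d) * gauss_sum q chi)%C.
Proof.
  assert (Hq := char_pos q chi Hchi).
  destruct (Nat.eq_dec (Nat.gcd d q) 1) as [E|E].
  - rewrite (gauss_sum_csum q chi Hq (char_q q chi Hchi)).
    rewrite <- (csum_mult_perm (fun h => chi h * er q h)%C d q Hq); auto.
    + rewrite <- csum_scal. apply csum_ext. intros i _.
      rewrite (char_mult q chi Hchi).
      transitivity (Cconj (chi d) * chi d * (chi i * er q (d * i)))%C; [|ring].
      rewrite (char_conj_mult q chi Hchi); auto. ring.
    + intros m. rewrite (char_period q chi Hchi), er_period; auto.
  - assert (Z : chi d = 0%C) by now apply (char_0_iff q chi Hchi).
    rewrite Z. replace (Cconj 0) with (RtoC 0) by (unfold Cconj, RtoC; simpl; f_equal; ring).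
    set (g := Nat.gcd d q) in *.
    assert (Gd : Nat.divide g d) by apply Nat.gcd_divide_l.
    assert (Gq : Nat.divide g q) by apply Nat.gcd_divide_r.
    destruct Gq as [d' Hd']. destruct Gd as [d1 Hd1].
    assert (Hlt : (d' < q)%nat) by (destruct g as [|[|g']]; [lia|lia|nia]).
    destruct (proj2 Hprim d') as [n [N1 [N2 N3]]]; [exists g; lia | auto |].
    set (Sd := csum (fun h => chi h * er q (d * h))%C q).
    assert (Hd'0 : d' <> O) by (intros X; rewrite X in Hd'; simpl in Hd'; lia).
    (* The congruence [n = 1] modulo [d' = q / g] as an equation between natural numbers; the first
       alternative occurs only for [n = 0], where [d' = 1]. *)
    assert (En : exists z, (n + z * d' = 1 \/ n = 1 + z * d')%nat).
    { destruct n as [|n].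
      - exists 1%nat. rewrite Nat.Div0.mod_0_l in N2. symmetry in N2.
        destruct (Nat.eq_dec d' 1) as [X|X]; [left; lia|].
        rewrite Nat.mod_small in N2; lia.
      - exists (S n / d' - 1 / d')%nat.
        assert (E1 := Nat.div_mod_eq (S n) d'). assert (E2 := Nat.div_mod_eq 1 d').
        assert (S n / d' >= 1 / d')%nat by (apply Nat.Div0.div_le_mono; lia).
        right. rewrite Nat.mul_sub_distr_r. rewrite N2 in E1. nia. }
    (* [d d'] is a multiple of [q], so replacing [h] by [n h] leaves the exponential unchanged. *)
    assert (EE : forall h, er q (d * (n * h)) = er q (d * h)).
    { intros h. destruct En as [z [X|X]].
      - replace (d * h)%nat with (d * (n * h) + q * (d1 * z * h))%nat.
        + rewrite er_plus, er_q by auto. ring.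
        + replace (d * h)%nat with (d * ((n + z * d') * h))%nat by (rewrite X; ring).
          rewrite Hd', Hd1. ring.
      - replace (d * (n * h))%nat with (d * h + q * (d1 * z * h))%nat.
        + rewrite er_plus, er_q by auto. ring.
        + rewrite X, Hd', Hd1. ring. }
    (* Substituting [h -> n h] multiplies the sum by [chi n], which is not 1, so the sum
       vanishes. *)
    assert (ES : (chi n * Sd = Sd)%C).
    { unfold Sd at 2. rewrite <- (csum_mult_perm _ n q Hq (char_twist_period d) N1).
      unfold Sd. rewrite <- csum_scal. apply csum_ext. intros i _.
      rewrite (char_mult q chi Hchi), EE. ring. }
    assert (F : ((chi n - 1) * Sd = 0)%C) by (replace ((chi n - 1) * Sd)%C with (chi n * Sd - Sd)%C by ring; rewrite ES; ring).
    assert (X : (chi n - 1)%C <> 0%C).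
    { intros X; apply N3. replace (chi n) with (chi n - 1 + 1)%C by ring. rewrite X; ring. }
    replace Sd with ((chi n - 1) * Sd * / (chi n - 1))%C by (field; auto).
    rewrite F. ring.
Qed.

(** This is separability at [d = 0], where [chi] vanishes because [gcd 0 q = q > 1]. *)
Lemma primitive_sum_0 : (1 < q)%nat -> csum chi q = 0%C.
Proof.
  intros Hq. assert (E := gauss_sum_separable 0).
  rewrite (csum_ext _ chi) in E.
  - rewrite E. replace (chi O) with (RtoC 0); [unfold Cconj, Cmult, RtoC; simpl; f_equal; ring|].
    symmetry. apply (char_0_iff q chi Hchi). rewrite Nat.gcd_0_l. lia.
  - intros i _. simpl Nat.mul. replace (er q 0) with (RtoC 1); [ring|].
    rewrite <- (er_q q 0) by lia. f_equal; lia.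
Qed.
End Primitive.

Lemma csum_single (f : nat -> C) n i0 : (i0 < n)%nat -> (forall i, (i < n)%nat -> i <> i0 -> f i = 0%C) ->
  csum f n = f i0.
Proof.
  intros H Hf. replace n with (i0 + S (n - i0 - 1))%nat in * by lia.
  rewrite csum_app, csum_shift, Nat.add_0_r.
  rewrite (csum_ext f (fun _ => RtoC 0) i0) by (intros; apply Hf; lia).
  rewrite (csum_ext _ (fun _ => RtoC 0) (n - i0 - 1)) by (intros; apply Hf; lia).
  rewrite !csum_zero. ring.
Qed.

(** The double sum of [chi h e^(2 pi i j (h - 1) / q)] over [j] and [h], evaluated both ways:
    separability in [h] and again in [j] gives the left side, orthogonality in [j] singles out
    [h = 1]. Here [q - 1] stands for -1. *)
Lemma gauss_sum_conj q chi : is_primitive_char q chi ->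
  (gauss_sum q (conj_char chi) * gauss_sum q chi * chi (q - 1)%nat = RtoC (INR q))%C.
Proof.
  intros Hp. assert (Hchi := proj1 Hp).
  assert (Hq := char_pos q chi Hchi).
  transitivity (csum (fun j => csum (fun h => chi h * er q (j * h)) q * er q ((q - 1) * j))%C q).
  - rewrite (csum_ext _ (fun j => gauss_sum q chi * (conj_char chi j * er q ((q - 1) * j)))%C)
      by (intros i _; rewrite (gauss_sum_separable q chi Hp); unfold conj_char; ring).
    rewrite csum_scal, (gauss_sum_separable q _ (conj_char_primitive q chi Hp)).
    unfold conj_char at 2. rewrite Cconj_conj. ring.
  - rewrite (csum_ext _ (fun j => csum (fun h => chi h * er q ((h + (q - 1)) * j)) q)%C).
    + rewrite csum_swap.
      rewrite (csum_ext _ (fun h => chi h * if Nat.eqb ((h + (q - 1)) mod q) 0 then RtoC (INR q) else RtoC 0)%C)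
        by (intros h _; now rewrite csum_scal, er_orth).
      assert (Hlt : (1 mod q < q)%nat) by (apply Nat.mod_upper_bound; lia).
      assert (Hm : forall h, (h < q)%nat -> ((h + (q - 1)) mod q = 0 <-> h = 1 mod q)%nat).
      { intros h Hh. destruct h as [|h].
        - simpl. rewrite Nat.mod_small by lia.
          destruct (Nat.eq_dec q 1) as [->|N]; [simpl; lia|]. rewrite Nat.mod_small; lia.
        - replace (S h + (q - 1))%nat with (h + 1 * q)%nat by lia.
          rewrite Nat.Div0.mod_add, !Nat.mod_small; lia. }
      rewrite (csum_single _ q (1 mod q) Hlt).
      * replace (Nat.eqb ((1 mod q + (q - 1)) mod q) 0) with true
          by (symmetry; apply Nat.eqb_eq, Hm; auto).
        rewrite (periodic_mod chi q 1) by apply (char_period q chi Hchi).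
        rewrite (char_1 q chi Hchi). ring.
      * intros i Hi Ni. destruct (Nat.eqb_spec ((i + (q - 1)) mod q) 0) as [E|E]; [|ring].
        apply Hm in E; auto. contradiction.
    + intros j _. rewrite Cmult_comm, <- csum_scal. apply csum_ext. intros h _.
      rewrite Nat.mul_add_distr_r, er_plus, (Nat.mul_comm h j). ring.
Qed.

(** * The Lipschitz formula twisted by a primitive character *)

Definition cpx (u v : R) : C := (u, v).

(** With [eps = chi (-1)], the two terms collect the indices [i] and [-i], so a sum over [i >= 1]
    covers all nonzero integers. *)
Definition kap (eps : C) (n : nat) (u v : R) : C :=
  (/ cpx u (- v) ^ n + eps * / cpx u v ^ n)%C.

Lemma csum_rev f n : csum f n = csum (fun i => f (n - 1 - i)%nat) n.
Proof.
  induction n as [|n IH]; auto.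
  rewrite (csum_shift (fun i => f (S n - 1 - i)%nat)). cbn [csum].
  rewrite IH, Cplus_comm. f_equal; [f_equal; lia|].
  apply csum_ext. intros i Hi; f_equal; lia.
Qed.

Lemma Csum_incr (a : nat -> C) l : a O = 0%C -> Csum (fun i => a (S i)) l -> Csum a l.
Proof.
  intros H0 H. apply Ccv_incr. eapply Ccv_ext; [|exact H].
  intros n. rewrite (csum_shift a), H0. ring.
Qed.

Lemma Cmod_pair_ge_fst u v : Rabs u <= Cmod (cpx u v).
Proof. exact (re_le_Cmod (u, v)). Qed.

Lemma Cmod_pair_ge_snd u v : Rabs v <= Cmod (cpx u v).
Proof. exact (Cmod_ge_Im (u, v)). Qed.

Lemma pair_neq_0 (u v : R) : 0 < u -> cpx u v <> 0%C.
Proof. intros H. now apply Re_pos_neq_0. Qed.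

Lemma twisted_sum_ex q (chi : nat -> C) w j (s : R) :
  (0 < q)%nat -> (forall n, Cmod (chi n) <= 1) -> Rabs s = 1 ->
  exists g, Csum (fun i => chi (S i) * / cpx w (s * (2 * PI * INR (S i) / INR q)) ^ (2 + j))%C g.
Proof.
  intros Hq Hc Hs. assert (Hpi := PI_gt_3).
  assert (Q : 0 < INR q) by (apply lt_0_INR; lia).
  set (c := 2 * PI / INR q). assert (Pc : 0 < c) by (apply Rdiv_lt_0_compat; lra).
  apply (Csum_ex _ (fun i => / c ^ (2 + j) * / INR (S i) ^ 2)).
  - intros i. rewrite Cmod_mult.
    assert (P := INR_S_pos i).
    set (z := cpx w (s * (2 * PI * INR (S i) / INR q))).
    assert (B : c * INR (S i) <= Cmod z).
    { eapply Rle_trans; [|apply Cmod_pair_ge_snd]. rewrite Rabs_mult, Hs, Rmult_1_l.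
      eapply Rle_trans; [|apply Rle_abs]. right; unfold c; field; lra. }
    generalize (inv_pow_bound c z j i Pc B) (Cmod_ge_0 (/ z ^ (2 + j))%C) (Cmod_ge_0 (chi (S i))) (Hc (S i)).
    nra.
  - apply ex_series_scal_R, ex_series_inv_sq.
Qed.

(** The Lipschitz formula is applied at [w + 2 pi i h / q] and summed over the residues [h] with
    weight [chi (-h)]. The poles reassemble into one series over all integers divided by [q]; on the
    other side the factors [e^(-2 pi i m h / q)] sum to [tau(chi)] times the conjugate of
    [chi m]. *)
Theorem twisted_lipschitz q chi w j :
  is_primitive_char q chi -> (1 < q)%nat -> 0 < w ->
  exists g e,
    Csum (fun i => chi (S i) * kap (chi (q - 1)%nat) (2 + j) w (2 * PI * INR (S i) / INR q))%C g /\
    Csum (fun m => Cconj (chi (S m)) * lexp (S j) w m)%C e /\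
    (INR (fact (S j)) * g = gauss_sum q chi * e)%C.
Proof.
  intros Hp Hq Hw. assert (Hchi := proj1 Hp). assert (Hpi := PI_gt_3).
  assert (Q : 0 < INR q) by (apply lt_0_INR; lia).
  assert (Hle := Cmod_char_le q chi Hchi).
  set (eps := chi (q - 1)%nat). set (n := (2 + j)%nat).
  set (F := fun (s : R) i => (chi i * / cpx w (s * (2 * PI * INR i / INR q)) ^ n)%C).
  destruct (twisted_sum_ex q chi w j 1) as [gp Gp]; [lia|auto|apply Rabs_R1|].
  destruct (twisted_sum_ex q chi w j (-1)) as [gm Gm]; [lia|auto|rewrite Rabs_left; lra|].
  change (Csum (fun i => F 1 (S i)) gp) in Gp. change (Csum (fun i => F (-1) (S i)) gm) in Gm.
  assert (Z0 : chi O = 0%C) by (apply (char_0_iff q chi Hchi); rewrite Nat.gcd_0_l; lia).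
  (* The upper halves of the pairs have indices [q l + h] starting from 0, the lower halves
     [q l + (q - h)] starting from 1. The upper series is therefore started at 0, where [chi]
     vanishes. *)
  assert (Gp0 : Csum (F 1) gp).
  { apply Csum_incr; auto. unfold F. rewrite Z0. ring. }
  exists (gm + eps * gp)%C.
  set (wh := fun h : nat => (RtoC w + iPI (INR h / INR q))%C).
  assert (Hwh : forall h, (h < q)%nat -> 0 < Re (wh h) /\ Rabs (Im (wh h)) <= 3 * PI).
  { intros h Hh. unfold wh. rewrite Re_shift_plus, Im_shift_plus. simpl. split; auto.
    assert (0 <= INR h / INR q <= 1).
    { assert (H1 := pos_INR h). apply lt_INR in Hh.
      split; [apply Rmult_le_pos; auto; left; now apply Rinv_0_lt_compat|].
      apply Rmult_le_reg_r with (INR q); auto. unfold Rdiv. rewrite Rmult_assoc, Rinv_l; lra. }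
    rewrite Rabs_pos_eq; nra. }
  assert (Hex : exists gh eh : nat -> C, forall h, (h < q)%nat ->
             Csum (lip n (wh h)) (gh h) /\ Csum (lexp (S j) (wh h)) (eh h)).
  { destruct (choose_fun (fun h (ge : C * C) => (h < q)%nat ->
       Csum (lip n (wh h)) (fst ge) /\ Csum (lexp (S j) (wh h)) (snd ge))) as [f Hf].
    (* For [h >= q] the pair is a default value; only residues are summed. *)
    - intros h. destruct (le_lt_dec q h) as [L|L]; [exists (RtoC 0, RtoC 0); lia|].
      destruct (Hwh h L) as [H1 H2]. destruct (lip_ex (wh h) j H1 H2) as [g G].
      destruct (lexp_ex (S j) (wh h) H1) as [e E]. now exists (g, e).
    - now exists (fun h => fst (f h)), (fun h => snd (f h)). }
  destruct Hex as [gh [eh Hge]].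
  assert (Rel : forall h, (h < q)%nat -> (INR (fact (S j)) * gh h = eh h)%C).
  { intros h Hh. destruct (Hwh h Hh), (Hge h Hh). now apply (lipschitz j (wh h)). }
  assert (SG : csum (fun h => chi (q - h)%nat * gh h)%C q = (gm + eps * gp)%C).
  { apply (Csum_unique (fun l => csum (fun h => chi (q - h)%nat * lip n (wh h) l)%C q)).
    - apply (Csum_csum (fun h l => chi (q - h)%nat * lip n (wh h) l)%C).
      intros h Hh. apply Csum_scal. now apply Hge.
    - assert (A1 := Csum_group _ _ q ltac:(lia) Gm).
      assert (A2 := Csum_scal eps _ _ (Csum_group _ _ q ltac:(lia) Gp0)).
      eapply Csum_ext; [|exact (Csum_plus _ _ _ _ A1 A2)].
      intros l. cbv beta. rewrite (csum_rev (fun h => F (-1) (S (q * l + h)))).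
      rewrite <- csum_scal, <- csum_plus. apply csum_ext. intros h Hh.
      unfold lip. rewrite Cmult_plus_distr_l, Cplus_comm. f_equal.
      + unfold F. rewrite (char_qmul q chi Hchi), (char_reflect q chi Hchi) by lia. fold eps.
        rewrite Cmult_assoc. do 3 f_equal. unfold cpx, wh, iPI, Cplus, RtoC; simpl.
        rewrite plus_INR, mult_INR. f_equal; field; lra.
      + unfold F. replace (S (q * l + (q - 1 - h))) with (q * l + (q - h))%nat by lia.
        rewrite (char_qmul q chi Hchi). do 3 f_equal.
        unfold cpx, wh, iPI, Cminus, Copp, Cplus, RtoC; cbn [fst snd].
        rewrite plus_INR, mult_INR, S_INR, minus_INR by lia. f_equal; field; lra. }
  assert (SE : Csum (fun m => gauss_sum q chi * (Cconj (chi (S m)) * lexp (S j) w m))%C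
                    (csum (fun h => chi (q - h)%nat * eh h)%C q)).
  { eapply Csum_ext; [|apply (Csum_csum (fun h m => chi (q - h)%nat * lexp (S j) (wh h) m)%C
        (fun h => chi (q - h)%nat * eh h)%C q); intros h Hh; apply Csum_scal; now apply Hge].
    intros m. cbv beta.
    rewrite (csum_ext _ (fun h => lexp (S j) w m * (chi (q - h)%nat * er q (S m * (q - h))))%C).
    - rewrite csum_scal, csum_rev.
      assert (E := gauss_sum_separable q chi Hp (S m)).
      (* After the reversal the residues run over [1..q] instead of [0..q-1]; the terms at the two
         ends agree. *)
      replace (csum (fun i => chi (q - (q - 1 - i))%nat * er q (S m * (q - (q - 1 - i))))%C q)
        with (csum (fun h => chi h * er q (S m * h))%C q).
      + rewrite E. ring.
      + assert (A := csum_shift (fun h => chi h * er q (S m * h))%C q). cbn [csum] in A.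
        assert (P := char_twist_period q chi Hp (S m) 0). simpl (0 + q)%nat in P. rewrite P in A.
        set (t := (chi O * er q (S m * 0))%C) in *.
        rewrite (csum_ext (fun i => chi (q - (q - 1 - i))%nat * er q (S m * (q - (q - 1 - i))))%C
                   (fun i => chi (S i) * er q (S m * S i))%C)
          by (intros i Hi; replace (q - (q - 1 - i))%nat with (S i) by lia; auto).
        set (u := csum (fun h => chi h * er q (S m * h))%C q) in *.
        set (v := csum (fun i => chi (S i) * er q (S m * S i))%C q) in *.
        transitivity (t + v - t)%C; [rewrite <- A; ring | ring].
    - intros h Hh. unfold lexp.
      replace (Cexp (- (INR (S m) * wh h))) with (Cexp (- (INR (S m) * w)) * er q (S m * (q - h)))%C; [ring|].
      assert (X : er q (S m * (q - h)) = Cexp (- iPI (INR (S m) * (INR h / INR q)))).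
      { transitivity (er q (S m * (q - h)) * Cexp (iPI (INR (S m) * (INR h / INR q)))
                      * Cexp (- iPI (INR (S m) * (INR h / INR q))))%C.
        - rewrite <- Cmult_assoc, <- Cexp_plus.
          replace (iPI (INR (S m) * (INR h / INR q)) + - iPI (INR (S m) * (INR h / INR q)))%C
            with (RtoC 0) by ring. rewrite Cexp_0. ring.
        - replace (Cexp (iPI (INR (S m) * (INR h / INR q)))) with (er q (S m * h)).
          + rewrite <- er_plus. replace (S m * (q - h) + S m * h)%nat with (q * S m)%nat by nia.
            rewrite er_q by lia. ring.
          + unfold er. do 2 f_equal. rewrite mult_INR. unfold Rdiv; ring. }
      rewrite X, <- Cexp_plus. f_equal. unfold wh.
      unfold iPI, Copp, Cplus, Cmult, RtoC; cbn [fst snd]. f_equal; field; lra. }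
  destruct (Csum_ex (fun m => Cconj (chi (S m)) * lexp (S j) w m)%C
              (fun m => INR (S m) ^ S j * exp (- (INR (S m) * w)))) as [e He].
  { intros m. rewrite Cmod_mult, Cmod_conj, Cmod_lexp. simpl Re.
    assert (0 <= INR (S m) ^ S j * exp (- (INR (S m) * w)))
      by (apply Rmult_le_pos; [apply pow_le, pos_INR | left; apply exp_pos]).
    specialize (Hle (S m)). nra. }
  { now apply ex_series_pow_exp. }
  exists e. split; [|split; [exact He|]].
  - eapply Csum_ext; [|exact (Csum_plus _ _ _ _ Gm (Csum_scal eps _ _ Gp))].
    intros i. unfold F, kap.
    replace (-1 * (2 * PI * INR (S i) / INR q)) with (- (2 * PI * INR (S i) / INR q)) by ring.
    rewrite Rmult_1_l. ring.
  - rewrite <- SG, <- csum_scal.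
    rewrite (csum_ext _ (fun h => chi (q - h)%nat * eh h)%C)
      by (intros h Hh; rewrite <- Rel by auto; ring).
    apply (Csum_unique _ _ _ SE). now apply Csum_scal.
Qed.

(** * The modular relation *)

Lemma inv_pow_diff (s : C) (h : R) n : 0 < Re s -> 0 <= h ->
  Cmod (/ (s + h) ^ n - / s ^ n)%C <= INR n * h * / Cmod s ^ S n.
Proof.
  intros Hs Hh.
  assert (Hs0 : s <> 0%C) by now apply Re_pos_neq_0.
  assert (Hsh : (s + h)%C <> 0%C) by (apply Re_pos_neq_0; destruct s; simpl in *; lra).
  set (a := (/ s)%C). set (b := (/ (s + h))%C).
  assert (Pa : 0 < Cmod s) by now apply Cmod_gt_0.
  assert (Hab : Cmod b <= Cmod a).
  { unfold a, b. rewrite !Cmod_inv by auto. apply Rinv_le_contravar; auto.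
    assert (Q1 := Cmod2_alt s). assert (Q2 := Cmod2_alt (s + h)%C).
    assert (R1 : Re (s + h)%C = Re s + h) by (destruct s; simpl; ring).
    assert (R2 : Im (s + h)%C = Im s) by (destruct s; simpl; ring).
    rewrite R1, R2 in Q2. assert (P2 := Cmod_ge_0 (s + h)%C). nra. }
  assert (Hd : (b - a)%C = (- (h * a * b))%C) by (unfold a, b; field; auto).
  replace (/ Cmod s ^ S n) with (Cmod a ^ S n) by (unfold a; rewrite Cmod_inv, pow_inv; auto).
  rewrite <- !Cpow_inv by auto. fold a b.
  assert (Ma := Cmod_ge_0 a). assert (Mb := Cmod_ge_0 b).
  induction n as [|n IH].
  - simpl. replace (1 - 1)%C with (RtoC 0) by ring. rewrite Cmod_0. lra.
  - replace (b ^ S n - a ^ S n)%C with (b * (b ^ n - a ^ n) + a ^ n * (b - a))%C by (simpl; ring).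
    rewrite Hd. eapply Rle_trans; [apply Cmod_triangle|].
    rewrite !Cmod_mult, Cmod_opp, !Cmod_mult, Cmod_pow, Cmod_RtoC_pos by auto.
    apply Rle_trans with (Cmod a * (INR n * h * Cmod a ^ S n) + Cmod a ^ n * (h * Cmod a * Cmod a)).
    + apply Rplus_le_compat.
      * apply Rmult_le_compat; auto using Cmod_ge_0.
      * apply Rmult_le_compat_l; [now apply pow_le|]. apply Rmult_le_compat_l; auto.
        now apply Rmult_le_pos.
    + right. rewrite S_INR. simpl. ring.
Qed.

(** An increment of [u] gains one power of [|u + i v|]; this gain is what grouping into periods
    exploits. *)
Lemma kap_diff eps n u u' v : Cmod eps = 1 -> 0 < u <= u' ->
  Cmod (kap eps n u' v - kap eps n u v)%C <= 2 * (INR n * (u' - u) * / Cmod (cpx u v) ^ S n).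
Proof.
  intros He Hu. unfold kap.
  replace (cpx u' (- v)) with (cpx u (- v) + RtoC (u' - u))%C
    by (unfold cpx, Cplus, RtoC; simpl; f_equal; ring).
  replace (cpx u' v) with (cpx u v + RtoC (u' - u))%C
    by (unfold cpx, Cplus, RtoC; simpl; f_equal; ring).
  assert (D1 := inv_pow_diff (cpx u (- v)) (u' - u) n).
  assert (D2 := inv_pow_diff (cpx u v) (u' - u) n).
  simpl Re in D1, D2. specialize (D1 ltac:(lra) ltac:(lra)). specialize (D2 ltac:(lra) ltac:(lra)).
  assert (E : Cmod (cpx u (- v)) = Cmod (cpx u v)).
  { unfold Cmod, cpx; simpl. f_equal; ring. }
  rewrite E in D1.
  set (A := (/ (cpx u (- v) + RtoC (u' - u)) ^ n - / cpx u (- v) ^ n)%C) in *.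
  set (B := (/ (cpx u v + RtoC (u' - u)) ^ n - / cpx u v ^ n)%C) in *.
  match goal with |- Cmod ?z <= _ => replace z with (A + eps * B)%C by (unfold A, B; ring) end.
  eapply Rle_trans; [apply Cmod_triangle|]. rewrite Cmod_mult, He. lra.
Qed.

Lemma kap_scale eps n lam u v : 0 < lam -> 0 < u ->
  kap eps n (lam * u) (lam * v) = (/ RtoC lam ^ n * kap eps n u v)%C.
Proof.
  intros Hl Hu. unfold kap.
  replace (cpx (lam * u) (- (lam * v))) with (RtoC lam * cpx u (- v))%C
    by (unfold cpx, Cmult, RtoC; simpl; f_equal; ring).
  replace (cpx (lam * u) (lam * v)) with (RtoC lam * cpx u v)%C
    by (unfold cpx, Cmult, RtoC; simpl; f_equal; ring).
  assert (L : RtoC lam <> 0%C) by (apply RtoC_neq_0; lra).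
  assert (N1 := pair_neq_0 u v Hu). assert (N2 := pair_neq_0 u (- v) Hu).
  rewrite !Cpow_mult_l. field. repeat split; apply Cpow_nz; auto.
Qed.

(* [v - iu = -i (u + iv)] and [v + iu = i (u - iv)]. *)
Lemma kap_flip eps m u v : (eps * eps = 1)%C -> 0 < u ->
  kap eps (2 * m) u v = (eps * (-1) ^ m * kap eps (2 * m) v u)%C.
Proof.
  intros He Hu. unfold kap.
  replace (cpx v (- u)) with ((- Ci) * cpx u v)%C
    by (unfold cpx, Ci, Copp, Cmult, RtoC; simpl; f_equal; ring).
  replace (cpx v u) with (Ci * cpx u (- v))%C
    by (unfold cpx, Ci, Cmult, RtoC; simpl; f_equal; ring).
  assert (N1 := pair_neq_0 u v Hu). assert (N2 := pair_neq_0 u (- v) Hu).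
  rewrite !Cpow_mult_l, (Cpow_mult_r (- Ci)), (Cpow_mult_r Ci).
  replace ((- Ci) ^ 2)%C with (RtoC (-1)) by (simpl; unfold Ci, Copp, Cmult, RtoC; simpl; f_equal; ring).
  replace (Ci ^ 2)%C with (RtoC (-1)) by (simpl; unfold Ci, Cmult, RtoC; simpl; f_equal; ring).
  assert (N3 : (RtoC (-1)) <> 0%C) by (apply RtoC_neq_0; lra).
  transitivity ((eps * eps) * / cpx u (- v) ^ (2 * m) + eps * / cpx u v ^ (2 * m))%C.
  - rewrite He. ring.
  - field. repeat split; apply Cpow_nz; auto.
Qed.

(** The character sums to 0 over a full period, so the value of [K] at the start of the block may be
    subtracted from all its values there. *)
Lemma char_block_sum q chi (K : nat -> C) : is_primitive_char q chi -> (1 < q)%nat -> forall M,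
  csum (fun h => chi (S (q * M + h)) * K (q * M + h)%nat)%C q
  = csum (fun h => chi (S h) * (K (q * M + h)%nat - K (q * M)%nat))%C q.
Proof.
  intros Hp Hq M. assert (Hchi := proj1 Hp).
  assert (Z : csum (fun h => chi (S h)) q = 0%C).
  { rewrite <- (primitive_sum_0 q chi Hp Hq).
    assert (A := csum_shift chi q). cbn [csum] in A. rewrite (char_q q chi Hchi) in A.
    transitivity (chi O + csum (fun h => chi (S h)) q - chi O)%C; [ring|]. rewrite <- A. ring. }
  rewrite (csum_ext (fun h => chi (S h) * (K (q * M + h)%nat - K (q * M)%nat))%C
    (fun h => chi (S (q * M + h)) * K (q * M + h)%nat - K (q * M)%nat * chi (S h))%C).
  - rewrite csum_minus, csum_scal, Z. ring.
  - intros h _. replace (S (q * M + h)) with (q * M + S h)%nat by lia.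
    rewrite (char_qmul q chi Hchi). ring.
Qed.

(** A block is a sum of increments of the kernel, hence of order [|u + i v|^(-(j+3))]. From
    [|u + i v|^2 >= u v] three of these powers give [(u v)^(-3/2)], summable in both variables even
    for [j = 0]; the other [j] are bounded through [|u + i v| >= y]. *)
Lemma block_bound q chi p j y eps : is_primitive_char q chi -> (1 < q)%nat -> (0 < p)%nat -> 0 < y ->
  Cmod eps = 1 ->
  exists K, 0 <= K /\ forall M i,
    Cmod (csum (fun h => chi (S (q * M + h)) *
            kap eps (2 + j) (INR (S (q * M + h)) * y) (2 * PI * INR (S i) / INR p))%C q)
    <= K * Rpower (INR (S M)) (- (1 + / 2)) * Rpower (INR (S i)) (- (1 + / 2)).
Proof.
  intros Hp Hq Hpp Hy He. assert (Hchi := proj1 Hp). assert (Hpi := PI_gt_3).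
  assert (Q : 0 < INR q) by (apply lt_0_INR; lia). assert (P : 0 < INR p) by (apply lt_0_INR; lia).
  set (n := (2 + j)%nat).
  set (K0 := 2 * (INR n * (INR q * y)) * / y ^ j).
  assert (PK0 : 0 <= K0).
  { unfold K0. repeat apply Rmult_le_pos; try lra; [apply pos_INR|].
    left; apply Rinv_0_lt_compat, pow_lt; auto. }
  (* From [u >= (M + 1) y] and [v >= (i + 1) / p]. *)
  set (c := y * / INR p). assert (Pc : 0 < c) by (apply Rmult_lt_0_compat; auto; now apply Rinv_0_lt_compat).
  exists (INR q * K0 * Rpower c (- (1 + / 2))). split.
  { apply Rmult_le_pos; [apply Rmult_le_pos; lra | left; apply Rpower_pos]. }
  intros M i. set (v := 2 * PI * INR (S i) / INR p).
  assert (PM := INR_S_pos M). assert (Pi := INR_S_pos i).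
  set (b := INR (S (q * M)) * y).
  assert (Hb : INR (S M) * y <= b).
  { unfold b. apply Rmult_le_compat_r; [lra|]. apply le_INR. nia. }
  assert (Pb : y <= b).
  { eapply Rle_trans; [|exact Hb]. rewrite S_INR. generalize (pos_INR M). nra. }
  assert (Pv : INR (S i) * / INR p <= v).
  { unfold v, Rdiv. apply Rmult_le_compat_r; [left; now apply Rinv_0_lt_compat|]. nra. }
  assert (Piv : 0 < INR (S i) * / INR p) by (apply Rmult_lt_0_compat; auto; now apply Rinv_0_lt_compat).
  set (r := Cmod (cpx b v)).
  assert (Hr1 : y <= r).
  { eapply Rle_trans; [exact Pb|]. eapply Rle_trans; [apply Rle_abs | apply Cmod_pair_ge_fst]. }
  assert (Hr2 : c * INR (S M) * INR (S i) <= r ^ 2).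
  { unfold r. rewrite Cmod2_alt. simpl Re; simpl Im.
    assert (X : (INR (S M) * y) * (INR (S i) * / INR p) <= b * v)
      by (apply Rmult_le_compat; try lra; apply Rmult_le_pos; lra).
    replace (c * INR (S M) * INR (S i)) with ((INR (S M) * y) * (INR (S i) * / INR p))
      by (unfold c; field; lra).
    assert (0 <= (b - v) ^ 2) by apply pow2_ge_0.
    assert (0 <= b * v) by (apply Rmult_le_pos; lra). nra. }
  assert (Pr : 0 < r) by lra.
  assert (Pcm : 0 < c * INR (S M)) by now apply Rmult_lt_0_compat.
  assert (Pcmi : 0 < c * INR (S M) * INR (S i)) by now apply Rmult_lt_0_compat.
  assert (Hr3 : / r ^ S n <= / y ^ j * (Rpower c (- (1 + / 2)) * Rpower (INR (S M)) (- (1 + / 2))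
                                       * Rpower (INR (S i)) (- (1 + / 2)))).
  { rewrite !Rpower_mult_distr by auto.
    replace (S n) with (j + 3)%nat by (unfold n; lia).
    rewrite pow_add, Rinv_mult.
    apply Rmult_le_compat.
    - left; apply Rinv_0_lt_compat, pow_lt; auto.
    - left; apply Rinv_0_lt_compat, pow_lt; auto.
    - apply Rinv_le_contravar; [now apply pow_lt|]. apply pow_incr; lra.
    - replace (/ r ^ 3) with (Rpower (r ^ 2) (- (1 + / 2))).
      + rewrite !Rpower_Ropp. apply Rinv_le_contravar; [apply Rpower_pos|].
        apply Rle_Rpower_l; [lra|]. split; auto.
      + rewrite <- (Rpower_pow 2 r Pr), Rpower_mult, <- (Rpower_neg_pow r 3 Pr).
        f_equal. simpl; field. }
  rewrite (char_block_sum q chi (fun m => kap eps n (INR (S m) * y) v)); auto.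
  eapply Rle_trans; [apply Cmod_csum|].
  apply Rle_trans with (rsum (fun _ => K0 * (Rpower c (- (1 + / 2)) * Rpower (INR (S M)) (- (1 + / 2))
                                       * Rpower (INR (S i)) (- (1 + / 2)))) q).
  - apply rsum_le. intros h Hh. rewrite Cmod_mult.
    assert (D := kap_diff eps n b (INR (S (q * M + h)) * y) v He).
    assert (Hbh : b <= INR (S (q * M + h)) * y)
      by (unfold b; apply Rmult_le_compat_r; [lra|]; apply le_INR; lia).
    specialize (D ltac:(lra)).
    assert (Hd : INR (S (q * M + h)) * y - b <= INR q * y).
    { unfold b. rewrite !S_INR, plus_INR. apply lt_INR in Hh. nra. }
    assert (PR : 0 < / Cmod (cpx b v) ^ S n) by (apply Rinv_0_lt_compat, pow_lt; auto).
    assert (Cl := Cmod_char_le q chi Hchi (S h)).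
    assert (C0 := Cmod_ge_0 (chi (S h))).
    unfold b in D at 3.
    match goal with |- _ * Cmod ?z <= _ => set (Z := Cmod z) in *; assert (PZ : 0 <= Z) by apply Cmod_ge_0 end.
    fold b in D.
    apply Rle_trans with Z; [nra|].
    eapply Rle_trans; [exact D|]. fold r in PR |- *. unfold K0.
    apply Rle_trans with (2 * (INR n * (INR q * y) * / r ^ S n)).
    + apply Rmult_le_compat_l; [lra|]. apply Rmult_le_compat_r; [lra|].
      apply Rmult_le_compat_l; [apply pos_INR | auto].
    + replace (2 * (INR n * (INR q * y)) * / y ^ j *
       (Rpower c (- (1 + / 2)) * Rpower (INR (S M)) (- (1 + / 2)) * Rpower (INR (S i)) (- (1 + / 2))))
      with (2 * (INR n * (INR q * y) * (/ y ^ j *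
       (Rpower c (- (1 + / 2)) * Rpower (INR (S M)) (- (1 + / 2)) * Rpower (INR (S i)) (- (1 + / 2)))))) by ring.
      apply Rmult_le_compat_l; [lra|]. apply Rmult_le_compat_l; auto.
      apply Rmult_le_pos; [apply pos_INR | apply Rmult_le_pos; lra].
  - rewrite rsum_const. right; ring.
Qed.

(* Grouping [m] into periods of [chi2] makes the double series absolutely convergent even for
   weight 2 ([j = 0]). *)
Theorem modular_relation p q chi1 chi2 m0 j y (e f : nat -> C) s1 s2 :
  is_primitive_char p chi1 -> is_primitive_char q chi2 -> (1 < p)%nat -> (1 < q)%nat ->
  chi1 (p - 1)%nat = chi2 (q - 1)%nat -> (chi2 (q - 1)%nat * chi2 (q - 1)%nat = 1)%C ->
  (2 + j = 2 * m0)%nat -> 0 < y ->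
  (forall m, Csum (fun d => chi1 (S d) * lexp (S j) (RtoC (INR (S m) * y)) d)%C (e m)) ->
  (forall i, Csum (fun d => conj_char chi2 (S d)
       * lexp (S j) (RtoC (INR (S i) * (4 * PI ^ 2 / (INR p * INR q * y)))) d)%C (f i)) ->
  Csum (fun m => chi2 (S m) * e m)%C s1 -> Csum (fun i => conj_char chi1 (S i) * f i)%C s2 ->
  (gauss_sum p (conj_char chi1) * s1
   = / RtoC (INR q * y / (2 * PI)) ^ (2 + j) * (chi2 (q - 1)%nat * (-1) ^ m0) * gauss_sum q chi2 * s2)%C.
Proof.
  intros Hp1 Hp2 Hp Hq Hpar He Hj Hy He1 Hf2 S1 S2.
  assert (Hpi := PI_gt_3).
  assert (Q : 0 < INR q) by (apply lt_0_INR; lia). assert (P : 0 < INR p) by (apply lt_0_INR; lia).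
  set (eps := chi2 (q - 1)%nat) in *.
  set (F := INR (fact (S j))). assert (PF : RtoC F <> 0%C) by (apply RtoC_neq_0, INR_fact_neq_0).
  (* The scaling that carries the points [2 pi m / q] and [W i] of the dual expansion to [m y] and
     [al i]. *)
  set (lam := INR q * y / (2 * PI)).
  assert (Pl : 0 < lam) by (apply Rdiv_lt_0_compat; [now apply Rmult_lt_0_compat | lra]).
  set (W := fun i : nat => INR (S i) * (4 * PI ^ 2 / (INR p * INR q * y))).
  set (al := fun i : nat => 2 * PI * INR (S i) / INR p).
  assert (Heps : Cmod eps = 1).
  { apply (f_equal Cmod) in He. rewrite Cmod_mult, Cmod_1 in He.
    assert (T := Cmod_ge_0 eps). nra. }
  (* [eps] squares to 1, so it is its own conjugate. *)
  assert (Epar : conj_char chi1 (p - 1)%nat = eps).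
  { unfold conj_char. rewrite Hpar. fold eps.
    transitivity (Cconj eps * (eps * eps))%C; [rewrite He; ring|].
    rewrite Cmult_assoc, (Cmult_comm (Cconj eps)), <- Cmod2_conj, Heps, pow1. ring. }
  set (tau1 := gauss_sum p (conj_char chi1)). set (tau2 := gauss_sum q chi2).
  (* The power of [lam] comes from homogeneity of the kernel, the rest from exchanging its two
     variables. *)
  set (kp := (/ RtoC lam ^ (2 + j) * (eps * (-1) ^ m0))%C).
  assert (T1 : forall m, Csum (fun i => conj_char chi1 (S i) * kap eps (2 + j) (INR (S m) * y) (al i))%C
                              (tau1 / F * e m)%C).
  { intros m. assert (Hw : 0 < INR (S m) * y) by (apply Rmult_lt_0_compat; auto; apply INR_S_pos).
    destruct (twisted_lipschitz p (conj_char chi1) (INR (S m) * y) j (conj_char_primitive _ _ Hp1) Hp Hw)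
      as [g [e' [G [E R]]]].
    rewrite Epar in G. replace (tau1 / F * e m)%C with g; [exact G|].
    assert (Ee : e' = e m).
    { apply (Csum_unique _ _ _ E). eapply Csum_ext; [|apply He1].
      intros d. unfold conj_char. now rewrite Cconj_conj. }
    rewrite Ee in R. fold F tau1 in R.
    replace g with (F * g / F)%C by (field; auto). rewrite R. field; auto. }
  assert (T2 : forall i, Csum (fun m => chi2 (S m) * kap eps (2 + j) (INR (S m) * y) (al i))%C
                              (kp * (tau2 / F) * f i)%C).
  { intros i. assert (Hw : 0 < W i).
    { apply Rmult_lt_0_compat; [apply INR_S_pos|]. apply Rdiv_lt_0_compat; [nra|].
      repeat apply Rmult_lt_0_compat; auto. }
    destruct (twisted_lipschitz q chi2 (W i) j Hp2 Hq Hw) as [g [e' [G [E R]]]].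
    fold eps in G.
    assert (Ee : e' = f i) by (apply (Csum_unique _ _ _ E); apply Hf2).
    rewrite Ee in R. fold F tau2 in R.
    replace (kp * (tau2 / F) * f i)%C with (kp * g)%C.
    - eapply Csum_ext; [|exact (Csum_scal kp _ _ G)].
      intros m. cbv beta.
      replace (INR (S m) * y) with (lam * (2 * PI * INR (S m) / INR q)) by (unfold lam; field; lra).
      replace (al i) with (lam * W i) by (unfold lam, W, al; field; lra).
      assert (Pm : 0 < 2 * PI * INR (S m) / INR q).
      { apply Rdiv_lt_0_compat; auto. apply Rmult_lt_0_compat; [lra | apply INR_S_pos]. }
      rewrite kap_scale by auto. rewrite Hj, (kap_flip eps m0 (2 * PI * INR (S m) / INR q)) by auto.
      unfold kp. rewrite Hj. ring.
    - replace g with (F * g / F)%C by (field; auto). rewrite R. field; auto. }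
  destruct (block_bound q chi2 p j y eps Hp2 Hq ltac:(lia) Hy Heps) as [K [PK HK]].
  assert (G1 : Csum (fun m => chi2 (S m) * (tau1 / F * e m))%C (tau1 / F * s1)%C).
  { eapply Csum_ext; [|exact (Csum_scal (tau1 / F)%C _ _ S1)]. intros m; cbv beta; ring. }
  assert (G2 : Csum (fun i => conj_char chi1 (S i) * (kp * (tau2 / F) * f i))%C (kp * (tau2 / F) * s2)%C).
  { eapply Csum_ext; [|exact (Csum_scal (kp * (tau2 / F))%C _ _ S2)]. intros m; cbv beta; ring. }
  (* The [m] sum is taken in blocks of length [q], for which the double series has a product
     majorant; rows are summed by [T1], columns by [T2]. *)
  assert (Main : (tau1 / F * s1 = kp * (tau2 / F) * s2)%C).
  { apply (Csum_unique (fun M => csum (fun h => chi2 (S (q * M + h)) * (tau1 / F * e (q * M + h)%nat))%C q)).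
    { apply (Csum_group _ _ q) in G1; [exact G1 | lia]. }
    apply (Csum_fubini_prod (fun M i => conj_char chi1 (S i) * csum (fun h => chi2 (S (q * M + h)) *
            kap eps (2 + j) (INR (S (q * M + h)) * y) (al i)) q)%C
            (fun M => K * Rpower (INR (S M)) (- (1 + / 2))) (fun i => Rpower (INR (S i)) (- (1 + / 2)))
            _ (fun i => conj_char chi1 (S i) * (kp * (tau2 / F) * f i))%C).
    - intros M i. rewrite Cmod_mult.
      assert (C1 := Cmod_char_le p _ (conj_char_dirichlet p chi1 (proj1 Hp1)) (S i)).
      assert (C0 := Cmod_ge_0 (conj_char chi1 (S i))). specialize (HK M i). fold (al i) in HK.
      match goal with |- _ * Cmod ?z <= _ => assert (Z := Cmod_ge_0 z); set (zz := Cmod z) in * end.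
      nra.
    - intros M. apply Rmult_le_pos; auto. left; apply Rpower_pos.
    - intros i. left; apply Rpower_pos.
    - apply ex_series_scal_R, ex_series_Rpower; lra.
    - apply ex_series_Rpower; lra.
    - intros M.
      eapply Csum_ext; [|apply (Csum_csum (fun h i => chi2 (S (q * M + h)) * (conj_char chi1 (S i) *
            kap eps (2 + j) (INR (S (q * M + h)) * y) (al i)))%C
            (fun h => chi2 (S (q * M + h)) * (tau1 / F * e (q * M + h)%nat))%C q);
          intros h _; apply Csum_scal, T1].
      intros i. cbv beta. rewrite <- csum_scal. apply csum_ext; intros; ring.
    - intros i. apply Csum_scal.
      exact (Csum_group _ _ q ltac:(lia) (T2 i)).
    - exact G2. }
  transitivity (F * (tau1 / F * s1))%C; [field; auto|].
  rewrite Main. fold kp. field; auto.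
Qed.

(** * Divisor sums *)

(* Indices are shifted by one: [divs b n d] is the contribution of the divisor [d + 1] of [n + 1] to
   a divisor sum whose term at [(d + 1) (m + 1) = n + 1] is [b d m]. *)
Definition divs (b : nat -> nat -> C) (n d : nat) : C :=
  if Nat.eqb (S n mod S d) 0 then b d (pred (S n / S d)) else RtoC 0.

(** Among [1..N] the multiples of [S d] are its products with [1..N / S d], so spreading [g] over
    them merely repeats its partial sums. *)
Lemma divs_partial (g : nat -> C) d N :
  csum (fun n => if Nat.eqb (S n mod S d) 0 then g (pred (S n / S d)) else RtoC 0) N = csum g (N / S d).
Proof.
  induction N as [|N IH]; [now rewrite Nat.Div0.div_0_l|].
  cbn [csum]. rewrite IH.
  assert (E1 := Nat.div_mod_eq N (S d)). assert (E2 := Nat.div_mod_eq (S N) (S d)).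
  assert (B1 := Nat.mod_upper_bound N (S d) ltac:(lia)).
  assert (B2 := Nat.mod_upper_bound (S N) (S d) ltac:(lia)).
  destruct (Nat.eqb_spec (S N mod S d) 0) as [E|E].
  - assert (Q : (S N / S d = S (N / S d))%nat) by nia.
    rewrite Q. reflexivity.
  - assert (Q : (S N / S d = N / S d)%nat) by nia.
    rewrite Q. ring.
Qed.

Lemma Csum_multiples (g : nat -> C) d l : Csum g l ->
  Csum (fun n => if Nat.eqb (S n mod S d) 0 then g (pred (S n / S d)) else RtoC 0) l.
Proof.
  intros H. eapply Ccv_ext; [intros N; symmetry; apply divs_partial|].
  apply (Ccv_subseq (csum g) l (fun N => N / S d)%nat); auto.
  intros K. exists (S d * K)%nat. intros n Hn. now apply Nat.div_le_lower_bound.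
Qed.

(** Two exchanges of summation: one replaces the sum by columns [m] with the sum by rows [d]; the
    other acts after each row has been spread over the multiples of [d + 1], and collects the terms
    with equal product. *)
Lemma Csum_divisors b u v e s :
  (forall d m, Cmod (b d m) <= u d * v m) ->
  (forall d, 0 <= u d) -> (forall m, 0 <= v m) -> ex_series u -> ex_series v ->
  (forall m, Csum (fun d => b d m) (e m)) -> Csum e s ->
  Csum (fun n => csum (divs b n) (S n)) s.
Proof.
  intros H Pu Pv Hu Hv He Hs.
  destruct Hv as [V HV].
  assert (Hrow : forall d, exists l, Csum (fun m => b d m) l).
  { intros d. apply (Csum_ex _ (fun m => u d * v m)); auto. apply ex_series_scal_R. now exists V. }
  destruct (choose_fun _ Hrow) as [r Hr].
  assert (Hr' : Csum r s).
  { apply (Csum_fubini_prod b u v r e s); auto. now exists V. }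
  apply (Csum_fubini (divs b) (fun d => V * u d) _ r); auto.
  - intros d n.
    apply Rle_trans with (rsum (fun m => Cmod (b d m)) (n / S d)).
    + right.
      assert (E := divs_partial (fun m => RtoC (Cmod (b d m))) d n).
      rewrite csum_RtoC in E. apply RtoC_inj. rewrite <- E, <- csum_RtoC.
      apply csum_ext. intros i _. unfold divs. destruct (Nat.eqb _ _); auto. now rewrite Cmod_0.
    + apply Rle_trans with (rsum (fun m => u d * v m) (n / S d)).
      * apply rsum_le; auto.
      * rewrite rsum_scal, Rmult_comm. apply Rmult_le_compat_r; auto. now apply rsum_le_series.
  - now apply ex_series_scal_R.
  - intros n. apply Csum_finite. intros d Hd. unfold divs.
    rewrite Nat.mod_small by lia. reflexivity.
  - intros d. apply (Csum_multiples (b d)), Hr.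
Qed.

Lemma Csum_ex_series (x : nat -> R) l : (forall n, 0 <= x n) -> Csum (fun n => RtoC (x n)) l -> ex_series x.
Proof.
  intros Px H. destruct (H 1 Rlt_0_1) as [N HN].
  apply (ex_series_bounded x (Cmod l + 1)); auto.
  intros n. specialize (HN (N + n)%nat ltac:(lia)).
  rewrite csum_RtoC in HN.
  assert (L := rsum_mono x n (N + n) Px ltac:(lia)).
  assert (T := Cmod_triangle (RtoC (rsum x (N + n)) - l) l).
  replace (RtoC (rsum x (N + n)) - l + l)%C with (RtoC (rsum x (N + n))) in T by ring.
  rewrite Cmod_RtoC_pos in T by now apply rsum_pos. lra.
Qed.

Lemma Rcpow_nat d k : (0 < d)%nat -> Rcpow (INR d) (RtoC (INR k)) = RtoC (INR d ^ k).
Proof.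
  intros Hd. assert (P : 0 < INR d) by now apply lt_0_INR.
  unfold Rcpow. rewrite <- RtoC_mult, Cexp_RtoC. f_equal. now rewrite <- Rpower_pow.
Qed.

Lemma sigma_char_divs k chi1 chi2 n :
  sigma_char (RtoC (INR k)) chi1 chi2 (S n)
  = csum (divs (fun d m => RtoC (INR (S d) ^ k) * chi1 (S d) * chi2 (S m))%C n) (S n).
Proof.
  unfold sigma_char. rewrite sum_n_csum. simpl Nat.pred. apply csum_ext.
  intros d Hd. cbv zeta. unfold divs. destruct (Nat.eqb_spec (S n mod S d) 0) as [E|E]; auto.
  rewrite Rcpow_nat by lia. do 2 f_equal.
  assert (0 < S n / S d)%nat by (apply Nat.div_str_pos; lia). lia.
Qed.

(** A weight depending only on the product is constant along a divisor sum. *)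
Lemma divs_scal b c n :
  csum (divs (fun d m => b d m * c (S d * S m)%nat)%C n) (S n) = (csum (divs b n) (S n) * c (S n))%C.
Proof.
  rewrite Cmult_comm, <- csum_scal. apply csum_ext. intros d Hd. unfold divs.
  destruct (Nat.eqb_spec (S n mod S d) 0) as [E|E]; [|ring].
  assert (Q : (0 < S n / S d)%nat) by (apply Nat.div_str_pos; lia).
  replace (S d * S (pred (S n / S d)))%nat with (S n); [ring|].
  rewrite Nat.succ_pred by lia. assert (X := Nat.div_mod_eq (S n) (S d)). lia.
Qed.

Lemma exp_le x y : x <= y -> exp x <= exp y.
Proof. intros [H | ->]; [left; now apply exp_increasing | lra]. Qed.

(** For [d, m >= 1], [d m >= (d + m) / 2], so [e^(-d m y)] is at most [e^(-d y / 2) e^(-m y / 2)],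
    which gives the product majorant needed to regroup by [n = d m]. *)
Lemma sigma_exp_sum k chi1 chi2 y (e : nat -> C) s :
  0 < y -> (forall n, Cmod (chi1 n) <= 1) -> (forall n, Cmod (chi2 n) <= 1) ->
  (forall m, Csum (fun d => chi1 (S d) * lexp k (RtoC (INR (S m) * y)) d)%C (e m)) ->
  Csum (fun m => chi2 (S m) * e m)%C s ->
  Csum (fun n => sigma_char (RtoC (INR k)) chi1 chi2 (S n) * RtoC (exp (- (INR (S n) * y))))%C s.
Proof.
  intros Hy H1 H2 He Hs.
  set (b := fun d m => (RtoC (INR (S d) ^ k) * chi1 (S d) * chi2 (S m))%C).
  set (c := fun n => RtoC (exp (- (INR n * y)))).
  apply (Csum_ext (fun n => csum (divs (fun d m => b d m * c (S d * S m)%nat)%C n) (S n))).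
  { intros n. now rewrite (divs_scal b c), sigma_char_divs. }
  apply (Csum_divisors _ (fun d => INR (S d) ^ k * exp (- (INR (S d) * (y / 2))))
     (fun m => INR (S m) ^ 0 * exp (- (INR (S m) * (y / 2)))) (fun m => chi2 (S m) * e m)%C); auto.
  - intros d m. unfold b, c.
    rewrite !Cmod_mult, !Cmod_RtoC_pos by first [apply pow_le, pos_INR | left; apply exp_pos].
    rewrite mult_INR.
    assert (Q : 1 <= INR (S d)) by (rewrite S_INR; generalize (pos_INR d); lra).
    assert (Q' : 1 <= INR (S m)) by (rewrite S_INR; generalize (pos_INR m); lra).
    assert (L : exp (- (INR (S d) * INR (S m) * y)) <= exp (- (INR (S d) * (y / 2))) * exp (- (INR (S m) * (y / 2)))).
    { rewrite <- exp_plus. apply exp_le.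
      assert (0 <= (INR (S d) - 1) * (INR (S m) - 1)) by (apply Rmult_le_pos; lra).
      assert ((INR (S d) + INR (S m)) / 2 <= INR (S d) * INR (S m)) by nra.
      nra. }
    assert (PE := exp_pos (- (INR (S d) * INR (S m) * y))).
    assert (PD : 0 <= INR (S d) ^ k) by (apply pow_le, pos_INR).
    assert (C1 := H1 (S d)). assert (C2 := H2 (S m)).
    assert (D1 := Cmod_ge_0 (chi1 (S d))). assert (D2 := Cmod_ge_0 (chi2 (S m))).
    apply Rle_trans with (INR (S d) ^ k * exp (- (INR (S d) * INR (S m) * y))).
    + apply Rmult_le_compat_r; [lra|].
      rewrite Rmult_assoc. rewrite <- (Rmult_1_r (INR (S d) ^ k)) at 2. apply Rmult_le_compat_l; auto. nra.
    + apply Rle_trans with (INR (S d) ^ k * (exp (- (INR (S d) * (y / 2))) * exp (- (INR (S m) * (y / 2))))).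
      * apply Rmult_le_compat_l; auto.
      * right. rewrite pow_O. ring.
  - intros d. apply Rmult_le_pos; [apply pow_le, pos_INR | left; apply exp_pos].
  - intros d. apply Rmult_le_pos; [apply pow_le, pos_INR | left; apply exp_pos].
  - apply ex_series_pow_exp; lra.
  - apply ex_series_pow_exp; lra.
  - intros m. eapply Csum_ext; [|exact (Csum_scal (chi2 (S m)) _ _ (He m))].
    intros d. cbv beta. unfold lexp, b, c.
    replace (- (INR (S d) * RtoC (INR (S m) * y)))%C with (RtoC (- (INR (S d * S m) * y))).
    + rewrite Cexp_RtoC. ring.
    + rewrite mult_INR, RtoC_opp, !RtoC_mult. ring.
Qed.

(** Taking absolute values leaves the divisor function [sigma_k], whose Dirichlet series at
    [k + 1 + eta] is [zeta (1 + eta) zeta (k + 1 + eta)]; [u] and [v] are the terms of the two zeta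
    series. *)
Lemma sigma_series_abs k chi1 chi2 eta :
  0 < eta -> (forall n, Cmod (chi1 n) <= 1) -> (forall n, Cmod (chi2 n) <= 1) ->
  ex_series (fun n => Cmod (sigma_char (RtoC (INR k)) chi1 chi2 (S n)) * Rpower (INR (S n)) (- (INR k + 1 + eta))).
Proof.
  intros Hn H1 H2.
  set (m := INR k + 1 + eta). assert (Pk := pos_INR k).
  set (u := fun d => Rpower (INR (S d)) (- (1 + eta))).
  set (v := fun d => Rpower (INR (S d)) (- (1 + (INR k + eta)))).
  assert (Hu : ex_series u) by (apply ex_series_Rpower; lra).
  assert (Hv : ex_series v) by (apply ex_series_Rpower; lra).
  assert (Pu : forall d, 0 <= u d) by (intros; left; apply Rpower_pos).
  assert (Pv : forall d, 0 <= v d) by (intros; left; apply Rpower_pos).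
  destruct Hu as [U HU].
  set (b := fun d m => RtoC (u d * v m)).
  assert (He : forall i, Csum (fun d => b d i) (RtoC (v i) * RtoC U)%C).
  { intros i. assert (X : Csum (fun d => RtoC (u d)) (RtoC U)).
    { eapply (Ccv_ext (fun n => RtoC (rsum u n))).
      - intros n. now rewrite csum_RtoC.
      - intros eps Heps. assert (T := rsum_cv _ _ HU). apply is_lim_seq_spec in T.
        destruct (T (mkposreal _ Heps)) as [N HN]. exists N. intros n Hnn.
        rewrite <- RtoC_minus, Cmod_R. now apply HN. }
    eapply Csum_ext; [|exact (Csum_scal (RtoC (v i)) _ _ X)].
    intros d; unfold b; cbv beta. rewrite RtoC_mult. ring. }
  destruct (Csum_ex (fun i => RtoC (v i) * RtoC U)%C (fun i => Rabs U * v i)) as [s Hs].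
  { intros i. rewrite Cmod_mult, !Cmod_R, (Rabs_pos_eq (v i)) by auto. right; ring. }
  { now apply ex_series_scal_R. }
  assert (D : Csum (fun n => csum (divs b n) (S n)) s).
  { apply (Csum_divisors b u v (fun i => RtoC (v i) * RtoC U)%C s); auto; [|now exists U].
    intros d i. unfold b. rewrite Cmod_RtoC_pos; [lra | now apply Rmult_le_pos]. }
  set (x := fun n => rsum (fun d => if Nat.eqb (S n mod S d) 0 then u d * v (pred (S n / S d)) else 0) (S n)).
  assert (Hx : ex_series x).
  { apply (Csum_ex_series x s).
    - intros n. apply rsum_pos. intros d. destruct (Nat.eqb _ _); [now apply Rmult_le_pos | lra].
    - eapply Csum_ext; [|exact D]. intros n. unfold x.
      rewrite <- csum_RtoC. apply csum_ext. intros d _. unfold divs, b.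
      destruct (Nat.eqb _ _); auto. }
  apply (ex_series_le_R _ x); auto. intros n.
  split; [apply Rmult_le_pos; [apply Cmod_ge_0 | left; apply Rpower_pos]|].
  rewrite sigma_char_divs.
  replace (Cmod (csum (divs (fun d m => RtoC (INR (S d) ^ k) * chi1 (S d) * chi2 (S m))%C n) (S n)) * Rpower (INR (S n)) (- m))
    with (Cmod (csum (divs (fun d i => RtoC (INR (S d) ^ k) * chi1 (S d) * chi2 (S i) * RtoC (Rpower (INR (S d * S i)) (- m)))%C n) (S n))).
  2: { rewrite (divs_scal (fun d m => RtoC (INR (S d) ^ k) * chi1 (S d) * chi2 (S m))%C (fun n => RtoC (Rpower (INR n) (- m)))).
       rewrite Cmod_mult, Cmod_RtoC_pos; auto. left; apply Rpower_pos. }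
  eapply Rle_trans; [apply Cmod_csum|]. apply rsum_le. intros d Hd. unfold divs.
  destruct (Nat.eqb _ _); [|rewrite Cmod_0; lra].
  set (i := pred (S n / S d)).
  rewrite !Cmod_mult, !Cmod_RtoC_pos by first [apply pow_le, pos_INR | left; apply Rpower_pos].
  assert (Q : 0 < INR (S d)) by apply INR_S_pos. assert (Q' : 0 < INR (S i)) by apply INR_S_pos.
  rewrite mult_INR, <- Rpower_mult_distr by auto.
  assert (E1 : INR (S d) ^ k * Rpower (INR (S d)) (- m) = u d).
  { unfold u, m. rewrite <- Rpower_pow, <- Rpower_plus by auto. f_equal; ring. }
  assert (E2 : Rpower (INR (S i)) (- m) = v i).
  { unfold v, m. f_equal; ring. }
  rewrite E2.
  replace (INR (S d) ^ k * Cmod (chi1 (S d)) * Cmod (chi2 (S i)) * (Rpower (INR (S d)) (- m) * v i))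
    with (Cmod (chi1 (S d)) * Cmod (chi2 (S i)) * (u d * v i)) by (rewrite <- E1; ring).
  assert (C1 := H1 (S d)). assert (C2 := H2 (S i)).
  assert (D1 := Cmod_ge_0 (chi1 (S d))). assert (D2 := Cmod_ge_0 (chi2 (S i))).
  assert (0 <= u d * v i) by (apply Rmult_le_pos; auto).
  rewrite <- (Rmult_1_l (u d * v i)) at 2. apply Rmult_le_compat_r; auto. nra.
Qed.

(** * Integrals over the real line *)

(** Componentwise continuity matches the componentwise integral, so real Riemann integration
    suffices. *)
Definition contC (f : R -> C) : Prop :=
  (forall t, continuous (fun t => fst (f t)) t) /\ (forall t, continuous (fun t => snd (f t)) t).

Definition cint (f : R -> C) (a b : R) : C :=
  (RInt (fun t => fst (f t)) a b, RInt (fun t => snd (f t)) a b).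

(** The integral over the whole line, with the two ends moving independently, as those of the Gamma
    integral do. *)
Definition FI (f : R -> C) (l : C) : Prop :=
  forall eps : R, 0 < eps -> exists T : R, forall a b, a < - T -> T < b -> Cmod (cint f a b - l)%C < eps.

Lemma ex_RInt_cont (g : R -> R) a b : (forall t, continuous g t) -> ex_RInt g a b.
Proof. intros H. apply (ex_RInt_continuous (V := R_CompleteNormedModule)). auto. Qed.

Lemma cint_correct f a b : contC f -> @is_RInt C_R_NormedModule f a b (cint f a b).
Proof.
  intros [H1 H2].
  apply (is_RInt_fct_extend_pair (U := R_NormedModule) (V := R_NormedModule) f a b).
  - apply (RInt_correct (V := R_CompleteNormedModule)), ex_RInt_cont, H1.
  - apply (RInt_correct (V := R_CompleteNormedModule)), ex_RInt_cont, H2.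
Qed.

Lemma cint_ext f g a b : (forall t, f t = g t) -> cint f a b = cint g a b.
Proof. intros H. unfold cint. f_equal; apply RInt_ext; intros t _; now rewrite H. Qed.

Lemma contC_ext f g : (forall t, f t = g t) -> contC f -> contC g.
Proof.
  intros E [H1 H2]; split; intros t.
  - apply (continuous_ext (fun t => fst (f t))); [intros; now rewrite E | apply H1].
  - apply (continuous_ext (fun t => snd (f t))); [intros; now rewrite E | apply H2].
Qed.

Lemma contC_plus f g : contC f -> contC g -> contC (fun t => f t + g t)%C.
Proof.
  intros [H1 H2] [H3 H4]; split; intros t; simpl.
  - apply (continuous_plus (V := R_NormedModule) (fun t => fst (f t)) (fun t => fst (g t))); auto.
  - apply (continuous_plus (V := R_NormedModule) (fun t => snd (f t)) (fun t => snd (g t))); auto.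
Qed.

Lemma contC_scal c f : contC f -> contC (fun t => c * f t)%C.
Proof.
  intros [H1 H2]; split; intros t; simpl.
  - apply (continuous_minus (V := R_NormedModule) (fun t => fst c * fst (f t)) (fun t => snd c * snd (f t))).
    + apply (continuous_scal_r (V := R_NormedModule) (fst c)); auto.
    + apply (continuous_scal_r (V := R_NormedModule) (snd c)); auto.
  - apply (continuous_plus (V := R_NormedModule) (fun t => fst c * snd (f t)) (fun t => snd c * fst (f t))).
    + apply (continuous_scal_r (V := R_NormedModule) (fst c)); auto.
    + apply (continuous_scal_r (V := R_NormedModule) (snd c)); auto.
Qed.

Lemma contC_minus f g : contC f -> contC g -> contC (fun t => f t - g t)%C.
Proof.
  intros H1 H2. apply (contC_ext (fun t => f t + (-1) * g t)%C); [intros; ring|].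
  apply contC_plus; auto. now apply contC_scal.
Qed.

Lemma contC_zero : contC (fun _ => RtoC 0).
Proof. split; intros t; apply continuous_const. Qed.

Lemma contC_csum (f : nat -> R -> C) n : (forall i, contC (f i)) -> contC (fun t => csum (fun i => f i t) n).
Proof.
  intros H; induction n as [|n IH]; simpl; [apply contC_zero|].
  apply (contC_plus (fun t => csum (fun i => f i t) n)); auto.
Qed.

Lemma contC_affine f s c : contC f -> contC (fun t => f (s * t + c)).
Proof.
  intros [H1 H2].
  assert (L : forall t, continuous (fun t => s * t + c) t).
  { intros t. apply (ex_derive_continuous (V := R_NormedModule)). auto_derive; auto. }
  split; intros t.
  - apply (continuous_comp (fun t => s * t + c) (fun t => fst (f t))); auto.
  - apply (continuous_comp (fun t => s * t + c) (fun t => snd (f t))); auto.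
Qed.

Lemma cint_plus f g a b : contC f -> contC g -> cint (fun t => f t + g t)%C a b = (cint f a b + cint g a b)%C.
Proof.
  intros [H1 H2] [H3 H4]. unfold cint, Cplus; simpl. f_equal.
  - apply (RInt_plus (V := R_CompleteNormedModule) (fun t => fst (f t)) (fun t => fst (g t))); now apply ex_RInt_cont.
  - apply (RInt_plus (V := R_CompleteNormedModule) (fun t => snd (f t)) (fun t => snd (g t))); now apply ex_RInt_cont.
Qed.

Lemma cint_scal c f a b : contC f -> cint (fun t => c * f t)%C a b = (c * cint f a b)%C.
Proof.
  intros [H1 H2].
  assert (S : forall k (g : R -> R), (forall t, continuous g t) -> RInt (fun t => k * g t) a b = k * RInt g a b).
  { intros k g Hg. apply (RInt_scal (V := R_CompleteNormedModule)). now apply ex_RInt_cont. }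
  assert (CS : forall k (g : R -> R), (forall t, continuous g t) -> forall t, continuous (fun t => k * g t) t).
  { intros k g Hg t. apply (continuous_scal_r (V := R_NormedModule) k); auto. }
  unfold cint, Cmult; simpl. f_equal.
  - rewrite <- !S by auto.
    apply (RInt_minus (V := R_CompleteNormedModule) (fun t => fst c * fst (f t)) (fun t => snd c * snd (f t)));
      apply ex_RInt_cont; auto.
  - rewrite <- !S by auto.
    apply (RInt_plus (V := R_CompleteNormedModule) (fun t => fst c * snd (f t)) (fun t => snd c * fst (f t)));
      apply ex_RInt_cont; auto.
Qed.

Lemma cint_Chasles f a b c : contC f -> (cint f a b + cint f b c = cint f a c)%C.
Proof.
  intros [H1 H2]. unfold cint, Cplus; simpl. f_equal.
  - apply (RInt_Chasles (V := R_CompleteNormedModule) (fun t => fst (f t))); now apply ex_RInt_cont.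
  - apply (RInt_Chasles (V := R_CompleteNormedModule) (fun t => snd (f t))); now apply ex_RInt_cont.
Qed.

Lemma cint_point f a : cint f a a = RtoC 0.
Proof. unfold cint. now rewrite !RInt_point. Qed.

Lemma cint_shift f c a b : contC f -> cint (fun t => f (t + c)) a b = cint f (a + c) (b + c).
Proof.
  intros [H1 H2].
  assert (S : forall (g : R -> R), (forall t, continuous g t) ->
     RInt (fun t => g (t + c)) a b = RInt g (a + c) (b + c)).
  { intros g Hg.
    assert (E := RInt_comp_lin (V := R_CompleteNormedModule) g 1 c a b).
    rewrite !Rmult_1_l in E. rewrite <- E by now apply ex_RInt_cont.
    apply RInt_ext. intros t _. unfold scal; simpl; unfold mult; simpl. rewrite !Rmult_1_l. auto. }
  unfold cint. rewrite <- (S (fun t => fst (f t))), <- (S (fun t => snd (f t))); auto.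
Qed.

Lemma cint_opp f a b : contC f -> cint (fun t => f (- t)) a b = cint f (- b) (- a).
Proof.
  intros [H1 H2].
  assert (S : forall (g : R -> R), (forall t, continuous g t) ->
     RInt (fun t => g (- t)) a b = RInt g (- b) (- a)).
  { intros g Hg.
    assert (E := RInt_comp_lin (V := R_CompleteNormedModule) g (-1) 0 a b).
    replace (-1 * a + 0) with (- a) in E by ring. replace (-1 * b + 0) with (- b) in E by ring.
    rewrite <- (opp_RInt_swap (V := R_CompleteNormedModule) g (- a) (- b)) by now apply ex_RInt_cont.
    rewrite <- E by now apply ex_RInt_cont.
    rewrite <- (RInt_opp (V := R_CompleteNormedModule)).
    - apply RInt_ext. intros t _. unfold opp, scal; simpl; unfold mult; simpl.
      replace (-1 * t + 0) with (- t) by ring. ring.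
    - apply ex_RInt_cont. intros t. apply (continuous_scal_r (V := R_NormedModule) (-1)).
      apply (continuous_comp (fun t => -1 * t + 0) g); auto.
      apply (ex_derive_continuous (V := R_NormedModule)). auto_derive; auto. }
  unfold cint. rewrite <- (S (fun t => fst (f t))), <- (S (fun t => snd (f t))); auto.
Qed.

(** * Improper integrals over the line *)

Lemma FI_ext f g l : (forall t, f t = g t) -> FI f l -> FI g l.
Proof.
  intros E H eps He. destruct (H eps He) as [T HT]. exists T. intros a b Ha Hb.
  rewrite <- (cint_ext f g) by auto. auto.
Qed.

Lemma FI_unique f l l' : FI f l -> FI f l' -> l = l'.
Proof.
  intros H H'.
  apply (Ccv_unique (fun n => cint f (- INR n) (INR n))).
  - intros eps He. destruct (H eps He) as [T HT].
    destruct (INR_unbounded T) as [N HN]. exists N. intros n Hn. apply le_INR in Hn. apply HT; lra.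
  - intros eps He. destruct (H' eps He) as [T HT].
    destruct (INR_unbounded T) as [N HN]. exists N. intros n Hn. apply le_INR in Hn. apply HT; lra.
Qed.

Lemma FI_plus f g l m : contC f -> contC g -> FI f l -> FI g m -> FI (fun t => f t + g t)%C (l + m)%C.
Proof.
  intros Cf Cg H H' eps He.
  destruct (H (eps / 2) ltac:(lra)) as [T HT]; destruct (H' (eps / 2) ltac:(lra)) as [T' HT'].
  exists (Rmax T T'); intros a b Ha Hb.
  assert (L1 := Rmax_l T T'). assert (L2 := Rmax_r T T').
  specialize (HT a b ltac:(lra) ltac:(lra)); specialize (HT' a b ltac:(lra) ltac:(lra)).
  rewrite cint_plus by auto.
  replace (cint f a b + cint g a b - (l + m))%C with ((cint f a b - l) + (cint g a b - m))%C by ring.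
  eapply Rle_lt_trans; [apply Cmod_triangle|]; lra.
Qed.

Lemma FI_scal c f l : contC f -> FI f l -> FI (fun t => c * f t)%C (c * l)%C.
Proof.
  intros Cf H eps He.
  assert (P := Cmod_ge_0 c).
  destruct (H (eps / (Cmod c + 1))) as [T HT]; [apply Rdiv_lt_0_compat; lra|].
  exists T; intros a b Ha Hb; specialize (HT a b Ha Hb).
  rewrite cint_scal by auto.
  replace (c * cint f a b - c * l)%C with (c * (cint f a b - l))%C by ring.
  rewrite Cmod_mult.
  apply (Rmult_lt_compat_l (Cmod c + 1)) in HT; [|lra].
  replace ((Cmod c + 1) * (eps / (Cmod c + 1))) with eps in HT by (field; lra).
  assert (Q := Cmod_ge_0 (cint f a b - l)%C). nra.
Qed.

Lemma FI_csum (f : nat -> R -> C) (l : nat -> C) n :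
  (forall i, contC (f i)) -> (forall i, FI (f i) (l i)) -> FI (fun t => csum (fun i => f i t) n) (csum l n).
Proof.
  intros Cf H; induction n as [|n IH]; simpl.
  - intros eps He; exists 0; intros a b _ _.
    assert (E : cint (fun _ => RtoC 0) a b = RtoC 0).
    { unfold cint, RtoC; simpl. f_equal; rewrite RInt_const; unfold scal; simpl; unfold mult; simpl; ring. }
    rewrite E. unfold Cminus. now rewrite Cplus_opp_r, Cmod_0.
  - apply (FI_plus (fun t => csum (fun i => f i t) n)); auto. now apply contC_csum.
Qed.

Lemma FI_shift f l c : contC f -> FI f l -> FI (fun t => f (t + c)) l.
Proof.
  intros Cf H eps He. destruct (H eps He) as [T HT]. exists (T + Rabs c). intros a b Ha Hb.
  rewrite cint_shift by auto. assert (L1 := Rle_abs c). assert (L2 := Rle_abs (- c)). rewrite Rabs_Ropp in L2.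
  apply HT; lra.
Qed.

Lemma FI_opp f l : contC f -> FI f l -> FI (fun t => f (- t)) l.
Proof.
  intros Cf H eps He. destruct (H eps He) as [T HT]. exists T. intros a b Ha Hb.
  rewrite cint_opp by auto. apply HT; lra.
Qed.

Lemma cint_bound f (A A' : R -> R) a b : contC f ->
  (forall t, is_derive A t (A' t)) -> (forall t, continuous A' t) ->
  (forall t, Cmod (f t) <= A' t) -> a <= b -> Cmod (cint f a b) <= A b - A a.
Proof.
  intros Cf HA HA' Hf Hab.
  rewrite Cmod_norm.
  apply (norm_RInt_le (V := C_R_NormedModule) f A' a b (cint f a b) (A b - A a)); auto.
  - intros t _. generalize (Hf t). rewrite Cmod_norm. exact (fun h => h).
  - now apply cint_correct.
  - apply (is_RInt_derive (V := R_CompleteNormedModule) A A'); auto.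
Qed.

(** The integrable majorant is given by a bounded primitive [A], so that its integrals are
    increments of [A]. *)
Lemma FI_dominated f (A A' : R -> R) M : contC f ->
  (forall t, is_derive A t (A' t)) -> (forall t, continuous A' t) ->
  (forall t, Cmod (f t) <= A' t) -> (forall t, 0 <= A t <= M) ->
  exists l, FI f l.
Proof.
  intros Cf HA HA' Hf HM.
  assert (B := fun a b => cint_bound f A A' a b Cf HA HA' Hf).
  assert (Mon : forall a b, a <= b -> A a <= A b).
  { intros a b Hab. generalize (B a b Hab) (Cmod_ge_0 (cint f a b)). lra. }
  (* The integral over [[-n, n]] is a partial sum over the shells between consecutive integers;
     these are summable since [A] is bounded, and arbitrary endpoints are compared with integer ones
     afterwards. *)
  set (x := fun n : nat => (cint f (- INR (S n)) (- INR n) + cint f (INR n) (INR (S n)))%C).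
  set (d := fun n : nat => (A (INR (S n)) - A (INR n)) + (A (- INR n) - A (- INR (S n)))).
  assert (St : forall n : nat, INR n <= INR (S n)) by (intros n; rewrite S_INR; lra).
  assert (Hd : forall n, Cmod (x n) <= d n).
  { intros n. unfold x, d. eapply Rle_trans; [apply Cmod_triangle|].
    generalize (B (- INR (S n)) (- INR n)) (B (INR n) (INR (S n))) (St n).
    intros H1 H2 H3. specialize (H1 ltac:(lra)). specialize (H2 H3). lra. }
  assert (Pd : forall n, 0 <= d n).
  { intros n. eapply Rle_trans; [apply Cmod_ge_0 | apply Hd]. }
  assert (Ed : forall n, rsum d n = A (INR n) - A (- INR n)).
  { induction n as [|n IH]; [simpl; rewrite Ropp_0; ring|]. cbn [rsum]. rewrite IH. unfold d. ring. }
  assert (Ex : forall n, csum x n = cint f (- INR n) (INR n)).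
  { induction n as [|n IH]; [simpl; rewrite Ropp_0, cint_point; auto|].
    cbn [csum]. rewrite IH. unfold x.
    rewrite <- (cint_Chasles f (- INR (S n)) (- INR n) (INR (S n))) by auto.
    rewrite <- (cint_Chasles f (- INR n) (INR n) (INR (S n))) by auto. ring. }
  destruct (ex_series_bounded d M Pd) as [D HD].
  { intros n. rewrite Ed. generalize (HM (INR n)) (HM (- INR n)). lra. }
  destruct (Csum_ex x d Hd (ex_intro _ D HD)) as [l Hl].
  exists l. intros eps He.
  assert (T := rsum_cv _ _ HD). apply is_lim_seq_spec in T.
  assert (He2 : 0 < eps / 2) by lra.
  destruct (T (mkposreal _ He2)) as [N HN]. specialize (HN N (Nat.le_refl N)). simpl in HN.
  apply Rabs_def2 in HN.
  assert (Tl := Csum_tail _ _ _ _ N Hd Hl HD). rewrite Ex in Tl. rewrite Ed in HN, Tl.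
  exists (INR N). intros a b Ha Hb. assert (PN := pos_INR N).
  destruct (INR_unbounded (Rmax (- a) b)) as [n Hn].
  assert (L1 := Rmax_l (- a) b). assert (L2 := Rmax_r (- a) b).
  assert (LD := rsum_le_series d D n Pd HD). rewrite Ed in LD.
  assert (M1 := Mon b (INR n) ltac:(lra)). assert (M2 := Mon (- INR n) a ltac:(lra)).
  assert (B1 := B a (- INR N) ltac:(lra)). assert (B2 := B (INR N) b ltac:(lra)).
  rewrite <- (cint_Chasles f a (- INR N) b), <- (cint_Chasles f (- INR N) (INR N) b) by auto.
  replace (cint f a (- INR N) + (cint f (- INR N) (INR N) + cint f (INR N) b) - l)%C
    with ((cint f a (- INR N) + cint f (INR N) b) + - (l - cint f (- INR N) (INR N)))%C by ring.
  eapply Rle_lt_trans; [apply Cmod_triangle|].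
  eapply Rle_lt_trans; [apply Rplus_le_compat_r, Cmod_triangle|].
  rewrite Cmod_opp. lra.
Qed.

Lemma FI_bound f l (A A' : R -> R) M : contC f ->
  (forall t, is_derive A t (A' t)) -> (forall t, continuous A' t) ->
  (forall t, Cmod (f t) <= A' t) -> (forall t, 0 <= A t <= M) -> FI f l -> Cmod l <= M.
Proof.
  intros Cf HA HA' Hf HM H. apply Rnot_lt_le. intros L.
  destruct (H (Cmod l - M) ltac:(lra)) as [T HT].
  set (b := Rabs T + 1). assert (L1 := Rle_abs T). assert (L2 := Rle_abs (- T)). rewrite Rabs_Ropp in L2.
  specialize (HT (- b) b ltac:(unfold b; lra) ltac:(unfold b; lra)).
  assert (B := cint_bound f A A' (- b) b Cf HA HA' Hf ltac:(unfold b; generalize (Rabs_pos T); lra)).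
  assert (X := Cmod_triangle (cint f (- b) b) (- (cint f (- b) b - l))%C). rewrite Cmod_opp in X.
  replace (cint f (- b) b + - (cint f (- b) b - l))%C with l in X by ring.
  generalize (HM b) (HM (- b)). lra.
Qed.

(* Majorant: the derivative of the logistic function [e^(al t) / (1 + e^(al t))] is at least
   [al e^(-al |t|) / 4]. *)
Lemma logistic_majorant K al : 0 <= K -> 0 < al -> exists A A' : R -> R,
  (forall t, is_derive A t (A' t)) /\ (forall t, continuous A' t) /\
  (forall t, K * exp (- (al * Rabs t)) <= A' t) /\ (forall t, 0 <= A t <= 4 * K / al).
Proof.
  intros HK Ha.
  exists (fun t => 4 * K / al * (exp (al * t) / (1 + exp (al * t)))).
  exists (fun t => 4 * K * (exp (al * t) / (1 + exp (al * t)) ^ 2)).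
  assert (P : forall t, 0 < exp t) by apply exp_pos.
  assert (PK : 0 <= 4 * K / al) by (apply Rmult_le_pos; [lra | left; now apply Rinv_0_lt_compat]).
  split; [|split; [|split; [|intros t; split]]].
  - intros t. specialize (P (al * t)). auto_derive; [lra|]. field. lra.
  - intros t. apply (ex_derive_continuous (V := R_NormedModule)). specialize (P (al * t)).
    auto_derive. apply Rgt_not_eq. nra.
  - intros t. rewrite Rmult_assoc, (Rmult_comm 4), Rmult_assoc. apply Rmult_le_compat_l; auto.
    set (E := exp (al * t)). assert (PE : 0 < E) by apply P.
    apply Rmult_le_reg_r with ((1 + E) ^ 2); [apply pow_lt; lra|].
    replace (E / (1 + E) ^ 2 * 4 * (1 + E) ^ 2) with (4 * E) by (field; lra).
    destruct (Rle_dec 0 t) as [Ht|Ht].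
    + rewrite Rabs_pos_eq by auto.
      assert (X : exp (- (al * t)) * E = 1) by (unfold E; rewrite <- exp_plus, Rplus_opp_l; apply exp_0).
      assert (E1 : 1 <= E) by (unfold E; rewrite <- exp_0; apply exp_le; nra).
      assert (Pm := P (- (al * t))). set (m := exp (- (al * t))) in *.
      assert (m <= 1) by nra. simpl. nra.
    + rewrite Rabs_left by lra. replace (- (al * - t)) with (al * t) by ring. fold E.
      assert (E1 : E <= 1) by (unfold E; rewrite <- exp_0; apply exp_le; nra).
      assert ((1 + E) ^ 2 <= 4) by (simpl; nra). nra.
  - apply Rmult_le_pos; auto. specialize (P (al * t)). left. apply Rdiv_lt_0_compat; lra.
  - rewrite <- (Rmult_1_r (4 * K / al)) at 2. apply Rmult_le_compat_l; auto.
    specialize (P (al * t)). apply Rmult_le_reg_r with (1 + exp (al * t)); [lra|].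
    unfold Rdiv. rewrite Rmult_assoc, Rinv_l; lra.
Qed.

Lemma FI_exp_ex f K al : contC f -> 0 < al ->
  (forall t, Cmod (f t) <= K * exp (- (al * Rabs t))) -> exists l, FI f l.
Proof.
  intros Cf Ha Hf.
  assert (HK : 0 <= K).
  { specialize (Hf 0). rewrite Rabs_R0, Rmult_0_r, Ropp_0, exp_0 in Hf. generalize (Cmod_ge_0 (f 0)). lra. }
  destruct (logistic_majorant K al HK Ha) as (A & A' & H1 & H2 & H3 & H4).
  apply (FI_dominated f A A' (4 * K / al)); auto.
  intros t. eapply Rle_trans; [apply Hf | apply H3].
Qed.

Lemma FI_exp_bound f K al l : contC f -> 0 < al ->
  (forall t, Cmod (f t) <= K * exp (- (al * Rabs t))) -> FI f l -> Cmod l <= 4 * K / al.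
Proof.
  intros Cf Ha Hf.
  assert (HK : 0 <= K).
  { specialize (Hf 0). rewrite Rabs_R0, Rmult_0_r, Ropp_0, exp_0 in Hf. generalize (Cmod_ge_0 (f 0)). lra. }
  destruct (logistic_majorant K al HK Ha) as (A & A' & H1 & H2 & H3 & H4).
  apply (FI_bound f l A A' (4 * K / al)); auto.
  intros t. eapply Rle_trans; [apply Hf | apply H3].
Qed.

(* Two series with the same pointwise sum and a common integrable majorant integrate termwise to the
   same value, since the difference of the partial sums is bounded by the two tails. *)
Lemma Csum_FI_eq (f g : nat -> R -> C) (I J : nat -> C) (S : R -> C) (c c' : nat -> R) al :
  0 < al -> (forall n, contC (f n)) -> (forall n, contC (g n)) ->
  (forall n t, Cmod (f n t) <= c n * exp (- (al * Rabs t))) ->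
  (forall n t, Cmod (g n t) <= c' n * exp (- (al * Rabs t))) ->
  ex_series c -> ex_series c' ->
  (forall t, Csum (fun n => f n t) (S t)) -> (forall t, Csum (fun n => g n t) (S t)) ->
  (forall n, FI (f n) (I n)) -> (forall n, FI (g n) (J n)) ->
  exists s, Csum I s /\ Csum J s.
Proof.
  intros Ha Cf Cg Hf Hg [D HD] [D' HD'] Sf Sg If Ig.
  assert (Bi : forall n, Cmod (I n) <= (4 / al) * c n).
  { intros n. eapply Rle_trans; [apply (FI_exp_bound (f n) (c n) al); auto|]. right; field; lra. }
  assert (Bj : forall n, Cmod (J n) <= (4 / al) * c' n).
  { intros n. eapply Rle_trans; [apply (FI_exp_bound (g n) (c' n) al); auto|]. right; field; lra. }
  destruct (Csum_ex I _ Bi) as [s Hs]; [apply ex_series_scal_R; now exists D|].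
  destruct (Csum_ex J _ Bj) as [s' Hs']; [apply ex_series_scal_R; now exists D'|].
  exists s; split; auto. replace s with s'; auto.
  apply (Ccv_unique (csum J)); auto.
  assert (Z : Ccv (fun N => csum J N - csum I N)%C 0%C).
  (* [4 / al] is the bound of the logistic majorant for the integral of [e^(-al |t|)]. *)
  { apply (Ccv_squeeze _ (fun N => (4 / al) * ((D - rsum c N) + (D' - rsum c' N)))).
    - intros N.
      replace (4 / al * (D - rsum c N + (D' - rsum c' N)))
        with (4 * (D - rsum c N + (D' - rsum c' N)) / al) by (field; lra).
      apply (FI_exp_bound (fun t => csum (fun n => g n t) N - csum (fun n => f n t) N)%C); auto.
      + apply contC_minus; now apply contC_csum.
      + intros t. set (E := exp (- (al * Rabs t))).
        assert (HDE : is_series (fun n => c n * E) (D * E)) by apply (is_series_scal_r E c D HD).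
        assert (HDE' : is_series (fun n => c' n * E) (D' * E)) by apply (is_series_scal_r E c' D' HD').
        assert (T1 := Csum_tail _ _ _ _ N (fun n => Hf n t) (Sf t) HDE).
        assert (T2 := Csum_tail _ _ _ _ N (fun n => Hg n t) (Sg t) HDE').
        assert (RS : forall x, rsum (fun n => x n * E) N = rsum x N * E).
        { intros x. rewrite Rmult_comm, <- rsum_scal. apply rsum_ext; intros; ring. }
        rewrite RS in T1, T2.
        replace (csum (fun n => g n t) N - csum (fun n => f n t) N)%C
          with ((S t - csum (fun n => f n t) N) + - (S t - csum (fun n => g n t) N))%C by ring.
        eapply Rle_trans; [apply Cmod_triangle|]. rewrite Cmod_opp. lra.
      + apply (FI_ext (fun t => csum (fun n => g n t) N + (-1) * csum (fun n => f n t) N)%C); [intros; ring|].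
        replace (csum J N - csum I N)%C with (csum J N + (-1) * csum I N)%C by ring.
        apply FI_plus; [now apply contC_csum | apply contC_scal; now apply contC_csum | now apply FI_csum |].
        apply FI_scal; [now apply contC_csum | now apply FI_csum].
    - assert (L1 := rsum_cv _ _ HD). assert (L2 := rsum_cv _ _ HD').
      replace (Finite 0) with (Rbar_mult (4 / al) (Finite ((D - D) + (D' - D'))))
        by (simpl; f_equal; ring).
      apply is_lim_seq_scal_l.
      apply (is_lim_seq_plus' (fun N => D - rsum c N) (fun N => D' - rsum c' N)).
      + apply (is_lim_seq_minus' (fun _ => D)); auto. apply is_lim_seq_const.
      + apply (is_lim_seq_minus' (fun _ => D')); auto. apply is_lim_seq_const. }
  apply (Ccv_ext (fun N => csum I N + (csum J N - csum I N))%C); [intros; ring|].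
  replace s with (s + 0)%C by ring. now apply Ccv_plus.
Qed.

(** * The Gamma and Bessel integrals in the variable [y = e^t] *)

(** The integrand [e^(-A y - B / y) y^s dy / y] in the variable [y = e^t]. It specialises to Gamma
    integrands for [A = 0] or [B = 0] and to Bessel integrands otherwise. *)
Definition Phi (A B : R) (s : C) (t : R) : C :=
  (RtoC (exp (- (A * exp t) - B * exp (- t))) * Cexp (s * RtoC t))%C.

Lemma contC_Phi A B s : contC (Phi A B s).
Proof.
  apply (contC_ext (fun t =>
    (exp (- (A * exp t) - B * exp (- t)) * (exp (fst s * t) * cos (snd s * t)),
     exp (- (A * exp t) - B * exp (- t)) * (exp (fst s * t) * sin (snd s * t))))).
  - intros t. destruct s as [s1 s2]. unfold Phi, Cexp, Cmult, RtoC; simpl.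
    replace (s1 * t - s2 * 0) with (s1 * t) by ring.
    replace (s1 * 0 + s2 * t) with (s2 * t) by ring. f_equal; ring.
  - split; intros t; simpl; apply (ex_derive_continuous (V := R_NormedModule)); auto_derive; auto.
Qed.

Lemma Cmod_Phi A B s t : Cmod (Phi A B s t) = exp (- (A * exp t)) * (exp (- (B * exp (- t))) * exp (Re s * t)).
Proof.
  unfold Phi. rewrite Cmod_mult, Cmod_Cexp, Cmod_RtoC_pos by (left; apply exp_pos).
  rewrite <- !exp_plus. f_equal. destruct s; simpl; ring.
Qed.

Lemma exp_weight_power B m t : 0 < B -> 0 < m ->
  exp (- (B * exp (- t))) <= Rpower m m * Rpower B (- m) * exp (m * t).
Proof.
  intros HB Hm. assert (P := exp_pos (- t)).
  eapply Rle_trans; [apply (Rpower_exp_bound m); auto; now apply Rmult_lt_0_compat|].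
  rewrite <- Rpower_mult_distr by auto. right.
  replace (Rpower (exp (- t)) (- m)) with (exp (m * t)) by (unfold Rpower; rewrite ln_exp; f_equal; ring).
  ring.
Qed.

(** The weight is traded for the power [rho - al] when [t >= 0] and [rho + al] when [t < 0]; in both
    cases [e^(-al |t|)] is left. *)
Lemma exp_weight_bound B rho al : 0 < B -> 0 < al < rho ->
  exists K, 0 <= K /\ forall t, exp (- (B * exp (- t))) * exp (- rho * t) <= K * exp (- (al * Rabs t)).
Proof.
  intros HB Ha.
  set (K1 := Rpower (rho - al) (rho - al) * Rpower B (- (rho - al))).
  set (K2 := Rpower (rho + al) (rho + al) * Rpower B (- (rho + al))).
  assert (P1 : 0 < K1) by (apply Rmult_lt_0_compat; apply Rpower_pos).
  assert (P2 : 0 < K2) by (apply Rmult_lt_0_compat; apply Rpower_pos).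
  exists (K1 + K2). split; [lra|]. intros t.
  assert (PE := exp_pos (- rho * t)). assert (PA := exp_pos (- (al * Rabs t))).
  destruct (Rle_dec 0 t) as [Ht|Ht].
  - apply Rle_trans with (K1 * exp ((rho - al) * t) * exp (- rho * t)).
    + apply Rmult_le_compat_r; [lra|]. apply exp_weight_power; lra.
    + rewrite Rmult_assoc, <- exp_plus, Rabs_pos_eq in * by auto.
      replace ((rho - al) * t + - rho * t) with (- (al * t)) by ring. nra.
  - apply Rle_trans with (K2 * exp ((rho + al) * t) * exp (- rho * t)).
    + apply Rmult_le_compat_r; [lra|]. apply exp_weight_power; lra.
    + rewrite Rmult_assoc, <- exp_plus, (Rabs_left t) in * by lra.
      replace ((rho + al) * t + - rho * t) with (- (al * - t)) by ring. nra.
Qed.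

Lemma Phi_bound A B s : 0 <= A -> 0 < B -> 0 < Re s ->
  exists K, forall t, Cmod (Phi A B (- s) t) <= K * exp (- (Re s / 2 * Rabs t)).
Proof.
  intros HA HB Hs. destruct (exp_weight_bound B (Re s) (Re s / 2) HB ltac:(lra)) as [K [HK H]].
  exists K. intros t. rewrite Cmod_Phi.
  replace (Re (- s)%C) with (- Re s) by (destruct s; reflexivity).
  assert (E : exp (- (A * exp t)) <= 1).
  { rewrite <- exp_0. apply exp_le. generalize (exp_pos t). nra. }
  specialize (H t). assert (P := exp_pos (- (A * exp t))).
  assert (P' : 0 < exp (- (B * exp (- t))) * exp (- Re s * t)) by (apply Rmult_lt_0_compat; apply exp_pos).
  nra.
Qed.

Lemma Phi_ex A B s : 0 <= A -> 0 < B -> 0 < Re s -> exists l, FI (Phi A B (- s)) l.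
Proof.
  intros HA HB Hs. destruct (Phi_bound A B s HA HB Hs) as [K H].
  apply (FI_exp_ex _ K (Re s / 2)); auto; [apply contC_Phi | lra].
Qed.

Lemma ball_of_Cmod (l z : C) (eps : posreal) : Cmod (z - l)%C < eps -> ball l eps z.
Proof. intros H. now apply C_NormedModule_mixin_compat1. Qed.

Lemma RInt_ln_subst (f : R -> C) a b : contC f -> 0 < a -> 0 < b ->
  @is_RInt C_R_NormedModule (fun y => RtoC (/ y) * f (ln y))%C a b (cint f (ln a) (ln b)).
Proof.
  intros Cf Ha Hb.
  assert (Pos : forall y, Rmin a b <= y <= Rmax a b -> 0 < y).
  { intros y Hy. assert (0 < Rmin a b) by now apply Rmin_pos. lra. }
  assert (K : forall (g : R -> R), (forall t, continuous g t) ->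
     is_RInt (fun y => / y * g (ln y)) a b (RInt g (ln a) (ln b))).
  { intros g Hg.
    apply (is_RInt_comp (V := R_CompleteNormedModule) g ln (fun y => / y) a b).
    - intros y Hy. apply Hg.
    - intros y Hy. apply Pos in Hy. split.
      + apply is_derive_Reals, derivable_pt_lim_ln. auto.
      + apply (ex_derive_continuous (V := R_NormedModule)). auto_derive. lra. }
  apply (is_RInt_fct_extend_pair (U := R_NormedModule) (V := R_NormedModule)).
  - apply (is_RInt_ext (fun y => / y * fst (f (ln y)))); [|apply K, Cf].
    intros y _. simpl. ring.
  - apply (is_RInt_ext (fun y => / y * snd (f (ln y)))); [|apply K, Cf].
    intros y _. simpl. ring.
Qed.

(** The substitution [t = ln y] sends the ends 0 and infinity to the two ends of the line, and its
    factor [1 / y] lowers the exponent [s] to [s - 1]. *)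
Lemma Gamma_integral s l : FI (Phi 1 0 s) l -> CGamma s = l.
Proof.
  intros H. unfold CGamma.
  apply (@is_RInt_gen_unique C_R_CompleteNormedModule (at_right 0) (Rbar_locally p_infty)).
  { apply Proper_StrongProper, at_right_proper_filter. }
  { apply Proper_StrongProper, Rbar_locally_filter. }
  intros P [eps HP]. destruct (H eps (cond_pos eps)) as [T HT].
  apply (Filter_prod _ _ _ (fun a => 0 < a < exp (- T)) (fun b => exp T < b)).
  - exists (mkposreal _ (exp_pos (- T))). intros a Ha Ha0. split; auto.
    unfold ball in Ha; simpl in Ha. unfold AbsRing_ball, abs, minus, plus, opp in Ha; simpl in Ha.
    rewrite Rabs_pos_eq in Ha by lra. lra.
  - exists (exp T). auto.
  - intros a b [Ha0 Ha] Hb. simpl.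
    assert (Hb0 : 0 < b) by (generalize (exp_pos T); lra).
    exists (cint (Phi 1 0 s) (ln a) (ln b)). split.
    + apply (is_RInt_ext (V := C_R_NormedModule) (fun y => RtoC (/ y) * Phi 1 0 s (ln y))%C);
        [|apply RInt_ln_subst; auto; apply contC_Phi].
      intros y [Hy _].
      assert (Py : 0 < y) by (assert (0 < Rmin a b) by (now apply Rmin_pos); lra).
      unfold Phi, Rcpow. rewrite exp_Ropp, exp_ln by auto.
      replace (- (1 * y) - 0 * / y) with (- y) by ring.
      replace ((s - 1) * ln y)%C with (s * ln y + - RtoC (ln y))%C by ring.
      rewrite Cexp_plus, Cexp_opp, Cexp_RtoC, exp_ln by auto.
      rewrite RtoC_inv by lra. match goal with |- @eq _ ?u ?v => change (@eq C u v) end. ring.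
    + apply HP, ball_of_Cmod, HT.
      * rewrite <- (ln_exp (- T)). apply ln_increasing; auto.
      * rewrite <- (ln_exp T). apply ln_increasing; auto. apply exp_pos.
Qed.

(** The reflection [t -> -t] makes this a Gamma integral, and the translation by [ln A] rescales [y]
    and produces [A^(-s)]. *)
Lemma Phi_Gamma A s : 0 < A -> 0 < Re s -> FI (Phi 0 A (- s)) (CGamma s / Rcpow A s)%C.
Proof.
  intros HA Hs.
  destruct (Phi_ex 0 1 s ltac:(lra) ltac:(lra) Hs) as [l Hl].
  assert (G : FI (Phi 1 0 s) l).
  { eapply FI_ext; [|apply FI_opp; [|exact Hl]; apply contC_Phi].
    intros t. unfold Phi. rewrite Ropp_involutive, RtoC_opp.
    f_equal; [do 2 f_equal; ring | f_equal; ring]. }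
  rewrite (Gamma_integral s l G).
  assert (N : Rcpow A s <> 0%C) by apply Cexp_neq_0.
  replace (l / Rcpow A s)%C with (/ Rcpow A s * l)%C by (field; auto).
  assert (G1 := FI_shift _ _ (ln A) (contC_Phi 1 0 s) G).
  assert (C1 : contC (fun t => Phi 1 0 s (t + ln A))).
  { apply (contC_ext (fun t => Phi 1 0 s (1 * t + ln A))); [intros; f_equal; ring|].
    apply contC_affine, contC_Phi. }
  assert (G2 := FI_opp _ _ C1 G1).
  assert (C2 : contC (fun t => Phi 1 0 s (- t + ln A))).
  { apply (contC_ext (fun t => Phi 1 0 s ((-1) * t + ln A))); [intros; f_equal; ring|].
    apply contC_affine, contC_Phi. }
  eapply FI_ext; [|exact (FI_scal (/ Rcpow A s)%C _ _ C2 G2)].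
  intros t. cbv beta. unfold Phi, Rcpow.
  rewrite exp_plus, exp_ln by auto.
  rewrite <- Cexp_opp.
  replace (- (1 * (exp (- t) * A)) - 0 * exp (- (- t + ln A))) with (- (0 * exp t) - A * exp (- t)) by ring.
  rewrite (Cmult_comm (Cexp _)), <- Cmult_assoc, <- Cexp_plus. do 2 f_equal.
  rewrite RtoC_plus, RtoC_opp. ring.
Qed.

(** The exponent is [-z cosh t], which is even; folding the line onto the half-line replaces
    [e^(-nu t)] by twice the average of [e^(nu t)] and [e^(-nu t)]. *)
Lemma Phi_Bessel_sym nu z : 0 < Re nu -> 0 < z ->
  FI (Phi (z / 2) (z / 2) (- nu)) (2 * BesselK nu z)%C.
Proof.
  intros Hn Hz.
  destruct (Phi_ex (z / 2) (z / 2) nu ltac:(lra) ltac:(lra) Hn) as [L HL].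
  set (g := Phi (z / 2) (z / 2) (- nu)) in *.
  assert (Cg : contC g) by apply contC_Phi.
  assert (Cg' : contC (fun t => g (- t))).
  { apply (contC_ext (fun t => g (-1 * t + 0))); [intros; f_equal; ring|]. now apply contC_affine. }
  assert (Two : (RtoC 2) <> 0%C) by (apply RtoC_neq_0; lra).
  set (h := fun t => (RtoC (/ 2) * (g t + g (- t)%R))%C).
  assert (Ch : contC h) by (apply contC_scal, contC_plus; auto).
  assert (Eh : forall T, cint h 0 T = (RtoC (/ 2) * cint g (- T) T)%C).
  { intros T. unfold h. rewrite cint_scal by now apply contC_plus.
    rewrite cint_plus, cint_opp by auto. rewrite Ropp_0.
    rewrite <- (cint_Chasles g (- T) 0 T) by auto. ring. }
  assert (K : BesselK nu z = (RtoC (/ 2) * L)%C).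
  { unfold BesselK.
    apply (@is_RInt_gen_unique C_R_CompleteNormedModule (at_point 0) (Rbar_locally p_infty)).
    { apply Proper_StrongProper, at_point_filter. }
    { apply Proper_StrongProper, Rbar_locally_filter. }
    intros P [eps HP]. destruct (HL eps (cond_pos eps)) as [T HT].
    apply (Filter_prod _ _ _ (fun a => a = 0) (fun b => T < b)).
    - reflexivity.
    - exists T. auto.
    - intros a b -> Hb. simpl. exists (cint h 0 b). split.
      + apply (is_RInt_ext (V := C_R_NormedModule) h); [|now apply cint_correct].
        intros t _. unfold h, g, Phi. rewrite Ropp_involutive.
        replace (- (z / 2 * exp t) - z / 2 * exp (- t)) with (- z * cosh t) by (unfold cosh; field).
        replace (- (z / 2 * exp (- t)) - z / 2 * exp t) with (- z * cosh t) by (unfold cosh; field).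
        replace (- nu * RtoC (- t))%C with (nu * t)%C by (rewrite RtoC_opp; ring).
        replace (- nu * t)%C with (- (nu * t))%C by ring.
        rewrite RtoC_inv by lra. match goal with |- @eq _ ?u ?v => change (@eq C u v) end. field. auto.
      + apply HP, ball_of_Cmod. rewrite Eh.
        replace (RtoC (/ 2) * cint g (- b) b - RtoC (/ 2) * L)%C with (RtoC (/ 2) * (cint g (- b) b - L))%C by ring.
        rewrite Cmod_mult, Cmod_RtoC_pos by lra.
        specialize (HT (- b) b ltac:(lra) Hb). generalize (Cmod_ge_0 (cint g (- b) b - L)%C). lra. }
  rewrite K. replace (2 * (RtoC (/ 2) * L))%C with L; auto.
  rewrite RtoC_inv by lra. field; auto.
Qed.

Lemma Phi_Bessel nu A B : 0 < Re nu -> 0 < A -> 0 < B ->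
  FI (Phi A B (- nu)) (2 * Rcpow A (nu / 2) / Rcpow B (nu / 2) * BesselK nu (2 * sqrt (A * B)))%C.
Proof.
  intros Hn HA HB.
  destruct (Phi_ex A B nu ltac:(lra) HB Hn) as [l Hl].
  (* The translation that balances [A e^t] against [B e^(-t)]: both become [sqrt (A B)] times the
     exponential, and [e^(-nu c)] is [(A / B)^(nu/2)]. *)
  set (c := (ln B - ln A) / 2).
  assert (H1 := FI_shift _ _ c (contC_Phi A B (- nu)) Hl).
  set (r := sqrt (A * B)).
  assert (Pr : 0 < r) by (apply sqrt_lt_R0; now apply Rmult_lt_0_compat).
  assert (Er : r = exp ((ln A + ln B) / 2)).
  { unfold r. rewrite <- (sqrt_Rsqr (exp ((ln A + ln B) / 2))) by (left; apply exp_pos).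
    f_equal. unfold Rsqr. rewrite <- exp_plus.
    replace ((ln A + ln B) / 2 + (ln A + ln B) / 2) with (ln A + ln B) by field.
    rewrite exp_plus, !exp_ln; auto. }
  assert (H2 := Phi_Bessel_sym nu (2 * r) Hn ltac:(lra)).
  assert (H3 := FI_scal (Cexp (- nu * c)) _ _ (contC_Phi _ _ _) H2).
  assert (N : Rcpow B (nu / 2) <> 0%C) by apply Cexp_neq_0.
  assert (Two : (RtoC 2) <> 0%C) by (apply RtoC_neq_0; lra).
  replace (2 * Rcpow A (nu / 2) / Rcpow B (nu / 2) * BesselK nu (2 * r))%C with l; auto.
  transitivity (Cexp (- nu * c) * (2 * BesselK nu (2 * r)))%C.
  - apply (FI_unique _ _ _ H1). eapply FI_ext; [|exact H3].
    intros t. cbv beta. unfold Phi.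
    replace (2 * r / 2) with r by field.
    replace (- (A * exp (t + c)) - B * exp (- (t + c))) with (- (r * exp t) - r * exp (- t)).
    + rewrite (Cmult_comm (Cexp _)), <- Cmult_assoc, <- Cexp_plus. do 2 f_equal.
      rewrite RtoC_plus. ring.
    + assert (E1 : A * exp (t + c) = r * exp t).
      { rewrite Er. transitivity (exp (ln A) * exp (t + c)); [rewrite exp_ln; auto|].
        rewrite <- !exp_plus. f_equal. unfold c. field. }
      assert (E2 : B * exp (- (t + c)) = r * exp (- t)).
      { rewrite Er. transitivity (exp (ln B) * exp (- (t + c))); [rewrite exp_ln; auto|].
        rewrite <- !exp_plus. f_equal. unfold c. field. }
      rewrite E1, E2. reflexivity.
  - unfold Rcpow, Cdiv. rewrite <- Cexp_opp.
    replace (- nu * c)%C with (nu * / 2 * ln A + - (nu * / 2 * ln B))%C.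
    + rewrite Cexp_plus. ring.
    + unfold c, Rdiv. rewrite RtoC_mult, RtoC_minus, RtoC_inv by lra. field; auto.
Qed.

(** * The summation formula *)

Lemma modulus_one_char chi : is_dirichlet_char 1 chi -> forall n, chi n = 1%C.
Proof.
  intros H n. rewrite <- (char_1 1 chi H), <- (periodic_mod chi 1 n) by apply (char_period 1 chi H).
  rewrite <- (periodic_mod chi 1 1) by apply (char_period 1 chi H). now rewrite !Nat.mod_1_r.
Qed.

Lemma modulus_gt_1 q chi : is_dirichlet_char q chi -> ~ is_principal q chi -> (1 < q)%nat.
Proof.
  intros H N. assert (P := char_pos q chi H).
  destruct (Nat.eq_dec q 1) as [->|]; [|lia].
  exfalso. apply N. intros n _. now apply modulus_one_char.
Qed.

Lemma odd_modulus_gt_1 q chi : is_dirichlet_char q chi -> is_odd_char q chi -> (1 < q)%nat.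
Proof.
  intros H N. assert (P := char_pos q chi H).
  destruct (Nat.eq_dec q 1) as [->|]; [|lia].
  exfalso. unfold is_odd_char in N. rewrite (modulus_one_char chi H) in N.
  apply RtoC_inj in N. lra.
Qed.

Lemma Cmod_Rcpow x s : Cmod (Rcpow x s) = Rpower x (Re s).
Proof. unfold Rcpow, Rpower. rewrite Cmod_Cexp. f_equal. destruct s; simpl; ring. Qed.

Lemma Rcpow_mult x y s : 0 < x -> 0 < y -> Rcpow (x * y) s = (Rcpow x s * Rcpow y s)%C.
Proof.
  intros Hx Hy. unfold Rcpow. rewrite ln_mult, RtoC_plus by auto. rewrite <- Cexp_plus. f_equal. ring.
Qed.

Lemma lexp_double_ex k chi1 chi2 y :
  0 < y -> (forall n, Cmod (chi1 n) <= 1) -> (forall n, Cmod (chi2 n) <= 1) ->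
  exists (e : nat -> C) s,
    (forall m, Csum (fun d => chi1 (S d) * lexp k (RtoC (INR (S m) * y)) d)%C (e m)) /\
    Csum (fun m => chi2 (S m) * e m)%C s.
Proof.
  intros Hy H1 H2.
  destruct (ex_series_pow_exp k (y / 2) ltac:(lra)) as [D HD].
  set (w := fun m => exp (- (INR (S m) * (y / 2)))).
  assert (Bd : forall m d, Cmod (chi1 (S d) * lexp k (RtoC (INR (S m) * y)) d)%C
                <= w m * (INR (S d) ^ k * exp (- (INR (S d) * (y / 2))))).
  { intros m d. rewrite Cmod_mult, Cmod_lexp. simpl Re.
    assert (Q : 1 <= INR (S d)) by (rewrite S_INR; generalize (pos_INR d); lra).
    assert (Q' : 1 <= INR (S m)) by (rewrite S_INR; generalize (pos_INR m); lra).
    assert (L : exp (- (INR (S d) * (INR (S m) * y))) <= exp (- (INR (S d) * (y / 2))) * w m).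
    { unfold w. rewrite <- exp_plus. apply exp_le.
      assert (0 <= (INR (S d) - 1) * (INR (S m) - 1)) by (apply Rmult_le_pos; lra).
      assert ((INR (S d) + INR (S m)) / 2 <= INR (S d) * INR (S m)) by nra. nra. }
    assert (PD : 0 <= INR (S d) ^ k) by (apply pow_le, pos_INR).
    assert (PE := exp_pos (- (INR (S d) * (INR (S m) * y)))).
    apply Rle_trans with (1 * (INR (S d) ^ k * exp (- (INR (S d) * (INR (S m) * y))))).
    - apply Rmult_le_compat_r; auto. apply Rmult_le_pos; lra.
    - rewrite Rmult_1_l. replace (w m * (INR (S d) ^ k * exp (- (INR (S d) * (y / 2)))))
        with (INR (S d) ^ k * (exp (- (INR (S d) * (y / 2))) * w m)) by ring.
      now apply Rmult_le_compat_l. }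
  destruct (choose_fun (fun m em => Csum (fun d => chi1 (S d) * lexp k (RtoC (INR (S m) * y)) d)%C em))
    as [e He].
  { intros m. apply (Csum_ex _ _ (Bd m)). apply ex_series_scal_R. now exists D. }
  exists e.
  destruct (Csum_ex (fun m => chi2 (S m) * e m)%C (fun m => D * (INR (S m) ^ 0 * w m))) as [s Hs].
  - intros m. rewrite Cmod_mult, pow_O, Rmult_1_l.
    assert (T := Csum_bound _ _ _ (w m * D) (Bd m) (He m)
                   (is_series_scal (V := R_NormedModule) (w m) _ _ HD)).
    generalize (Cmod_ge_0 (e m)) (Cmod_ge_0 (chi2 (S m))) (H2 (S m)). nra.
  - apply ex_series_scal_R, ex_series_pow_exp; lra.
  - now exists s.
Qed.

(* Termwise integration of the modular relation against [e^(-B/y) y^(-nu-1) dy], with [y = e^t]. *)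
Lemma sigma_bessel_gamma k p q chi1 chi2 m0 B nu :
  is_primitive_char p chi1 -> is_primitive_char q chi2 -> (1 < p)%nat -> (1 < q)%nat ->
  chi1 (p - 1)%nat = chi2 (q - 1)%nat -> (chi2 (q - 1)%nat * chi2 (q - 1)%nat = 1)%C ->
  (k + 1 = 2 * m0)%nat -> 0 < B -> 0 < Re nu ->
  exists s,
    Csum (fun n => gauss_sum p (conj_char chi1) * sigma_char (RtoC (INR k)) chi1 chi2 (S n)
      * (2 * Rcpow (INR (S n)) (nu / 2) / Rcpow B (nu / 2) * BesselK nu (2 * sqrt (INR (S n) * B))))%C s /\
    Csum (fun n => RtoC (2 * PI / INR q) ^ (k + 1) * (chi2 (q - 1)%nat * (-1) ^ m0) * gauss_sum q chi2
      * sigma_char (RtoC (INR k)) (conj_char chi2) (conj_char chi1) (S n)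
      * (CGamma (nu + RtoC (INR k) + 1)
         / Rcpow (4 * PI ^ 2 / (INR p * INR q) * INR (S n) + B) (nu + RtoC (INR k) + 1)))%C s.
Proof.
  intros Hp1 Hp2 Hp Hq Hpar He Hk HB Hnu.
  assert (Hpi := PI_gt_3).
  assert (Q : 0 < INR q) by (apply lt_0_INR; lia). assert (P : 0 < INR p) by (apply lt_0_INR; lia).
  set (c0 := 4 * PI ^ 2 / (INR p * INR q)).
  assert (Pc0 : 0 < c0) by (apply Rdiv_lt_0_compat; [nra | now apply Rmult_lt_0_compat]).
  set (tau1 := gauss_sum p (conj_char chi1)). set (tau2 := gauss_sum q chi2).
  set (Cst := (RtoC (2 * PI / INR q) ^ (k + 1) * (chi2 (q - 1)%nat * (-1) ^ m0) * tau2)%C).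
  set (s := (nu + RtoC (INR k) + 1)%C).
  assert (Rs : Re s = Re nu + INR k + 1) by (unfold s; destruct nu; simpl; ring).
  assert (Pk := pos_INR k).
  set (sg := fun n => sigma_char (RtoC (INR k)) chi1 chi2 (S n)).
  set (sg' := fun n => sigma_char (RtoC (INR k)) (conj_char chi2) (conj_char chi1) (S n)).
  assert (D1 := proj1 Hp1). assert (D2 := proj1 Hp2).
  assert (D1' := conj_char_dirichlet p chi1 D1). assert (D2' := conj_char_dirichlet q chi2 D2).
  (* [m] is the exponent at which the divisor sums are summable. Trading [m] powers leaves the decay
     rates [Re nu + m] on the Bessel side and [Re nu - eta = Re nu / 2] on the Gamma side; [al] lies
     below both. *)
  set (eta := Re nu / 2). set (al := Re nu / 4). set (m := INR k + 1 + eta).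
  assert (Pm : 0 < m) by (unfold m, eta; lra). assert (Pal : 0 < al) by (unfold al; lra).
  destruct (exp_weight_bound B (Re nu + m) al HB) as [K1 [PK1 HK1]]; [unfold m, al, eta; lra|].
  destruct (exp_weight_bound B (Re nu - eta) al HB) as [K2 [PK2 HK2]]; [unfold al, eta; lra|].
  assert (X1 := sigma_series_abs k chi1 chi2 eta ltac:(unfold eta; lra)
                  (Cmod_char_le p chi1 D1) (Cmod_char_le q chi2 D2)).
  assert (X2 := sigma_series_abs k (conj_char chi2) (conj_char chi1) eta ltac:(unfold eta; lra)
                  (Cmod_char_le q _ D2') (Cmod_char_le p _ D1')).
  fold m in X1, X2.
  set (Em := Rpower m m). assert (PEm : 0 < Em) by apply Rpower_pos.
  assert (Hpt : forall t, exists z,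
      Csum (fun n => tau1 * sg n * Phi (INR (S n)) B (- nu) t)%C z /\
      Csum (fun n => Cst * sg' n * Phi 0 (c0 * INR (S n) + B) (- s) t)%C z).
  { intros t. set (y := exp t). assert (Py : 0 < y) by apply exp_pos.
    (* The dual point is [c0 e^(-t)], so [e^(-n y')] merges with [e^(-B / y)] into a Gamma
       integrand. *)
    set (y' := 4 * PI ^ 2 / (INR p * INR q * y)).
    assert (Ey' : y' = c0 * exp (- t)).
    { unfold y', c0. rewrite exp_Ropp. fold y. field. repeat split; lra. }
    assert (Py' : 0 < y') by (rewrite Ey'; apply Rmult_lt_0_compat; auto; apply exp_pos).
    destruct (lexp_double_ex k chi1 chi2 y Py (Cmod_char_le p chi1 D1) (Cmod_char_le q chi2 D2))
      as (e & s1 & He1 & Hs1).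
    destruct (lexp_double_ex k (conj_char chi2) (conj_char chi1) y' Py'
                (Cmod_char_le q _ D2') (Cmod_char_le p _ D1')) as (f & s2 & Hf2 & Hs2).
    assert (Z1 := sigma_exp_sum k chi1 chi2 y e s1 Py (Cmod_char_le p chi1 D1) (Cmod_char_le q chi2 D2) He1 Hs1).
    assert (Z2 := sigma_exp_sum k _ _ y' f s2 Py' (Cmod_char_le q _ D2') (Cmod_char_le p _ D1') Hf2 Hs2).
    (* The modular relation is stated for [k = j + 1]; [k + 1 = 2 m0] excludes [k = 0]. *)
    destruct k as [|j]; [lia|].
    assert (MR := modular_relation p q chi1 chi2 m0 j y e f s1 s2 Hp1 Hp2 Hp Hq Hpar He ltac:(lia) Py
                    He1 Hf2 Hs1 Hs2).
    fold tau1 tau2 in MR.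
    set (w := (RtoC (exp (- (B * exp (- t)))) * Cexp (- nu * t))%C).
    exists (tau1 * w * s1)%C. split.
    - eapply Csum_ext; [|exact (Csum_scal (tau1 * w)%C _ _ Z1)].
      intros n. cbv beta. unfold Phi, w. fold (sg n). fold y.
      replace (- (INR (S n) * y) - B * exp (- t)) with (- (B * exp (- t)) + - (INR (S n) * y)) by ring.
      rewrite exp_plus, RtoC_mult. ring.
    (* The factor [y^(-k-1)] of the modular relation is [e^(-(k+1) t)] and raises the exponent from
       [nu] to [s]. *)
    - replace (tau1 * w * s1)%C with (Cst * (w * RtoC (exp (- (INR (S j + 1) * t)))) * s2)%C.
      + eapply Csum_ext; [|exact (Csum_scal (Cst * (w * RtoC (exp (- (INR (S j + 1) * t)))))%C _ _ Z2)].
        intros n. cbv beta. unfold Phi, w. fold (sg' n). rewrite Ey'.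
        replace (- (0 * exp t) - (c0 * INR (S n) + B) * exp (- t))
          with (- (B * exp (- t)) + - (INR (S n) * (c0 * exp (- t)))) by ring.
        replace (- s * t)%C with (- nu * t + RtoC (- (INR (S j + 1) * t)))%C
          by (unfold s; rewrite plus_INR, RtoC_opp, RtoC_mult, RtoC_plus; simpl (INR 1); ring).
        rewrite Cexp_plus, Cexp_RtoC, exp_plus, RtoC_mult. ring.
      + replace (tau1 * w * s1)%C with (w * (tau1 * s1))%C by ring. rewrite MR. unfold Cst.
        replace (2 + j)%nat with (S j + 1)%nat by lia.
        assert (E : (/ RtoC (INR q * y / (2 * PI)) ^ (S j + 1)
                     = RtoC (2 * PI / INR q) ^ (S j + 1) * RtoC (exp (- (INR (S j + 1) * t))))%C).
        { rewrite <- !RtoC_pow, <- RtoC_inv, <- RtoC_mult.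
          - f_equal. rewrite <- pow_inv.
            replace (exp (- (INR (S j + 1) * t))) with ((/ y) ^ (S j + 1)).
            + rewrite <- Rpow_mult_distr. f_equal. field. repeat split; lra.
            + unfold y. rewrite <- exp_Ropp, <- Rpower_pow by apply exp_pos.
              unfold Rpower. rewrite ln_exp. f_equal; ring.
          - apply pow_nonzero. apply Rgt_not_eq, Rdiv_lt_0_compat; [now apply Rmult_lt_0_compat | lra]. }
        rewrite E. ring. }
  destruct (choose_fun _ Hpt) as [SS HSS].
  apply (Csum_FI_eq (fun n t => tau1 * sg n * Phi (INR (S n)) B (- nu) t)%C
           (fun n t => Cst * sg' n * Phi 0 (c0 * INR (S n) + B) (- s) t)%C _ _ SS
           (fun n => (Cmod tau1 * Em * K1) * (Cmod (sg n) * Rpower (INR (S n)) (- m)))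
           (fun n => (Cmod Cst * (Em * Rpower c0 (- m)) * K2) * (Cmod (sg' n) * Rpower (INR (S n)) (- m))) al).
  - exact Pal.
  - intros n. apply contC_scal, contC_Phi.
  - intros n. apply contC_scal, contC_Phi.
  - intros n t. rewrite !Cmod_mult, Cmod_Phi.
    replace (Re (- nu)%C) with (- Re nu) by (destruct nu; reflexivity).
    assert (PN := INR_S_pos n).
    assert (E := Rpower_exp_bound m (INR (S n) * exp t) Pm ltac:(apply Rmult_lt_0_compat; auto; apply exp_pos)).
    rewrite <- Rpower_mult_distr in E by (auto; apply exp_pos).
    replace (Rpower (exp t) (- m)) with (exp (- m * t)) in E by (unfold Rpower; now rewrite ln_exp).
    fold Em in E. specialize (HK1 t).
    replace (exp (- (Re nu + m) * t)) with (exp (- m * t) * exp (- Re nu * t)) in HK1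
      by (rewrite <- exp_plus; f_equal; ring).
    set (u := exp (- (B * exp (- t)))) in *. set (v := exp (- Re nu * t)) in *.
    set (w := exp (- (al * Rabs t))) in *.
    assert (Puv : 0 <= u * v) by (apply Rmult_le_pos; left; apply exp_pos).
    apply Rle_trans with (Cmod tau1 * Cmod (sg n) * (Em * (Rpower (INR (S n)) (- m) * exp (- m * t)) * (u * v))).
    + apply Rmult_le_compat_l; [apply Rmult_le_pos; apply Cmod_ge_0|]. now apply Rmult_le_compat_r.
    + assert (F : 0 <= Cmod tau1 * Cmod (sg n) * Em * Rpower (INR (S n)) (- m)).
      { repeat apply Rmult_le_pos; try apply Cmod_ge_0; [lra | left; apply Rpower_pos]. }
      apply (Rmult_le_compat_l _ _ _ F) in HK1. lra.
  - intros n t. rewrite !Cmod_mult, Cmod_Phi.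
    replace (Re (- s)%C) with (- Re s) by reflexivity. rewrite Rs.
    assert (PN := INR_S_pos n).
    replace (exp (- (0 * exp t))) with 1 by (rewrite Rmult_0_l, Ropp_0, exp_0; auto). rewrite Rmult_1_l.
    replace (exp (- ((c0 * INR (S n) + B) * exp (- t))))
      with (exp (- (c0 * INR (S n) * exp (- t))) * exp (- (B * exp (- t))))
      by (rewrite <- exp_plus; f_equal; ring).
    assert (E := exp_weight_power (c0 * INR (S n)) m t ltac:(now apply Rmult_lt_0_compat) Pm).
    rewrite <- Rpower_mult_distr in E by auto. fold Em in E.
    specialize (HK2 t).
    replace (exp (- (Re nu - eta) * t)) with (exp (m * t) * exp (- (Re nu + INR k + 1) * t)) in HK2
      by (rewrite <- exp_plus; f_equal; unfold m; ring).
    set (u := exp (- (B * exp (- t)))) in *. set (v := exp (- (Re nu + INR k + 1) * t)) in *.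
    set (w := exp (- (al * Rabs t))) in *.
    assert (Puv : 0 <= u * v) by (apply Rmult_le_pos; left; apply exp_pos).
    apply Rle_trans with (Cmod Cst * Cmod (sg' n)
       * (Em * (Rpower c0 (- m) * Rpower (INR (S n)) (- m)) * exp (m * t) * (u * v))).
    + apply Rmult_le_compat_l; [apply Rmult_le_pos; apply Cmod_ge_0|].
      rewrite Rmult_assoc. now apply Rmult_le_compat_r.
    + assert (F : 0 <= Cmod Cst * Cmod (sg' n) * Em * Rpower c0 (- m) * Rpower (INR (S n)) (- m)).
      { repeat apply Rmult_le_pos; try apply Cmod_ge_0; try (left; apply Rpower_pos); lra. }
      apply (Rmult_le_compat_l _ _ _ F) in HK2. lra.
  - apply ex_series_scal_R, X1.
  - apply ex_series_scal_R, X2.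
  - intros t. apply HSS.
  - intros t. apply HSS.
  - intros n. apply FI_scal; [apply contC_Phi|]. apply Phi_Bessel; auto. apply INR_S_pos.
  - intros n. apply FI_scal; [apply contC_Phi|]. apply Phi_Gamma; [|lra].
    generalize (INR_S_pos n). nra.
Qed.

(** Each factor is the exponential of a combination of the logarithms of 2, [PI], [p], [q], [a] and
    [x], so the identity is one between exponents. *)
Lemma constant_identity k (p q : nat) a x nu :
  (0 < p)%nat -> (0 < q)%nat -> 0 < a -> 0 < x ->
  (Rcpow (a ^ 2 * x / 4) (nu / 2) / 2 * (RtoC (2 * PI / INR q) ^ (k + 1) / INR p)
   / Rcpow (4 * PI ^ 2 / (INR p * INR q)) (nu + RtoC (INR k) + 1)
   = Rcpow (a * INR q) nu * Rcpow (INR p) (nu + RtoC (INR k)) * Rcpow x (nu / 2)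
     / (Rcpow 2 (3 * nu + RtoC (INR k) + 2) * Rcpow PI (2 * nu + RtoC (INR k) + 1)))%C.
Proof.
  intros Hp Hq Ha Hx. assert (Hpi := PI_gt_3).
  assert (Q : 0 < INR q) by (apply lt_0_INR; lia). assert (P : 0 < INR p) by (apply lt_0_INR; lia).
  assert (RE : forall r, 0 < r -> RtoC r = Cexp (RtoC (ln r))) by (intros; rewrite Cexp_RtoC, exp_ln; auto).
  assert (Two : RtoC 2 <> 0%C) by (apply RtoC_neq_0; lra).
  assert (Pq : 0 < 2 * PI / INR q) by (apply Rdiv_lt_0_compat; lra).
  assert (E1 : ln (a ^ 2 * x / 4) = 2 * ln a + ln x - 2 * ln 2).
  { rewrite ln_div, ln_mult by (try apply Rmult_lt_0_compat; try apply pow_lt; lra).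
    replace 4 with (2 ^ 2) by ring. rewrite !ln_pow by lra. simpl; ring. }
  assert (E2 : ln (4 * PI ^ 2 / (INR p * INR q)) = 2 * ln 2 + 2 * ln PI - ln (INR p) - ln (INR q)).
  { rewrite ln_div, !ln_mult by (try apply Rmult_lt_0_compat; try apply pow_lt; lra).
    replace 4 with (2 ^ 2) by ring. rewrite !ln_pow by lra. simpl; ring. }
  assert (E3 : ln (2 * PI / INR q) = ln 2 + ln PI - ln (INR q)).
  { rewrite ln_div, ln_mult by lra. ring. }
  assert (M : (RtoC (2 * PI / INR q) ^ (k + 1) = Cexp ((INR k + 1) * (ln 2 + ln PI - ln (INR q))))%C).
  { rewrite (RE _ Pq), <- Cexp_nat, E3, plus_INR, RtoC_plus, RtoC_minus, RtoC_plus. reflexivity. }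
  rewrite M. unfold Rcpow. rewrite E1, E2, ln_mult by auto.
  rewrite (RE (INR p)) at 1 by auto.
  assert (T1 : forall u v l w : C, (Cexp u / 2 * (Cexp v / Cexp l) / Cexp w
                                    = Cexp (u - RtoC (ln 2) + v - l - w))%C).
  { intros u v l w. unfold Cminus. rewrite !Cexp_plus, !Cexp_opp, <- RE by lra.
    field. repeat split; auto using Cexp_neq_0. }
  assert (T2 : forall u v w y z : C, (Cexp u * Cexp v * Cexp w / (Cexp y * Cexp z)
                                    = Cexp (u + v + w - y - z))%C).
  { intros u v w y z. unfold Cminus. rewrite !Cexp_plus, !Cexp_opp.
    field. repeat split; auto using Cexp_neq_0. }
  rewrite T1, T2. f_equal.
  repeat rewrite ?RtoC_plus, ?RtoC_minus, ?RtoC_mult. field.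
Qed.

Theorem theorem2p10 (k p q : nat) (chi1 chi2 : nat -> C) (a x : R) (nu : C) :
  Nat.odd k = true ->
  is_primitive_char p chi1 -> is_primitive_char q chi2 ->
  ((is_even_char p chi1 /\ ~ is_principal p chi1 /\
    is_even_char q chi2 /\ ~ is_principal q chi2) \/
   (is_odd_char p chi1 /\ is_odd_char q chi2)) ->
  0 < a -> 0 < x -> 0 < Re nu ->
  exists L : C,
    is_series (fun n : nat =>
      (sigma_char (RtoC (INR k)) (conj_char chi2) (conj_char chi1) (S n)
       / Rcpow (INR (S n) + a ^ 2 * INR p * INR q * x / (16 * PI ^ 2))
               (nu + RtoC (INR k) + 1))%C) L /\
    is_series (fun n : nat =>
      (sigma_char (RtoC (INR k)) chi1 chi2 (S n) * Rcpow (INR (S n)) (nu / 2)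
       * BesselK nu (a * sqrt (INR (S n) * x)))%C)
      (RtoC ((-1) ^ ((k + 1) / 2)) * Rcpow (a * INR q) nu
       * Rcpow (INR p) (nu + RtoC (INR k)) * Rcpow x (nu / 2)
       / (Rcpow 2 (3 * nu + RtoC (INR k) + 2)
          * Rcpow PI (2 * nu + RtoC (INR k) + 1))
       * gauss_sum p chi1 * gauss_sum q chi2 * CGamma (nu + RtoC (INR k) + 1)
       * L)%C.
Proof.
  intros Hk Hp1 Hp2 Hpar Ha Hx Hnu. assert (Hpi := PI_gt_3).
  assert (D1 := proj1 Hp1). assert (D2 := proj1 Hp2).
  assert (Hpq : (1 < p)%nat /\ (1 < q)%nat /\ chi1 (p - 1)%nat = chi2 (q - 1)%nat /\
                (chi2 (q - 1)%nat * chi2 (q - 1)%nat = 1)%C).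
  { unfold is_even_char, is_odd_char in Hpar.
    destruct Hpar as [(V1 & N1 & V2 & N2) | (O1 & O2)].
    - rewrite V1, V2. repeat split; [now apply (modulus_gt_1 p chi1) | now apply (modulus_gt_1 q chi2) | ring].
    - rewrite O1, O2.
      repeat split; [now apply (odd_modulus_gt_1 p chi1) | now apply (odd_modulus_gt_1 q chi2) | ring]. }
  destruct Hpq as (Hp & Hq & He & Hee).
  assert (Q : 0 < INR q) by (apply lt_0_INR; lia). assert (P : 0 < INR p) by (apply lt_0_INR; lia).
  destruct (proj1 (Nat.odd_spec k) Hk) as [j Hj].
  set (m0 := S j). assert (Hm0 : (k + 1 = 2 * m0)%nat) by (unfold m0; lia).
  assert (Hm : ((k + 1) / 2 = m0)%nat) by (rewrite Hm0, Nat.mul_comm; apply Nat.div_mul; lia).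
  rewrite Hm.
  (* Chosen so that [2 sqrt (n B) = a sqrt (n x)]. *)
  set (B := a ^ 2 * x / 4).
  assert (PB : 0 < B) by (apply Rdiv_lt_0_compat; [apply Rmult_lt_0_compat; auto; now apply pow_lt | lra]).
  set (c0 := 4 * PI ^ 2 / (INR p * INR q)).
  assert (Pc0 : 0 < c0) by (apply Rdiv_lt_0_compat; [nra | now apply Rmult_lt_0_compat]).
  set (s := (nu + RtoC (INR k) + 1)%C).
  assert (Rs : Re s = INR k + 1 + Re nu) by (unfold s; destruct nu; simpl; ring).
  set (b := a ^ 2 * INR p * INR q * x / (16 * PI ^ 2)).
  (* Extracting [c0] from [c0 n + B] leaves [n + b], the denominator of the claim. *)
  assert (Eb : B = c0 * b) by (unfold B, c0, b; field; repeat split; lra).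
  assert (Pb : 0 < b).
  { apply Rmult_lt_reg_l with c0; auto. rewrite Rmult_0_r, <- Eb; auto. }
  set (sg' := fun n => sigma_char (RtoC (INR k)) (conj_char chi2) (conj_char chi1) (S n)).
  assert (NR : forall r z, Rcpow r z <> 0%C) by (intros; apply Cexp_neq_0).
  (* Dropping [b > 0] only enlarges the terms, and the divisor sums are summable against
     [n^(-k-1-Re nu)]. *)
  destruct (Csum_ex (fun n => sg' n / Rcpow (INR (S n) + b) s)%C
     (fun n => Cmod (sg' n) * Rpower (INR (S n)) (- (INR k + 1 + Re nu)))) as [L HL].
  { intros n. rewrite Cmod_div, Cmod_Rcpow, Rs by auto.
    apply Rmult_le_compat_l; [apply Cmod_ge_0|]. rewrite Rpower_Ropp.
    assert (PN := INR_S_pos n). assert (PK := pos_INR k).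
    apply Rinv_le_contravar; [apply Rpower_pos|]. apply Rle_Rpower_l; lra. }
  { apply sigma_series_abs; auto.
    - apply (Cmod_char_le q), conj_char_dirichlet, D2.
    - apply (Cmod_char_le p), conj_char_dirichlet, D1. }
  exists L. split; [now apply Csum_is_series|]. apply Csum_is_series.
  destruct (sigma_bessel_gamma k p q chi1 chi2 m0 B nu Hp1 Hp2 Hp Hq He Hee Hm0 PB Hnu) as [S [S1 S2]].
  set (eps := chi2 (q - 1)%nat) in *.
  set (tau1' := gauss_sum p (conj_char chi1)) in *. set (tau2 := gauss_sum q chi2) in *.
  set (tau1 := gauss_sum p chi1). fold c0 s in S2.
  set (M := (RtoC (2 * PI / INR q) ^ (k + 1))%C) in *.
  assert (GG := gauss_sum_conj p chi1 Hp1). fold tau1' tau1 in GG. rewrite He in GG.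
  assert (NP : RtoC (INR p) <> 0%C) by (apply RtoC_neq_0; lra).
  assert (NT : tau1' <> 0%C).
  { intros Z. apply NP. rewrite <- GG, Z. ring. }
  assert (ES : S = (M * (eps * (-1) ^ m0) * tau2 * CGamma s / Rcpow c0 s * L)%C).
  { apply (Csum_unique _ _ _ S2).
    eapply Csum_ext; [|exact (Csum_scal (M * (eps * (-1) ^ m0) * tau2 * CGamma s / Rcpow c0 s)%C _ _ HL)].
    intros n. cbv beta. fold (sg' n).
    replace (c0 * INR (Datatypes.S n) + B) with (c0 * (INR (Datatypes.S n) + b)) by (rewrite Eb; ring).
    rewrite Rcpow_mult by (auto; generalize (INR_S_pos n); lra). field. auto. }
  assert (Two : RtoC 2 <> 0%C) by (apply RtoC_neq_0; lra).
  match goal with |- Csum _ ?v => replace v with (Rcpow B (nu / 2) / (2 * tau1') * S)%C end.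
  - eapply Csum_ext; [|exact (Csum_scal (Rcpow B (nu / 2) / (2 * tau1'))%C _ _ S1)].
    intros n. cbv beta.
    replace (2 * sqrt (INR (Datatypes.S n) * B)) with (a * sqrt (INR (Datatypes.S n) * x)).
    + field. repeat split; auto.
    + rewrite <- (sqrt_Rsqr a) at 1 by lra. rewrite <- (sqrt_Rsqr 2) by lra.
      assert (PN := INR_S_pos n).
      rewrite <- !sqrt_mult by (try apply Rle_0_sqr; apply Rmult_le_pos; lra).
      f_equal. unfold Rsqr, B. field.
  - rewrite ES.
    assert (CI := constant_identity k p q a x nu ltac:(lia) ltac:(lia) Ha Hx).
    fold B c0 s M in CI.
    rewrite RtoC_pow.
    transitivity ((-1) ^ m0 * (Rcpow (a * INR q) nu * Rcpow (INR p) (nu + INR k) * Rcpow x (nu / 2) /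
       (Rcpow 2 (3 * nu + INR k + 2) * Rcpow PI (2 * nu + INR k + 1))) * tau1 * tau2 * CGamma s * L)%C.
    2: { field. auto. }
    rewrite <- CI.
    (* The product formula brings in [tau(chi1)] and [1 / p], and its [eps] cancels the one from the
       modular relation, so that only [(-1)^m0] remains. *)
    assert (IT : (/ tau1' = tau1 * eps / INR p)%C).
    { transitivity (tau1' * tau1 * eps / INR p / tau1')%C; [rewrite GG; field; auto | field; auto]. }
    replace (Rcpow B (nu / 2) / (2 * tau1'))%C with (Rcpow B (nu / 2) / 2 * / tau1')%C by (field; auto).
    rewrite IT.
    transitivity ((eps * eps) * ((-1) ^ m0 * (Rcpow B (nu / 2) / 2 * (M / INR p) / Rcpow c0 s)
       * tau1 * tau2 * CGamma s * L))%C; [field; auto|].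
    rewrite Hee. ring.
Qed.
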